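(* Let $N\ge 2$ and let $\Phi_N(x,y)\in\mathbb Z[x,y]$ be the classical modular polynomial. Then the total degree of $\Phi_N(x,y)$ (as a polynomial in the two independent variables $x,y$) equals the degree of the one-variable polynomial $\Phi_N(x,x)$, namely $$\deg\Phi_N(x,y)=2\sum_{\substack{k\mid N\\ N\ge k>\sqrt N}}\frac{k}{(k,N/k)}\,\varphi\big((k,N/k)\big)+\varphi(\sqrt N).$$
   Context: $j$ denotes the elliptic modular $j$-function. The classical modular polynomial $\Phi_N\in\mathbb Z[x,y]$ is the minimal polynomial of $j(Nz)$ over $\mathbb C(j)$, written as a polynomial in two variables with $\Phi_N(j(z),j(Nz))=0$; it is symmetric and irreducible in $\mathbb C[x,y]$. $\varphi$ is Euler's function, $(a,b)$ is the greatest common divisor, and by convention $\varphi(\sqrt N)=0$ if $N$ is not a perfect square. *)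

(* Defs.v *)
From HB Require Import structures.
From mathcomp Require Import all_boot all_order all_algebra all_field.
Set Implicit Arguments. Unset Strict Implicit. Unset Printing Implicit Defensive.
Import Order.TTheory GRing.Theory Num.Theory.
Local Open Scope ring_scope.

Definition fps := nat -> algC.
Definition fps_one : fps := fun n => if n == 0%N then 1 else 0.
Definition fps_mul (f g : fps) : fps :=
  fun n => \sum_(i < n.+1) f i * g (n - i)%N.
Fixpoint fps_pow (f : fps) (k : nat) : fps :=
  match k with 0%N => fps_one | k'.+1 => fps_mul f (fps_pow f k') end.
Definition fps_shift (k : nat) (f : fps) : fps :=
  fun n => if (k <= n)%N then f (n - k)%N else 0.

(* ---------- q-expansion of j:  j(q) = q^{-1} * qj(q),  q = e^{2 pi i z} ---------- *)
Definition sigma3 (n : nat) : nat := \sum_(d <- divisors n) d ^ 3.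
Definition E4 : fps := fun n => if n == 0%N then 1 else (240 * sigma3 n)%:R.
(* Delta / q = prod_{m>=1} (1 - q^m)^24 ; coefficient n only involves m <= n *)
Definition DeltaQ : fps := fun n =>
  ((\prod_(1 <= m < n.+1) (1 - 'X^m) ^+ 24 : {poly int})`_n)%:~R.
Definition E4cube : fps := fps_pow E4 3.
(* qj is the unique series with qj * DeltaQ = E4^3 (DeltaQ 0 = 1) *)
Fixpoint qj_list (n : nat) : seq algC :=
  match n with
  | 0%N => [:: E4cube 0%N]
  | n'.+1 => let s := qj_list n' in
      rcons s (E4cube n - \sum_(i < n) s`_i * DeltaQ (n - i)%N)
  end.
Definition qj : fps := fun n => (qj_list n)`_n.
(* q^N j(q^N) *)
Definition qjN (N : nat) : fps := fun n => if (N %| n)%N then qj (n %/ N)%N else 0.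

(* ---------- bivariate polynomials: P : {poly {poly algC}}, outer var y, inner var x ---------- *)
Definition ycoef (P : {poly {poly algC}}) (b : nat) : {poly algC} := P`_b.
Definition xbound (P : {poly {poly algC}}) : nat := (\max_(b < size P) size (ycoef P b))%N.

(* q^(A + N*B) * P(j(q), j(q^N)) as a formal power series, with A = xbound P, B = size P *)
Definition jsubst (N : nat) (P : {poly {poly algC}}) : fps := fun n =>
  \sum_(b < size P) \sum_(a < xbound P)
     P`_b`_a * fps_mul (fps_shift (xbound P - a) (fps_pow qj a))
                       (fps_shift (N * (size P - b)) (fps_pow (qjN N) b)) n.

Definition vanishes_jN (N : nat) (P : {poly {poly algC}}) : Prop :=
  forall n, jsubst N P n = 0.

(* P is the classical modular polynomial Phi_N: the minimal polynomial of j(Nz)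
   over C(j), i.e. monic in y with coefficients in C[x] (x = j) and of minimal
   y-degree among nonzero polynomials vanishing at (j(z), j(Nz)). *)
Definition is_modular_poly (N : nat) (P : {poly {poly algC}}) : Prop :=
  [/\ P \is monic, vanishes_jN N P &
      forall Q : {poly {poly algC}}, Q != 0 -> vanishes_jN N Q -> (size P <= size Q)%N].

Definition totdeg (P : {poly {poly algC}}) : nat :=
  (\max_(b < size P | ycoef P b != 0%R) (b + (size (ycoef P b)).-1))%N.

Definition diag (P : {poly {poly algC}}) : {poly algC} := P.['X].

Definition phi_sqrt (N : nat) : nat :=
  if (Nat.sqrt N * Nat.sqrt N == N)%N then totient (Nat.sqrt N) else 0%N.

Definition deg_formula (N : nat) : nat :=
  (2 * \sum_(k <- divisors N | (N < k * k)%N)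
          (k %/ gcdn k (N %/ k)) * totient (gcdn k (N %/ k)) + phi_sqrt N)%N.

(* Main.v *)
Require Import Defs.
From Stdlib Require PeanoNat.
From HB Require Import structures.
From mathcomp Require Import all_boot all_order all_algebra all_field.
From mathcomp Require Import boolp classical_sets reals topology normedtype sequences derive exp trigo.
From mathcomp Require Import complex.
From mathcomp Require Rstruct.
From mathcomp Require Import zify ring lra.

(** Write J_alpha(z) = j((a z + b)/d) for the primitive matrices alpha = (a, b; 0, d) of
    determinant N = a d with 0 <= b < d. Elementary convolution sums give Ramanujan's
    differential equations, hence E4^3 - E6^2 = 1728 Delta; Lipschitz's summation formula
    gives the modularity of E4 and E6; so the q-expansion of j defines a function with
    j(-1/z) = j(z). A function on the upper half-plane that is invariant under z + 1 and
    -1/z and has a finite polar part in q^(1/N) is a polynomial in j, by a Liouville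
    argument. Therefore prod_alpha (Y - J_alpha) = Phi(j, Y) with Phi monic in Y. The
    J_alpha are distinct and SL_2(Z) permutes them transitively, so no relation between
    j(z) and j(Nz) has smaller degree in Y. Since q-expansions have rational coefficients,
    Q-linear forms on coefficients carry relations from C to Q and from algC to Q.

    Let z tend to i oo and w = e^(2 i pi z/N). Then w^max(N, a^2) (j - J_alpha) has a
    nonzero limit, so N deg Phi(x, x) = sum_alpha max(N, a^2), which is N times the
    asserted degree; the same exponents bound the coefficients of prod_alpha (Y - J_alpha)
    and hence the total degree. *)

Set Implicit Arguments. Unset Strict Implicit. Unset Printing Implicit Defensive.
Import Order.TTheory GRing.Theory Num.Theory.
Import numFieldNormedType.Exports.
Import Normc.
Local Open Scope ring_scope.

(** * Sums over a x + b y = n *)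

(* The quadruples ((a, b), (x, y)) of positive integers with a x + b y = n. *)
Definition quads (n : nat) : seq ((nat * nat) * (nat * nat)) :=
  [seq t <- [seq (u, v) | u <- [seq (a, b) | a <- iota 1 n, b <- iota 1 n],
                          v <- [seq (x, y) | x <- iota 1 n, y <- iota 1 n]]
     | (t.1.1 * t.2.1 + t.1.2 * t.2.2 == n)%N].

Lemma mem_quads n a b x y : ((a, b), (x, y)) \in quads n =
  [&& (0 < a)%N, (0 < b)%N, (0 < x)%N, (0 < y)%N & (a * x + b * y == n)%N].
Proof.
rewrite mem_filter /=; apply/andP/and5P.
  move=> [/eqP E /allpairsP [[u v] /= [Hu Hv [Eu Ev]]]].
  move: Hu Hv; rewrite -{}Eu -{}Ev => /allpairsP [[a' b'] /= [Ha Hb [Ea Eb]]].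
  move=> /allpairsP [[x' y'] /= [Hx Hy [Ex Ey]]].
  move: Ha Hb Hx Hy; rewrite !mem_iota -Ea -Eb -Ex -Ey.
  by move=> /andP[? _] /andP[? _] /andP[? _] /andP[? _]; split => //; apply/eqP.
move=> [a0 b0 x0 y0 /eqP E]; split; first by apply/eqP.
have I c d e : (0 < c)%N -> (0 < d)%N -> (c * d + e = n)%N -> c \in iota 1 n.
  by move=> c0 d0 H; rewrite mem_iota c0 /=; nia.
apply: allpairs_f; apply: allpairs_f.
- exact: (I _ _ _ a0 x0 E).
- by apply: (I b y (a * x)%N) => //; rewrite addnC.
- by apply: (I x a (b * y)%N) => //; rewrite mulnC.
- by apply: (I y b (a * x)%N) => //; rewrite addnC mulnC -E; lia.
Qed.

Lemma uniq_quads n : uniq (quads n).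
Proof.
apply: filter_uniq; apply: allpairs_uniq.
- by apply: allpairs_uniq; rewrite ?iota_uniq // => -[? ?] [? ?].
- by apply: allpairs_uniq; rewrite ?iota_uniq // => -[? ?] [? ?].
- by move=> [? ?] [? ?].
Qed.

Lemma sum_quads_map (V : zmodType) n (p q : pred (nat * nat * (nat * nat))) f g
    (H : nat * nat * (nat * nat) -> V) :
  (forall t, t \in quads n -> p t -> [/\ f t \in quads n, q (f t) & g (f t) = t]) ->
  (forall t, t \in quads n -> q t -> [/\ g t \in quads n, p (g t) & f (g t) = t]) ->
  \sum_(t <- quads n | q t) H t = \sum_(t <- quads n | p t) H (f t).
Proof.
have := uniq_quads n; move: (quads n) => s Us fP gP; rewrite -big_filter -[RHS]big_filter -(big_map f predT H).
apply: perm_big; apply: uniq_perm.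
- exact: filter_uniq.
- rewrite map_inj_in_uniq ?filter_uniq // => u t.
  rewrite !mem_filter => /andP[ps Ms] /andP[pt Mt] E.
  by have [_ _ <-] := fP _ Ms ps; have [_ _ <-] := fP _ Mt pt; rewrite E.
- move=> t; rewrite mem_filter; apply/andP/mapP.
    move=> [qt Mt]; have [? ? E] := gP _ Mt qt; exists (g t); last by rewrite E.
    by rewrite mem_filter; apply/andP.
  by move=> [u]; rewrite mem_filter => /andP[ps Ms] ->; have [] := fP _ Ms ps.
Qed.

(* The bijection [(a, b, x, y) -> (a - b, b, x, x + y)] exchanges [a > b] and [x < y]. *)
Lemma sum_quads_telescope (K : fieldType) (h : K -> K -> K) n :
  (forall u v, h u (v - u) = h (u - v) v) ->
  \sum_(t <- quads n) (h t.1.1%:R t.1.2%:R - h (t.1.1%:R - t.1.2%:R) t.1.2%:R) =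
  \sum_(t <- quads n | t.2.1 == t.2.2) h t.1.1%:R t.1.2%:R
  - \sum_(t <- quads n | t.1.1 == t.1.2) h 0 t.1.2%:R.
Proof.
move=> hsym.
have split3 (F : nat * nat * (nat * nat) -> K) (l r : nat * nat * (nat * nat) -> nat) :
    \sum_(t <- quads n) F t = \sum_(t <- quads n | (l t < r t)%N) F t +
    \sum_(t <- quads n | (r t < l t)%N) F t + \sum_(t <- quads n | l t == r t) F t.
  rewrite (bigID (fun t => (l t < r t)%N)) /= -addrA; congr (_ + _).
  rewrite (bigID (fun t => (r t < l t)%N)) /=; congr (_ + _); apply: eq_bigl => t; lia.
rewrite sumrB.
rewrite [X in X - _](split3 _ (fun t => t.2.1) (fun t => t.2.2)).
rewrite [X in _ - X](split3 _ (fun t => t.1.1) (fun t => t.1.2)).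
rewrite (@sum_quads_map _ n (fun t => (t.1.2 < t.1.1)%N) (fun t => (t.2.1 < t.2.2)%N)
  (fun t => ((t.1.1 - t.1.2, t.1.2), (t.2.1, t.2.1 + t.2.2))%N)
  (fun t => ((t.1.1 + t.1.2, t.1.2), (t.2.1, t.2.2 - t.2.1))%N)); first last.
- move=> [[a b] [x y]]; rewrite !mem_quads /= => /and5P[? ? ? ? /eqP ?] ?; split.
  + by apply/and5P; split; try lia; apply/eqP; nia.
  + lia.
  + by congr (_, _, (_, _)); lia.
- move=> [[a b] [x y]]; rewrite !mem_quads /= => /and5P[? ? ? ? /eqP ?] ?; split.
  + by apply/and5P; split; try lia; apply/eqP; nia.
  + lia.
  + by congr (_, _, (_, _)); lia.
rewrite (@sum_quads_map _ n (fun t => (t.1.1 < t.1.2)%N) (fun t => (t.2.2 < t.2.1)%N)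
  (fun t => ((t.1.1, t.1.2 - t.1.1), (t.2.1 + t.2.2, t.2.2))%N)
  (fun t => ((t.1.1, t.1.2 + t.1.1), (t.2.1 - t.2.2, t.2.2))%N)); first last.
- move=> [[a b] [x y]]; rewrite !mem_quads /= => /and5P[? ? ? ? /eqP ?] ?; split.
  + by apply/and5P; split; try lia; apply/eqP; nia.
  + lia.
  + by congr (_, _, (_, _)); lia.
- move=> [[a b] [x y]]; rewrite !mem_quads /= => /and5P[? ? ? ? /eqP ?] ?; split.
  + by apply/and5P; split; try lia; apply/eqP; nia.
  + lia.
  + by congr (_, _, (_, _)); lia.
under eq_bigr => t lt do rewrite natrB ?(ltnW lt) //.
under [X in _ + X + _ - _]eq_bigr => t lt do rewrite natrB ?(ltnW lt) // hsym.
under [X in _ - (_ + _ + X)]eq_bigr => t /eqP -> do rewrite subrr.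
by ring.
Qed.

(** * Formal power series *)

Record pser (K : Type) := PSer { cf : nat -> K }.

Lemma pserP (K : Type) (f g : pser K) : (forall n, cf f n = cf g n) -> f = g.
Proof. by case: f => f; case: g => g /= H; congr PSer; apply/funext. Qed.

HB.instance Definition _ (K : Type) := gen_eqMixin (pser K).
HB.instance Definition _ (K : Type) := gen_choiceMixin (pser K).

Section PowerSeriesRing.
Variable K : comNzRingType.
Implicit Types f g h : pser K.

Definition pconst (c : K) := PSer (fun n => if n == 0%N then c else 0).
Definition padd f g := PSer (fun n => cf f n + cf g n).
Definition popp f := PSer (fun n => - cf f n).
Definition pmul f g := PSer (fun n => \sum_(i < n.+1) cf f i * cf g (n - i)).

Let trunc n f : {poly K} := \poly_(i < n.+1) cf f i.

Let cf_pmul n k f g : (k <= n)%N -> cf (pmul f g) k = (trunc n f * trunc n g)`_k.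
Proof.
move=> kn; rewrite coefM /=; apply: eq_bigr => i _.
by rewrite !coef_poly !ifT //; have := ltn_ord i; lia.
Qed.

Let coef_trunc n k f : (k <= n)%N -> (trunc n f)`_k = cf f k.
Proof. by move=> kn; rewrite coef_poly ltnS kn. Qed.

Let paddA : associative padd.
Proof. by move=> f g h; apply: pserP => n /=; rewrite addrA. Qed.
Let paddC : commutative padd.
Proof. by move=> f g; apply: pserP => n /=; rewrite addrC. Qed.
Let padd0 : left_id (pconst 0) padd.
Proof. by move=> f; apply: pserP => n /=; rewrite if_same add0r. Qed.
Let paddN : left_inverse (pconst 0) popp padd.
Proof. by move=> f; apply: pserP => n /=; rewrite if_same addNr. Qed.

HB.instance Definition _ := GRing.isZmodule.Build (pser K) paddA paddC padd0 paddN.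

Let pmulC : commutative pmul.
Proof. by move=> f g; apply: pserP => n; rewrite !(@cf_pmul n n) // mulrC. Qed.

Let pmulA : associative pmul.
Proof.
have H n f g h : cf (pmul f (pmul g h)) n = (trunc n f * (trunc n g * trunc n h))`_n.
  rewrite coefM /=; apply: eq_bigr => i _.
  by rewrite coef_trunc -?cf_pmul //; have := ltn_ord i; lia.
move=> f g h; apply: pserP => n.
by rewrite [in RHS]pmulC !H; congr (_ `_ _); rewrite mulrCA mulrC -mulrA mulrCA.
Qed.

Let pmul1 : left_id (pconst 1) pmul.
Proof.
move=> f; apply: pserP => n /=; rewrite big_ord_recl /= mul1r subn0 big1 ?addr0 // => i _.
by rewrite mul0r.
Qed.

Let pmulDl : left_distributive pmul padd.
Proof.
by move=> f g h; apply: pserP => n /=; rewrite -big_split; apply: eq_bigr => i _; rewrite mulrDl.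
Qed.

Let pone_neq0 : pconst 1 != 0.
Proof. by apply/eqP => /(congr1 (fun f => cf f 0)) /= /eqP; rewrite oner_eq0. Qed.

HB.instance Definition _ := GRing.Zmodule_isComNzRing.Build (pser K)
  pmulA pmulC pmul1 pmulDl pone_neq0.

Lemma cfD f g n : cf (f + g) n = cf f n + cf g n. Proof. by []. Qed.
Lemma cfN f n : cf (- f) n = - cf f n. Proof. by []. Qed.
Lemma cfB f g n : cf (f - g) n = cf f n - cf g n. Proof. by []. Qed.
Lemma cf0 n : cf (0 : pser K) n = 0. Proof. exact: if_same. Qed.
Lemma cf1 n : cf (1 : pser K) n = (n == 0%N)%:R. Proof. by rewrite /=; case: eqP. Qed.
Lemma cfM f g n : cf (f * g) n = \sum_(i < n.+1) cf f i * cf g (n - i).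
Proof. by []. Qed.
Lemma cfMn f m n : cf (f *+ m) n = cf f n *+ m.
Proof. by elim: m => [|m IH]; rewrite ?mulr0n ?cf0 // !mulrS cfD IH. Qed.
Lemma cfMc (c : K) f n : cf (pconst c * f) n = c * cf f n.
Proof.
rewrite cfM big_ord_recl /= subn0 big1 ?addr0 // => i _; by rewrite mul0r.
Qed.
Lemma cf_natM m f n : cf (m%:R * f) n = m%:R * cf f n.
Proof. by rewrite !mulr_natl cfMn. Qed.
Lemma cf_sum I (r : seq I) (P : pred I) (F : I -> pser K) n :
  cf (\sum_(i <- r | P i) F i) n = \sum_(i <- r | P i) cf (F i) n.
Proof. by elim/big_rec2: _ => [|i x y _ <-]; rewrite ?cf0 ?cfD. Qed.
Lemma cfM0 f g : cf (f * g) 0 = cf f 0 * cf g 0.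
Proof. by rewrite cfM big_ord_recl big_ord0 addr0. Qed.

Definition pX : pser K := PSer (fun n => (n == 1%N)%:R).

Lemma cf_pXn k n : cf (pX ^+ k) n = (n == k)%:R.
Proof.
elim: k n => [|k IH] n; first by rewrite expr0 cf1.
rewrite exprS cfM; case: n => [|n]; first by rewrite big_ord_recl big_ord0 /= mul0r addr0.
rewrite big_ord_recl /= mul0r add0r big_ord_recl /= mul1r big1 => [|i _]; last by rewrite mul0r.
by rewrite addr0 subSS subn0 IH eqSS.
Qed.

Lemma cf_pXnM k f n : cf (pX ^+ k * f) n = if (k <= n)%N then cf f (n - k) else 0.
Proof.
rewrite cfM; case: leqP => kn.
  have kn1 : (k < n.+1)%N by [].
  rewrite (bigD1 (Ordinal kn1)) //= cf_pXn eqxx mul1r big1 ?addr0 // => i ni.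
  rewrite cf_pXn; case: eqP => [E|]; last by rewrite mul0r.
  by case/eqP: ni; apply: val_inj.
rewrite big1 // => i _; rewrite cf_pXn; case: eqP => [E|]; last by rewrite mul0r.
by have := ltn_ord i; lia.
Qed.

(* The derivation [q d/dq]. *)
Definition pD f := PSer (fun n => n%:R * cf f n).

Lemma cf_pD f n : cf (pD f) n = n%:R * cf f n. Proof. by []. Qed.

Lemma pDM f g : pD (f * g) = pD f * g + f * pD g.
Proof.
apply: pserP => n /=; rewrite -big_split mulr_sumr; apply: eq_bigr => i _ /=.
have -> : (n%:R : K) = (i : nat)%:R + (n - i)%:R.
  by rewrite -natrD; congr _%:R; have := ltn_ord i; lia.
by rewrite mulrDl !mulrA [cf f i * _]mulrC -!mulrA.
Qed.

Lemma pDB f g : pD (f - g) = pD f - pD g.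
Proof. by apply: pserP => n /=; rewrite mulrBr. Qed.

Lemma pDX f n : pD (f ^+ n.+1) = n.+1%:R * f ^+ n * pD f.
Proof.
elim: n => [|n IH]; first by rewrite !expr1 expr0 mulr1 mul1r.
rewrite exprS pDM IH (mulrS 1 n.+1) exprS; move: (n.+1%:R) (f ^+ n) (pD f) => c u v.
by ring.
Qed.

End PowerSeriesRing.

Arguments pX {K}.

Definition psmap (K L : comNzRingType) (phi : {rmorphism K -> L}) (f : pser K) : pser L :=
  PSer (fun n => phi (cf f n)).

Section Psmap.
Variables (K L : comNzRingType) (phi : {rmorphism K -> L}).
Let psmap_additive : zmod_morphism (psmap phi).
Proof. by move=> f g; apply: pserP => n /=; rewrite rmorphB. Qed.
Let psmap_monoid : monoid_morphism (psmap phi).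
Proof.
split; first by apply: pserP => n /=; case: eqP; rewrite ?rmorph1 ?rmorph0.
move=> f g; apply: pserP => n /=; rewrite rmorph_sum; apply: eq_bigr => i _.
by rewrite rmorphM.
Qed.
HB.instance Definition _ := GRing.isZmodMorphism.Build (pser K) (pser L) (psmap phi) psmap_additive.
HB.instance Definition _ := GRing.isMonoidMorphism.Build (pser K) (pser L) (psmap phi) psmap_monoid.
Lemma psmapX : psmap phi pX = pX.
Proof. by apply: pserP => n /=; rewrite rmorph_nat. Qed.
End Psmap.

(** * Ramanujan's differential equations *)

Lemma perm_divisors N k : (0 < k <= N)%N ->
  perm_eq (divisors k) [seq d <- iota 1 N | (d %| k)%N].
Proof.
move=> /andP[k0 kN]; apply: uniq_perm.
- exact: divisors_uniq.
- exact/filter_uniq/iota_uniq.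
- move=> d; rewrite mem_filter -dvdn_divisors // mem_iota.
  by case: (boolP (d %| k)%N) => //= dk; have := dvdn_leq k0 dk; have := dvdn_gt0 k0 dk; lia.
Qed.

Lemma sum_divisors_pairs (V : zmodType) (F : nat -> nat -> V) N k : (0 < k <= N)%N ->
  \sum_(d <- divisors k) F d (k %/ d)%N =
  \sum_(a <- iota 1 N) \sum_(x <- iota 1 N | (a * x)%N == k) F a x.
Proof.
move=> /andP[k0 kN].
rewrite [RHS](eq_big_seq (fun a => if (a %| k)%N then F a (k %/ a)%N else 0)); last first.
  move=> a; rewrite mem_iota => /andP[a0 _]; case: ifP => [ak|nak]; last first.
    rewrite big1 // => x /eqP E; by rewrite -E dvdn_mulr in nak.
  rewrite (big_rem (k %/ a)%N) /=; last first.
    rewrite mem_iota divn_gt0 // dvdn_leq //=; have := leq_div k a; lia.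
  rewrite mulnC divnK // eqxx big_seq_cond big1 ?addr0 // => x /andP[xi /eqP E].
  move: xi; rewrite mem_rem_uniq ?iota_uniq // inE => /andP[xk _].
  by move: xk; rewrite -E mulKn // eqxx.
rewrite -big_mkcond -big_filter; apply: perm_big; apply: perm_divisors; exact/andP.
Qed.

Definition sigma (k n : nat) : nat := \sum_(d <- divisors n) d ^ k.
Section EisensteinSeries.
Variable K : realFieldType.

(* [divisors 0] is [:: 1], whence the guard. *)
Definition pS (k : nat) : pser K := PSer (fun n => if n == 0%N then 0 else (sigma k n)%:R).

Lemma cf_pS k n : (0 < n)%N -> cf (pS k) n = \sum_(d <- divisors n) d%:R ^+ k.
Proof.
move=> n0; rewrite /= /sigma eqn0Ngt n0 natr_sum; apply: eq_bigr => d _; exact: natrX.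
Qed.

Lemma cf_pS0 k : cf (pS k) 0 = 0. Proof. by []. Qed.

Lemma cf_pS_pairs k N n : (n <= N)%N ->
  cf (pS k) n = \sum_(a <- iota 1 N) \sum_(x <- iota 1 N | (a * x)%N == n) a%:R ^+ k.
Proof.
move=> nN; case: (posnP n) => [->|n0]; last first.
  by rewrite cf_pS // (@sum_divisors_pairs _ (fun d _ => d%:R ^+ k) N n) ?n0.
rewrite big_seq big1 // => a; rewrite mem_iota => /andP[a0 _].
rewrite big_seq_cond big1 // => x; rewrite mem_iota => /andP[/andP[x0 _] /eqP]; nia.
Qed.

Lemma cf_pS_mul r s n :
  cf (pS r * pS s) n = \sum_(t <- quads n) t.1.1%:R ^+ r * t.1.2%:R ^+ s.
Proof.
rewrite cfM big_filter.
under [LHS]eq_bigr => i _ do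
  rewrite (@cf_pS_pairs r n i (ltnSE (ltn_ord i))) (@cf_pS_pairs s n (n - i) (leq_subr _ _)).
rewrite /= [RHS]big_mkcond big_allpairs_dep /=.
rewrite big_allpairs_dep /=.
under [RHS]eq_bigr => a _ do under eq_bigr => b _ do rewrite big_allpairs_dep /=.
under [LHS]eq_bigr => i _ do rewrite big_distrl /=.
rewrite exchange_big /=; apply: eq_bigr => a _.
under [LHS]eq_bigr => i _ do rewrite big_distrr /=.
rewrite exchange_big /=; apply: eq_bigr => b _.
under [LHS]eq_bigr => i _ do rewrite big_mkcond big_distrl /=.
rewrite exchange_big /=; apply: eq_bigr => x _.
under [LHS]eq_bigr => i _ do rewrite big_mkcond big_distrr /=.
rewrite exchange_big /=; apply: eq_bigr => y _.
case: (leqP (a * x) n) => axn; last first.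
  rewrite ifF; last by apply/eqP; lia.
  rewrite big1 // => i _; rewrite ifF ?mul0r //; apply/eqP; have := ltn_ord i; lia.
have axn' : (a * x < n.+1)%N by [].
rewrite (bigD1 (Ordinal axn')) //= eqxx big1 ?addr0; last first.
  move=> i ni; rewrite ifF ?mul0r //; apply/eqP => E; case/eqP: ni; exact: val_inj.
have -> : (b * y == n - a * x)%N = (a * x + b * y == n)%N by lia.
by case: ifP; rewrite ?mulr0.
Qed.

Lemma sum_quads_x_eq_y (V : zmodType) (F : nat -> nat -> V) n : (0 < n)%N ->
  \sum_(t <- quads n | t.2.1 == t.2.2) F t.1.1 t.1.2 =
  \sum_(d <- divisors n) \sum_(a <- iota 1 d.-1) F a (d - a)%N.
Proof.
move=> n0.
pose s := [seq ((a, (d - a)%N), ((n %/ d)%N, (n %/ d)%N)) | d <- divisors n, a <- iota 1 d.-1].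
transitivity (\sum_(t <- s) F t.1.1 t.1.2); last by rewrite big_allpairs_dep.
rewrite -big_filter; apply: perm_big; apply: uniq_perm.
- exact/filter_uniq/uniq_quads.
- apply: allpairs_uniq_dep.
  + exact: divisors_uniq.
  + by move=> *; exact: iota_uniq.
  + move=> [d a] [d' a'] /allpairsPdep [? [? [_ + [-> ->]]]] /allpairsPdep [? [? [_ + [-> ->]]]] /=.
    rewrite !mem_iota => p p1 [E E' _].
    have Ed : forall u v c : nat, (0 < c < 1 + u.-1)%N -> (0 < c < 1 + v.-1)%N ->
      (u - c = v - c)%N -> u = v by move=> *; lia.
    by rewrite -E in p1 E' *; rewrite (Ed _ _ _ p p1 E').
move=> [[a b] [x y]]; rewrite mem_filter mem_quads /=; apply/andP/allpairsPdep.
  move=> [/eqP <- /and5P[? ? ? _ /eqP E]]; exists (a + b)%N; exists a.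
  have E' : n = ((a + b) * x)%N by rewrite mulnDl.
  split; first by rewrite -dvdn_divisors // E' dvdn_mulr.
    by rewrite mem_iota; lia.
  have -> : (n %/ (a + b) = x)%N by rewrite E' mulKn // addn_gt0; apply/orP; left.
  by rewrite addKn.
move=> [d [c [+ + [-> -> -> ->]]]]; rewrite -dvdn_divisors // mem_iota => dn ?.
have d0 := dvdn_gt0 n0 dn.
split => //; apply/and5P; split; rewrite ?divn_gt0 ?(dvdn_leq n0) //; try lia.
Qed.

Lemma sum_quads_a_eq_b (V : zmodType) (F : nat -> V) n : (0 < n)%N ->
  \sum_(t <- quads n | t.1.1 == t.1.2) F t.1.2 =
  \sum_(d <- divisors n) F d *+ (n %/ d).-1.
Proof.
move=> n0.
pose s := [seq ((d, d), (x, (n %/ d - x)%N)) | d <- divisors n, x <- iota 1 (n %/ d).-1].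
transitivity (\sum_(t <- s) F t.1.2); last first.
  by rewrite big_allpairs_dep /=; apply: eq_bigr => d _; rewrite big_const_seq count_predT size_iota iter_addr_0.
rewrite -big_filter; apply: perm_big; apply: uniq_perm.
- exact/filter_uniq/uniq_quads.
- apply: allpairs_uniq_dep.
  + exact: divisors_uniq.
  + by move=> *; exact: iota_uniq.
  + by move=> [d a] [d' a'] _ _ /= [-> _ -> _].
move=> [[a b] [x y]]; rewrite mem_filter mem_quads /=; apply/andP/allpairsPdep.
  move=> [/eqP <- /and5P[a0 ? ? ? /eqP E]]; exists a; exists x.
  have E' : n = (a * (x + y))%N by rewrite mulnDr.
  rewrite -dvdn_divisors // {1}E' dvdn_mulr // mem_iota E' mulKn //; split => //; first lia.
  by congr (_, (_, _)); lia.
move=> [d [c [+ + [-> -> -> ->]]]]; rewrite -dvdn_divisors // mem_iota => dn ?.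
have d0 := dvdn_gt0 n0 dn.
split => //; apply/and5P; split; try lia.
Qed.

Lemma sum_quads_sigma (h : K -> K -> K) (g : K -> K) n : (0 < n)%N ->
  (forall u v, h u (v - u) = h (u - v) v) ->
  (forall d : nat, (0 < d)%N -> \sum_(a <- iota 1 d.-1) h a%:R (d%:R - a%:R) = g d%:R) ->
  \sum_(t <- quads n) (h t.1.1%:R t.1.2%:R - h (t.1.1%:R - t.1.2%:R) t.1.2%:R) =
  \sum_(d <- divisors n) (g d%:R + h 0 d%:R - (n %/ d)%:R * h 0 d%:R).
Proof.
move=> n0 hsym hg; rewrite sum_quads_telescope //.
rewrite (sum_quads_x_eq_y (fun a b => h a%:R b%:R) n0) (sum_quads_a_eq_b (fun d => h 0 d%:R) n0).
rewrite -sumrB; apply: eq_big_seq => d; rewrite -dvdn_divisors // => dn.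
have d0 := dvdn_gt0 n0 dn.
have q0 : (0 < n %/ d)%N by rewrite divn_gt0 // dvdn_leq.
rewrite -hg // (eq_big_seq (fun a => h a%:R (d%:R - a%:R))) => [|a]; last first.
  by rewrite mem_iota => ?; rewrite natrB //; lia.
rewrite -(prednK q0) /= -natr1 -mulr_natl; ring.
Qed.

Lemma sum_iota_closed (f : K -> K) (F : K -> K) (m : nat) :
  F 0 = 0 -> (forall x, F (x + 1) - F x = f (x + 1)) -> \sum_(a <- iota 1 m) f a%:R = F m%:R.
Proof.
move=> F0 FS; elim: m => [|m IH]; first by rewrite big_nil F0.
have -> : iota 1 m.+1 = iota 1 m ++ [:: m.+1] by rewrite -{1}(addn1 m) iotaD add1n.
by rewrite big_cat big_seq1 /= IH -natr1 -FS; ring.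
Qed.

Lemma sigma_conv13 n : (0 < n)%N -> 8 * cf (pS 1 * pS 3) n =
  \sum_(d <- divisors n) (7 / 10 * d%:R ^+ 5 + d%:R ^+ 3 / 3 - d%:R / 30
    - (n %/ d)%:R * d%:R ^+ 4).
Proof.
move=> n0; rewrite cf_pS_mul mulr_sumr.
pose h (u v : K) := (u ^+ 2 + u * v + v ^+ 2) ^+ 2.
pose g (D : K) := 7 / 10 * D ^+ 5 - D ^+ 4 + D ^+ 3 / 3 - D / 30.
have hsym u v : h u (v - u) = h (u - v) v by rewrite /h; ring.
have hg d : (0 < d)%N -> \sum_(a <- iota 1 d.-1) h a%:R (d%:R - a%:R) = g d%:R.
  move=> d0; pose P (m D : K) :=
    1 / 5 * m ^+ 5 + 1 / 2 * m ^+ 4 + 1 / 3 * m ^+ 3 - 1 / 30 * m - 1 / 2 * m ^+ 4 * D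
    - m ^+ 3 * D - 1 / 2 * m ^+ 2 * D + m ^+ 3 * D ^+ 2 + 3 / 2 * m ^+ 2 * D ^+ 2
    + 1 / 2 * m * D ^+ 2 - m ^+ 2 * D ^+ 3 - m * D ^+ 3 + m * D ^+ 4.
  rewrite (@sum_iota_closed (fun a => h a (d%:R - a)) (P ^~ d%:R)) /P; first last.
  - by move=> x; rewrite /h; field.
  - by ring.
  by rewrite -(prednK d0) /= -natr1 /g; field.
have := sum_quads_sigma n0 hsym hg => E.
transitivity (\sum_(t <- quads n) (h t.1.1%:R t.1.2%:R - h (t.1.1%:R - t.1.2%:R) t.1.2%:R)
    + 4 * (cf (pS 1 * pS 3) n - cf (pS 3 * pS 1) n)).
  rewrite !cf_pS_mul -sumrB mulr_sumr -big_split /=; apply: eq_bigr => t _.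
  by rewrite /h; ring.
rewrite E [pS 3 * _]mulrC subrr mulr0 addr0.
by apply: eq_bigr => d _; rewrite /h /g; field.
Qed.

Lemma sigma_conv15 n : (0 < n)%N -> 12 * cf (pS 1 * pS 5) n + 14 * cf (pS 3 * pS 3) n =
  \sum_(d <- divisors n) (83 / 140 * d%:R ^+ 7 + d%:R ^+ 5 / 2 - 7 / 60 * d%:R ^+ 3 + d%:R / 42
    - (n %/ d)%:R * d%:R ^+ 6).
Proof.
move=> n0; rewrite !cf_pS_mul !mulr_sumr -big_split /=.
pose h (u v : K) := (u ^+ 2 + u * v + v ^+ 2) ^+ 3.
pose g (D : K) := 83 / 140 * D ^+ 7 - D ^+ 6 + D ^+ 5 / 2 - 7 / 60 * D ^+ 3 + D / 42.
have hsym u v : h u (v - u) = h (u - v) v by rewrite /h; ring.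
have hg d : (0 < d)%N -> \sum_(a <- iota 1 d.-1) h a%:R (d%:R - a%:R) = g d%:R.
  move=> d0; pose P (m D : K) :=
    1 / 7 * m ^+ 7 + 1 / 2 * m ^+ 6 + 1 / 2 * m ^+ 5 - 1 / 6 * m ^+ 3 + 1 / 42 * m
    - 1 / 2 * m ^+ 6 * D - 3 / 2 * m ^+ 5 * D - 5 / 4 * m ^+ 4 * D + 1 / 4 * m ^+ 2 * D
    + 6 / 5 * m ^+ 5 * D ^+ 2 + 3 * m ^+ 4 * D ^+ 2 + 2 * m ^+ 3 * D ^+ 2
    - 1 / 5 * m * D ^+ 2 - 7 / 4 * m ^+ 4 * D ^+ 3 - 7 / 2 * m ^+ 3 * D ^+ 3
    - 7 / 4 * m ^+ 2 * D ^+ 3 + 2 * m ^+ 3 * D ^+ 4 + 3 * m ^+ 2 * D ^+ 4 + m * D ^+ 4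
    - 3 / 2 * m ^+ 2 * D ^+ 5 - 3 / 2 * m * D ^+ 5 + m * D ^+ 6.
  rewrite (@sum_iota_closed (fun a => h a (d%:R - a)) (P ^~ d%:R)) /P; first last.
  - by move=> x; rewrite /h; field.
  - by ring.
  by rewrite -(prednK d0) /= -natr1 /g; field.
have := sum_quads_sigma n0 hsym hg => E.
transitivity (\sum_(t <- quads n) (h t.1.1%:R t.1.2%:R - h (t.1.1%:R - t.1.2%:R) t.1.2%:R)
    + 6 * (cf (pS 1 * pS 5) n - cf (pS 5 * pS 1) n)).
  rewrite !cf_pS_mul -sumrB mulr_sumr -big_split /=; apply: eq_bigr => t _.
  by rewrite /h; ring.
rewrite E [pS 5 * _]mulrC subrr mulr0 addr0.
by apply: eq_bigr => d _; rewrite /h /g; field.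
Qed.

Lemma sigma_conv33 n : (0 < n)%N -> 4 * cf (pS 3 * pS 3) n =
  \sum_(d <- divisors n) (d%:R ^+ 7 - d%:R ^+ 3) / 30.
Proof.
move=> n0; rewrite cf_pS_mul mulr_sumr.
pose h (u v : K) := (u * v * (u + v)) ^+ 2.
pose g (D : K) := (D ^+ 7 - D ^+ 3) / 30.
have hsym u v : h u (v - u) = h (u - v) v by rewrite /h; ring.
have hg d : (0 < d)%N -> \sum_(a <- iota 1 d.-1) h a%:R (d%:R - a%:R) = g d%:R.
  move=> d0; pose P (m D : K) :=
    1 / 3 * m ^+ 3 * D ^+ 4 + 1 / 2 * m ^+ 2 * D ^+ 4 + 1 / 6 * m * D ^+ 4
    - 1 / 2 * m ^+ 4 * D ^+ 3 - m ^+ 3 * D ^+ 3 - 1 / 2 * m ^+ 2 * D ^+ 3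
    + 1 / 5 * m ^+ 5 * D ^+ 2 + 1 / 2 * m ^+ 4 * D ^+ 2 + 1 / 3 * m ^+ 3 * D ^+ 2
    - 1 / 30 * m * D ^+ 2.
  rewrite (@sum_iota_closed (fun a => h a (d%:R - a)) (P ^~ d%:R)) /P; first last.
  - by move=> x; rewrite /h; field.
  - by ring.
  by rewrite -(prednK d0) /= -natr1 /g; field.
have := sum_quads_sigma n0 hsym hg => E.
rewrite (eq_bigr (fun t => h t.1.1%:R t.1.2%:R - h (t.1.1%:R - t.1.2%:R) t.1.2%:R)).
  by rewrite E; apply: eq_bigr => d _; rewrite /h /g; field.
by move=> t _; rewrite /h; ring.
Qed.

Definition pE2 : pser K := 1 - 24%:R * pS 1.
Definition pE4 : pser K := 1 + 240%:R * pS 3.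
Definition pE6 : pser K := 1 - 504%:R * pS 5.

Lemma sum_divisors_natM n k : (0 < n)%N ->
  n%:R * cf (pS k) n = \sum_(d <- divisors n) (n %/ d)%:R * d%:R ^+ k.+1.
Proof.
move=> n0; rewrite cf_pS // mulr_sumr; apply: eq_big_seq => d; rewrite -dvdn_divisors // => dn.
by rewrite exprS mulrA -natrM divnK.
Qed.

Lemma sigma_conv13_lin n : (0 < n)%N -> 8 * cf (pS 1 * pS 3) n =
  7 / 10 * cf (pS 5) n + cf (pS 3) n / 3 - cf (pS 1) n / 30 - n%:R * cf (pS 3) n.
Proof.
move=> n0; rewrite sigma_conv13 // sum_divisors_natM // !cf_pS // mulr_sumr !mulr_suml.
by rewrite -big_split -!sumrB; apply: eq_bigr => d _ /=; rewrite expr1.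
Qed.

Lemma sigma_conv15_lin n : (0 < n)%N ->
  12 * cf (pS 1 * pS 5) n + 14 * cf (pS 3 * pS 3) n =
  83 / 140 * cf (pS 7) n + cf (pS 5) n / 2 - 7 / 60 * cf (pS 3) n + cf (pS 1) n / 42
  - n%:R * cf (pS 5) n.
Proof.
move=> n0; rewrite sigma_conv15 // sum_divisors_natM // !cf_pS // !mulr_sumr !mulr_suml.
by rewrite -big_split -sumrB -big_split -sumrB; apply: eq_bigr => d _ /=; rewrite expr1.
Qed.

Lemma sigma_conv33_lin n : (0 < n)%N ->
  4 * cf (pS 3 * pS 3) n = (cf (pS 7) n - cf (pS 3) n) / 30.
Proof.
by move=> n0; rewrite sigma_conv33 // !cf_pS // -sumrB -mulr_suml.
Qed.

Lemma ramanujan4 : 3%:R * pD pE4 = pE2 * pE4 - pE6.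
Proof.
rewrite /pE2 /pE4 /pE6.
have -> : (1 - 24%:R * pS 1) * (1 + 240%:R * pS 3) - (1 - 504%:R * pS 5) =
  240%:R * pS 3 - 24%:R * pS 1 - 24%:R * (240%:R * (pS 1 * pS 3)) + 504%:R * pS 5 by ring.
apply: pserP => n; rewrite cf_natM cf_pD !(cfD, cfN) cf1 !cf_natM.
case: (posnP n) => [->|n0]; first by rewrite cfM0 !cf_pS0 /=; ring.
by rewrite add0r; have := sigma_conv13_lin n0; lra.
Qed.

Lemma ramanujan6 : 2%:R * pD pE6 = pE2 * pE6 - pE4 ^+ 2.
Proof.
rewrite /pE2 /pE4 /pE6.
have -> : (1 - 24%:R * pS 1) * (1 - 504%:R * pS 5) - (1 + 240%:R * pS 3) ^+ 2 =
  24%:R * (504%:R * (pS 1 * pS 5)) - 24%:R * pS 1 - 504%:R * pS 5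
  - 480%:R * pS 3 - 240%:R * (240%:R * (pS 3 * pS 3)) by ring.
apply: pserP => n; rewrite cf_natM cf_pD !(cfD, cfN) cf1 !cf_natM.
case: (posnP n) => [->|n0]; first by rewrite !cfM0 !cf_pS0 /=; ring.
rewrite add0r; have := sigma_conv15_lin n0; have := sigma_conv33_lin n0; lra.
Qed.

End EisensteinSeries.

(** * The discriminant and the q-expansion of j *)

Section Inverse.
Variable K : comNzRingType.
Implicit Types f g h : pser K.

Definition pshift h : pser K := PSer (fun n => cf h n.+1).

Lemma pshiftE h : cf h 0 = 0 -> h = pX * pshift h.
Proof.
by move=> h0; apply: pserP => -[|n]; rewrite -[pX]expr1 cf_pXnM //= subn1.
Qed.

Lemma cf_exp_lt h k i : cf h 0 = 0 -> (i < k)%N -> cf (h ^+ k) i = 0.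
Proof. by move=> /pshiftE -> ik; rewrite exprMn cf_pXnM leqNgt ik. Qed.

Lemma pser_inv f : cf f 0 = 1 -> exists g, f * g = 1.
Proof.
move=> f0; pose h := 1 - f.
have h0 : cf h 0 = 0 by rewrite cfB cf1 f0 subrr.
pose g := PSer (fun n => cf (\sum_(k < n.+1) h ^+ k) n).
have gE N n : (n <= N)%N -> cf g n = cf (\sum_(k < N.+1) h ^+ k) n.
  move=> /subnKC <-; elim: (N - n)%N => [|d IH]; first by rewrite addn0.
  by rewrite addnS big_ord_recr cfD /= -/(cf _ _) [X in _ + X]cf_exp_lt ?addr0 // ltnS; lia.
exists g; apply: pserP => n.
have -> : f = 1 - h by rewrite /h; ring.
transitivity (cf ((1 - h) * \sum_(k < n.+1) h ^+ k) n).
  rewrite !cfM; apply: eq_bigr => i _; congr (_ * _); apply: gE; exact: leq_subr.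
by rewrite -[1 - h]opprB mulNr -subrX1 opprB cfB cf_exp_lt ?subr0.
Qed.

Lemma cfM1 f g : cf (f * g) 1 = cf f 0 * cf g 1 + cf f 1 * cf g 0.
Proof. by rewrite cfM !big_ord_recl big_ord0 addr0. Qed.

End Inverse.

Section Delta.
Variable K : realFieldType.

Definition pDelta : pser K := PSer (fun n =>
  ((\prod_(1 <= m < n.+1) (1 - 'X^m) ^+ 24 : {poly int})`_n)%:~R).

Let emb (p : {poly int}) : pser K := PSer (fun n => (p`_n)%:~R).
Let emb_mul p q : emb (p * q) = emb p * emb q.
Proof.
apply: pserP => n /=; rewrite coefM rmorph_sum; apply: eq_bigr => i _.
by rewrite rmorphM.
Qed.
Let emb1 : emb 1 = 1.
Proof. by apply: pserP => n /=; rewrite coef1; case: eqP. Qed.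
Let embX p n : emb (p ^+ n) = emb p ^+ n.
Proof. by elim: n => [|n IH]; rewrite ?emb1 // !exprS emb_mul IH. Qed.
Let emb_fac m : emb (1 - 'X^m) = 1 - pX ^+ m.
Proof. by apply: pserP => n /=; rewrite -/(cf (pX ^+ m) n) cf_pXn coefB coef1 coefXn rmorphB /=; case: eqP; case: eqP. Qed.

Let P N : pser K := \prod_(1 <= m < N.+1) (1 - pX ^+ m) ^+ 24.

Let cf_P n : cf pDelta n = cf (P n) n.
Proof.
suff -> : P n = emb (\prod_(1 <= m < n.+1) (1 - 'X^m) ^+ 24) by [].
rewrite /P; elim/big_rec2: _ => [|i x y _ ->]; first by rewrite emb1.
by rewrite emb_mul embX emb_fac.
Qed.

Let cf_P_stable N n : (n <= N)%N -> cf pDelta n = cf (P N) n.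
Proof.
move=> /subnKC <-; rewrite cf_P; elim: (N - n)%N => [|d ->]; first by rewrite addn0.
rewrite addnS [in RHS]/P big_nat_recr //.
change (cf (P (n + d)) n = cf (P (n + d) * (1 - pX ^+ (n + d).+1) ^+ 24) n).
have [g ->] : exists g, (1 - pX ^+ (n + d).+1) ^+ 24 = 1 + pX ^+ (n + d).+1 * g :> pser K.
  elim: (24)%N => [|k [g IH]]; first by exists 0; rewrite mulr0 addr0.
  by exists (g - 1 - pX ^+ (n + d).+1 * g); rewrite exprS IH; ring.
by rewrite mulrDr mulr1 mulrCA cfD cf_pXnM ifF ?addr0 //; lia.
Qed.

Let u m : pser K := PSer (fun n => if (m %| n)%N && (0 < n)%N then m%:R else 0).

Let fac_u m : (0 < m)%N -> (1 - pX ^+ m) * u m = m%:R * pX ^+ m.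
Proof.
move=> m0; apply: pserP => n; rewrite mulrBl mul1r cfB cf_natM cf_pXn cf_pXnM.
case: (ltngtP n m) => [nm|nm|->] /=; rewrite ?subr0 ?mulr0.
- by case: (posnP n) => [|n0]; rewrite ?andbF // gtnNdvd.
- have -> : (m %| n - m)%N = (m %| n)%N by rewrite -{2}(subnK (ltnW nm)) dvdn_addl.
  by rewrite subn_gt0 nm (ltn_trans m0 nm) subrr.
- by rewrite dvdnn m0 subnn ltnn andbF subr0 mulr1.
Qed.

Let pD_pXn m : pD (pX ^+ m) = m%:R * pX ^+ m :> pser K.
Proof.
apply: pserP => n; rewrite cf_pD cf_natM !cf_pXn; case: eqP => [->|] //.
by rewrite !mulr0.
Qed.

Let pD1 : pD (1 : pser K) = 0.
Proof. by apply: pserP => n; rewrite cf_pD cf1 cf0; case: n => [|n]; rewrite ?mul0r ?mulr0. Qed.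

Let pD_P N : pD (P N) = - 24%:R * P N * \sum_(1 <= m < N.+1) u m.
Proof.
elim: N => [|N IH]; first by rewrite /P !big_geq // pD1 mulr0.
rewrite /P big_nat_recr //.
change (pD (P N * (1 - pX ^+ N.+1) ^+ 24) = - 24%:R * (P N * (1 - pX ^+ N.+1) ^+ 24)
  * \sum_(1 <= m < N.+2) u m).
rewrite pDM IH pDX pDB pD1 pD_pXn -fac_u //.
rewrite [in RHS]big_nat_recr //.
move: (P N) (\sum_(_ <= _ < _) _) (1 - pX ^+ N.+1) (u N.+1) => p s x v.
change (- 24%:R * p * s * x ^+ 24 + p * (24%:R * x ^+ 23 * (0 - x * v)) = - 24%:R * (p * x ^+ 24) * (s + v)).
by rewrite (exprS x 23); move: (x ^+ 23) => y; ring.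
Qed.

Lemma pD_pDelta : pD pDelta = - 24%:R * pS K 1 * pDelta.
Proof.
apply: pserP => n; rewrite cf_pD (@cf_P_stable n) // -cf_pD pD_P.
rewrite -!mulrA !mulNr !cfN !cf_natM; congr (- (_ * _)).
rewrite [in RHS]mulrC !cfM; apply: eq_bigr => i _.
rewrite -(@cf_P_stable n) -1?ltnS //; congr (_ * _).
move: (n - i)%N (leq_subr i n) => k kn.
rewrite cf_sum; case: (posnP k) => [->|k0]; first by rewrite big1 // => j _ /=; rewrite andbF.
rewrite cf_pS // (perm_big _ (@perm_divisors n k _)) /=; last by rewrite k0.
rewrite big_filter [RHS]big_mkcond /index_iota subSS subn0.
by apply: eq_bigr => m _ /=; rewrite k0 andbT expr1.
Qed.

Lemma pE2_ode_unique (f : pser K) :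
  pD f = pE2 K * f -> cf f 0 = 0 -> cf f 1 = 0 -> f = 0.
Proof.
move=> Df f0 f1; apply: pserP => n; rewrite cf0.
elim/ltn_ind: n => -[|[|n]] // IH.
have := congr1 (fun g => cf g n.+2) Df; rewrite cf_pD cfM big_ord_recl subn0.
rewrite big1 ?addr0 => [E|i _]; last by rewrite [cf f _]IH ?mulr0 // lift0; have := ltn_ord i; lia.
have e : cf (pE2 K) 0 = 1 by rewrite cfB cf1 cf_natM cf_pS0 mulr0 subr0.
have : n.+1%:R * cf f n.+2 = 0.
  by move: E; rewrite e mul1r -natr1 mulrDl mul1r -[RHS]add0r => /addIr.
by move/eqP; rewrite mulf_eq0 pnatr_eq0 => /eqP.
Qed.

Lemma cf_pDelta0 : cf pDelta 0 = 1. Proof. by rewrite /= big_geq // coef1. Qed.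

Lemma pDelta_eq : 1728%:R * (pX * pDelta) = pE4 K ^+ 3 - pE6 K ^+ 2.
Proof.
have D0 := cf_pDelta0.
have s0 k : cf (pS K k) 0 = 0 by [].
have s1 k : cf (pS K k) 1 = 1 by rewrite cf_pS // big_seq1 expr1n.
have e40 : cf (pE4 K) 0 = 1 by rewrite cfD cf1 cf_natM s0 mulr0 addr0.
have e41 : cf (pE4 K) 1 = 240%:R by rewrite cfD cf1 cf_natM s1 mulr1 add0r.
have e60 : cf (pE6 K) 0 = 1 by rewrite cfB cf1 cf_natM s0 mulr0 subr0.
have e61 : cf (pE6 K) 1 = - 504%:R by rewrite cfB cf1 cf_natM s1 mulr1 add0r.
have X0 : cf (@pX K) 0 = 0 by [].
have X1 : cf (@pX K) 1 = 1 by [].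
apply/eqP; rewrite -subr_eq0; apply/eqP; apply: pE2_ode_unique.
- have pDXX : pD pX = pX :> pser K by rewrite -[pX]expr1 pD_pXn mul1r.
  have pDc c f : pD (c%:R * f) = c%:R * pD f :> pser K.
    by apply: pserP => n; rewrite cf_pD !cf_natM cf_pD mulrCA.
  rewrite !pDB pDc !pDX (pDM pX) pDXX pD_pDelta.
  have r4 : 3%:R * pE4 K ^+ 2 * pD (pE4 K) = pE4 K ^+ 2 * (pE2 K * pE4 K - pE6 K).
    by rewrite -ramanujan4; ring.
  have r6 : 2%:R * pE6 K ^+ 1 * pD (pE6 K) = pE6 K * (pE2 K * pE6 K - pE4 K ^+ 2).
    by rewrite -ramanujan6; ring.
  rewrite {}r4 {}r6.
  have -> : pE2 K = 1 - 24%:R * pS K 1 by [].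
  move: (pE4 K) (pE6 K) (pS K 1) (1728%:R) pX pDelta => e4 e6 s c x d; ring.
- by rewrite cfB cf_natM !cfB !exprS !expr0 !mulr1 !cfM0 X0 e40 e60; ring.
- rewrite cfB cf_natM !cfB !exprS !expr0 !mulr1 !cfM1 !cfM0 X0 X1 D0 e40 e60 e41 e61; ring.
Qed.

Definition pDeltaV : pser K := sval (cid (pser_inv cf_pDelta0)).

Lemma pDeltaK : pDelta * pDeltaV = 1.
Proof. by rewrite /pDeltaV; case: cid. Qed.

Lemma pD_pDeltaV : pD pDeltaV = 24%:R * pS K 1 * pDeltaV.
Proof.
have : pD (pDelta * pDeltaV) = 0 by rewrite pDeltaK pD1.
rewrite pDM pD_pDelta => E.
have : pDeltaV * (- 24%:R * pS K 1 * pDelta * pDeltaV + pDelta * pD pDeltaV) = 0 by rewrite E mulr0.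
move: pDeltaK; move: pDelta pDeltaV (pD pDeltaV) => d v w dv.
have -> : v * (- 24%:R * pS K 1 * d * v + d * w) = (d * v) * w - (d * v) * (24%:R * pS K 1 * v) by ring.
by rewrite dv !mul1r => /eqP; rewrite subr_eq0 => /eqP.
Qed.

Definition pJ : pser K := pE4 K ^+ 3 * pDeltaV.

Lemma pJ_Delta : pJ * pDelta = pE4 K ^+ 3.
Proof. by rewrite /pJ -mulrA [_ * pDelta]mulrC pDeltaK mulr1. Qed.

End Delta.

Lemma cf_pJ0 (K : realFieldType) : cf (pJ K) 0 = 1.
Proof.
have e40 : cf (pE4 K) 0 = 1 by rewrite cfD cf1 cf_natM cf_pS0 mulr0 addr0.
have := congr1 (fun f => cf f 0) (pJ_Delta K).
by rewrite !exprS expr0 mulr1 !cfM0 cf_pDelta0 e40 !mulr1.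
Qed.

Lemma fps_powE f k : fps_pow f k = cf (PSer f ^+ k).
Proof.
elim: k => [|k IH]; first by apply/funext => n; rewrite expr0.
by apply/funext => n; rewrite exprS cfM /= IH.
Qed.

Lemma fps_shiftE k f : fps_shift k f = cf (pX ^+ k * PSer f).
Proof. by apply/funext => n; rewrite cf_pXnM. Qed.

Lemma fps_mulE f g : fps_mul f g = cf (PSer f * PSer g). Proof. by []. Qed.

Lemma PSerK (K : Type) (f : pser K) : PSer (cf f) = f. Proof. by case: f. Qed.

Lemma qjE : PSer qj = psmap (ratr : {rmorphism rat -> algC}) (pJ rat).
Proof.
have sizel n : size (qj_list n) = n.+1 by elim: n => //= n IH; rewrite size_rcons IH.
have nthl n m : (m <= n)%N -> (qj_list n)`_m = qj m.
  elim: n => [|n IH]; first by rewrite leqn0 => /eqP ->.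
  rewrite leq_eqVlt => /predU1P[-> //|mn] /=.
  by rewrite nth_rcons sizel mn IH.
have D0 : DeltaQ 0%N = 1 by rewrite /DeltaQ big_geq // coef1.
have qjD : PSer qj * PSer DeltaQ = PSer E4 ^+ 3.
  apply: pserP => n; transitivity (E4cube n); last by rewrite /E4cube fps_powE.
  rewrite cfM big_ord_recr /= subnn D0 mulr1.
  case: n => [|n]; first by rewrite big_ord0 add0r.
  rewrite {2}/qj /= nth_rcons sizel ltnn eqxx.
  under eq_bigr => i _ do rewrite -(nthl n i (ltnSE (ltn_ord i))).
  by rewrite addrC subrK.
have E4E : PSer E4 = psmap (ratr : {rmorphism rat -> algC}) (pE4 rat).
  apply: pserP => n; transitivity (ratr (cf (pE4 rat) n) : algC); last by [].
  rewrite cfD cf1 cf_natM [LHS]/= /E4.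
  case: (posnP n) => [->|n0]; first by rewrite cf_pS0 mulr0 addr0 rmorph1.
  by rewrite add0r /= eqn0Ngt n0 -natrM rmorph_nat /sigma3.
have DE : PSer DeltaQ = psmap (ratr : {rmorphism rat -> algC}) (pDelta rat).
  by apply: pserP => n /=; rewrite ratr_int.
have DV : PSer DeltaQ * psmap (ratr : {rmorphism rat -> algC}) (pDeltaV rat) = 1.
  by rewrite DE -rmorphM pDeltaK rmorph1.
by rewrite -[LHS]mulr1 -DV mulrA qjD E4E /pJ [RHS]rmorphM rmorphXn.
Qed.

(** * Convergence in R[i] *)

Section RealNull.
Variable R : realType.
Implicit Types u v : nat -> R.

Definition rnull u := forall e : R, 0 < e -> exists N, forall n, (N <= n)%N -> `|u n| < e.

Lemma rnull_cvg u : (u @ \oo --> 0)%classic -> rnull u.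
Proof.
move=> /cvgrPdist_lt h e e0; have [N _ HN] := h _ e0.
by exists N => n Nn; have := HN n Nn; rewrite /= sub0r normrN.
Qed.

Lemma rnullD u v : rnull u -> rnull v -> rnull (fun n => u n + v n).
Proof.
move=> hu hv e e0; have e2 : 0 < e / 2 by lra.
have [N HN] := hu _ e2; have [M HM] := hv _ e2; exists (maxn N M) => n.
rewrite geq_max => /andP[/HN a /HM b]; apply: le_lt_trans (ler_normD _ _) _; lra.
Qed.

Lemma rnull_le u v : rnull v -> (forall n, `|u n| <= v n) -> rnull u.
Proof.
move=> hv le e e0; have [N HN] := hv _ e0; exists N => n /HN.
by apply: le_lt_trans; apply: le_trans (le n) (ler_norm _).
Qed.

Lemma rnullMl c u : rnull u -> rnull (fun n => c * u n).
Proof.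
move=> hu e e0; have c1 : 0 < `|c| + 1 by have := normr_ge0 c; lra.
have [N HN] := hu _ (divr_gt0 e0 c1); exists N => n /HN.
rewrite normrM ltr_pdivlMr //; have := normr_ge0 (u n); have := normr_ge0 c.
by move: `|c| `|u n| => x y; nra.
Qed.

Lemma rnull_exp t : 0 <= t < 1 -> rnull (fun n => t ^+ n).
Proof. by move=> /andP[t0 t1]; apply/rnull_cvg/cvg_expr; rewrite ger0_norm. Qed.

Lemma rnull_harmonic : rnull (fun n => n.+1%:R^-1).
Proof. exact/rnull_cvg/cvg_harmonic. Qed.

Lemma rnull_subseq u (f : nat -> nat) : rnull u -> (forall n, (n <= f n)%N) -> rnull (u \o f).
Proof. by move=> hu hf e /hu[N HN]; exists N => n Nn; apply/HN/(leq_trans Nn). Qed.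

Lemma is_cvg_dominated (a : nat -> R) B t :
  0 <= t < 1 -> (forall n, `|a n| <= B * t ^+ n) -> cvgn (series a).
Proof.
move=> /andP[t0 t1] le; apply: normed_cvg.
apply: (@series_le_cvg _ _ (geometric B t)).
- by move=> n /=.
- by move=> n; apply: le_trans (le n).
- exact: le.
- by apply: is_cvg_geometric_series; rewrite ger0_norm.
Qed.

Lemma sum_geo_le (t : R) n : 0 <= t < 1 -> \sum_(i < n) t ^+ i <= (1 - t)^-1.
Proof.
move=> /andP[t0 t1]; rewrite -[X in _ <= X]mul1r ler_pdivlMr ?subr_gt0 // mulrC.
rewrite -[1 - t]opprB mulNr -subrX1; have := exprn_ge0 n t0; lra.
Qed.

Lemma natr_exp_le (t : R) n : 0 <= t < 1 -> n%:R * t ^+ n <= (1 - t)^-1.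
Proof.
move=> ht; have /andP[t0 t1] := ht; apply: le_trans (sum_geo_le n ht).
rewrite mulr_natl -[n in _ *+ n]card_ord -sumr_const.
by apply: ler_sum => i _; exact: (ler_wiXn2l t0 (ltW t1) (ltnW (ltn_ord i))).
Qed.

End RealNull.

Section Complex.
Variable R : realType.
Local Notation C := R[i].
Implicit Types (u v : nat -> C) (z w : C).
Local Notation Re := (@complex.Re R).
Local Notation Im := (@complex.Im R).

Lemma normc_ge0 z : 0 <= normc z. Proof. by case: z => a b; rewrite sqrtr_ge0. Qed.
Lemma normcB z w : normc (z - w) = normc (w - z). Proof. by rewrite -normcN opprB. Qed.
Lemma normcX z n : normc (z ^+ n) = normc z ^+ n.
Proof. by elim: n => [|n IH]; rewrite ?expr0 ?normc1 // !exprS normcM IH. Qed.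
Lemma normc_real (x : R) : normc (x%:C)%C = `|x|.
Proof. by rewrite /= expr0n addr0 sqrtr_sqr. Qed.
Lemma normc_nat n : normc (n%:R : C) = n%:R.
Proof. by rewrite normcMn normc1. Qed.
Lemma normc_eq0 z : (normc z == 0) = (z == 0).
Proof. by apply/eqP/eqP => [/eq0_normc|->]; rewrite ?normc0. Qed.
Lemma normc_gt0 z : (0 < normc z) = (z != 0).
Proof. by rewrite lt_def normc_ge0 andbT normc_eq0. Qed.
Lemma normc_sum I (r : seq I) (P : pred I) (F : I -> C) :
  normc (\sum_(i <- r | P i) F i) <= \sum_(i <- r | P i) normc (F i).
Proof.
elim/big_rec2: _ => [|i x y _ le]; first by rewrite normc0.
by apply: le_trans (le_normcD _ _) _; rewrite lerD2l.
Qed.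
Lemma normc_sub_le z w : normc z - normc w <= normc (z - w).
Proof. by rewrite lerBlDr; apply: le_trans (le_normcD _ _); rewrite subrK. Qed.
Lemma normc_Re z : `|Re z| <= normc z.
Proof. by case: z => a b /=; rewrite -sqrtr_sqr ler_wsqrtr // lerDl sqr_ge0. Qed.
Lemma normc_Im z : `|Im z| <= normc z.
Proof. by case: z => a b /=; rewrite -sqrtr_sqr ler_wsqrtr // lerDr sqr_ge0. Qed.
Lemma normc_le_ReIm z : normc z <= `|Re z| + `|Im z|.
Proof.
case: z => a b /=; rewrite -[X in _ <= X]ger0_norm ?addr_ge0 // -sqrtr_sqr ler_wsqrtr //.
rewrite sqrrD !real_normK ?num_real // lerD2r lerDl mulrn_wge0 //; exact: mulr_ge0.
Qed.
Lemma normc_sqr z : normc z ^+ 2 = Re z ^+ 2 + Im z ^+ 2.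
Proof. by case: z => a b /=; rewrite sqr_sqrtr // addr_ge0 ?sqr_ge0. Qed.

Definition ccvg u (l : C) := rnull (fun n => normc (u n - l)).

Lemma ccvg_cst l : ccvg (fun _ => l) l.
Proof. by move=> e e0; exists 0%N => n _; rewrite subrr normc0 normr0. Qed.

Lemma ccvgD u v l m : ccvg u l -> ccvg v m -> ccvg (fun n => u n + v n) (l + m).
Proof.
move=> hu hv; apply: rnull_le (rnullD hu hv) _ => n.
by rewrite ger0_norm ?normc_ge0 // opprD addrACA le_normcD.
Qed.

Lemma ccvgMl c u l : ccvg u l -> ccvg (fun n => c * u n) (c * l).
Proof.
move=> hu; apply: rnull_le (rnullMl (normc c) hu) _ => n.
by rewrite ger0_norm ?normc_ge0 // -mulrBr normcM.
Qed.

Lemma ccvgB u v l m : ccvg u l -> ccvg v m -> ccvg (fun n => u n - v n) (l - m).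
Proof.
move=> hu /(ccvgMl (-1)) hv; rewrite -[m]mul1r -mulNr.
by move=> e e0; have [N HN] := ccvgD hu hv e0; exists N => n /HN; rewrite mulN1r.
Qed.

Lemma ccvg_bounded u l : ccvg u l -> exists N B, forall n, (N <= n)%N -> normc (u n) <= B.
Proof.
move=> /(_ 1 ltr01)[N HN]; exists N, (normc l + 1) => n /HN.
rewrite ger0_norm ?normc_ge0 // => h; have := normc_sub_le (u n) l; lra.
Qed.

Lemma ccvgM u v l m : ccvg u l -> ccvg v m -> ccvg (fun n => u n * v n) (l * m).
Proof.
move=> hu hv; have [M [B HB]] := ccvg_bounded hv.
have B0 : 0 <= B by apply: le_trans (HB M _) => //; exact: normc_ge0.
have := rnullD (rnullMl B hu) (rnullMl (normc l) hv) => h e /h [N HN].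
exists (maxn N M) => n; rewrite geq_max => /andP[/HN a /HB b].
apply: le_lt_trans a; rewrite ger0_norm ?normc_ge0 // ger0_norm; last first.
  by rewrite addr_ge0 // mulr_ge0 // normc_ge0.
have -> : u n * v n - l * m = v n * (u n - l) + l * (v n - m) by ring.
apply: le_trans (le_normcD _ _) _; rewrite !normcM lerD2r ler_wpM2r ?normc_ge0 //.
Qed.

Lemma ccvgX u l k : ccvg u l -> ccvg (fun n => u n ^+ k) (l ^+ k).
Proof.
move=> hu; elim: k => [|k IH]; first exact: ccvg_cst.
by rewrite exprS => e /(ccvgM hu IH)[N HN]; exists N => n /HN; rewrite exprS.
Qed.

Lemma ccvg_uniq u l m : ccvg u l -> ccvg u m -> l = m.
Proof.
move=> hu hv; apply/eqP; rewrite -subr_eq0 -normc_eq0; apply/eqP.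
apply: le_anti; rewrite normc_ge0 andbT; apply/ler_addgt0Pl => e e0; rewrite addr0.
have [N HN] := rnullD hu hv e0; have := HN N (leqnn _).
rewrite ger0_norm ?addr_ge0 ?normc_ge0 // => /ltW; apply: le_trans.
rewrite (normcB (u N) l); have -> : l - m = (l - u N) + (u N - m) by ring.
exact: le_normcD.
Qed.

Lemma ccvg_le u l B : ccvg u l -> (forall n, normc (u n) <= B) -> normc l <= B.
Proof.
move=> hu le; apply/ler_addgt0Pl => e e0; have [N HN] := hu _ e0.
have := HN N (leqnn _); rewrite ger0_norm ?normc_ge0 // normcB => h.
have := normc_sub_le l (u N); have := le N; lra.
Qed.

Lemma ccvg_shift u l (f : nat -> nat) : ccvg u l -> (forall n, (n <= f n)%N) -> ccvg (u \o f) l.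
Proof. by move=> hu hf; apply: (rnull_subseq hu hf). Qed.

Lemma ccvg_diff u v l : ccvg u l -> rnull (fun n => normc (v n - u n)) -> ccvg v l.
Proof.
move=> hu hd; apply: rnull_le (rnullD hu hd) _ => n; rewrite ger0_norm ?normc_ge0 //.
have -> : v n - l = (u n - l) + (v n - u n) by ring.
exact: le_normcD.
Qed.

Lemma ccvg_ext u v l : (forall n, u n = v n) -> ccvg u l -> ccvg v l.
Proof. by move=> E hu e /hu[N HN]; exists N => n /HN; rewrite E. Qed.

Definition csum (a : nat -> C) : C :=
  Complex (limn (series (fun n => Re (a n)))) (limn (series (fun n => Im (a n)))).

Lemma cRe_sum I (r : seq I) (P : pred I) (F : I -> C) :
  Re (\sum_(i <- r | P i) F i) = \sum_(i <- r | P i) Re (F i).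
Proof. by elim/big_rec2: _ => // i x [? ?] _ <-; case: (F i). Qed.
Lemma cIm_sum I (r : seq I) (P : pred I) (F : I -> C) :
  Im (\sum_(i <- r | P i) F i) = \sum_(i <- r | P i) Im (F i).
Proof. by elim/big_rec2: _ => // i x [? ?] _ <-; case: (F i). Qed.
Lemma cReB z w : Re (z - w) = Re z - Re w. Proof. by case: z; case: w. Qed.
Lemma cImB z w : Im (z - w) = Im z - Im w. Proof. by case: z; case: w. Qed.

Lemma csum_cvg (a : nat -> C) B t : 0 <= t < 1 -> (forall n, normc (a n) <= B * t ^+ n) ->
  ccvg (fun N => \sum_(i < N) a i) (csum a).
Proof.
move=> ht le.
have cr : cvgn (series (fun n => Re (a n))).
  by apply: (is_cvg_dominated ht) => n; apply: le_trans (normc_Re _) (le n).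
have ci : cvgn (series (fun n => Im (a n))).
  by apply: (is_cvg_dominated ht) => n; apply: le_trans (normc_Im _) (le n).
have nul (s : nat -> R) : cvgn s -> rnull (fun n => `|s n - limn s|).
  move=> cs e e0; have /cvgrPdist_lt /(_ _ e0) [N _ HN] := cs.
  by exists N => n /HN /=; rewrite normr_id distrC.
apply: rnull_le (rnullD (nul _ cr) (nul _ ci)) _ => n.
rewrite ger0_norm ?normc_ge0 //; apply: le_trans (normc_le_ReIm _) _.
by rewrite cReB cImB cRe_sum cIm_sum !/series /= !big_mkord.
Qed.

Lemma csum_tail (a : nat -> C) B t N : 0 <= t < 1 -> (forall n, normc (a n) <= B * t ^+ n) ->
  normc (csum a - \sum_(i < N) a i) <= B * t ^+ N / (1 - t).
Proof.
move=> ht le; have /andP[t0 t1] := ht.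
have B0 : 0 <= B by have := le 0%N; rewrite expr0 mulr1; apply: le_trans (normc_ge0 _).
have h := ccvg_shift (csum_cvg ht le) (fun n => leq_addl N n).
apply: (ccvg_le (ccvgB h (ccvg_cst (\sum_(i < N) a i)))) => n /=.
rewrite big_split_ord /= addrAC subrr add0r; apply: le_trans (normc_sum _ _ _) _.
apply: (@le_trans _ _ (\sum_(i < n) B * t ^+ N * t ^+ i)).
  by apply: ler_sum => i _; rewrite -mulrA -exprD.
by rewrite -mulr_sumr ler_wpM2l ?mulr_ge0 ?exprn_ge0 ?sum_geo_le.
Qed.

End Complex.

(** * Power series on the unit disc *)

Section PowerSeriesEval.
Variable R : realType.
Local Notation C := R[i].
Implicit Types (f g : pser C) (z w : C).

(* The radius of convergence is at least 1. *)
Definition CV f := forall r : R, 0 <= r < 1 -> exists B, forall n, normc (cf f n) * r ^+ n <= B.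

Definition ev f w : C := csum (fun n => cf f n * w ^+ n).

(* A radius [r < 1] with [normc w <= r ^+ 3]: the spare powers absorb the coefficients. *)
Definition midrad w : R := 1 - (1 - normc w) / 3.

Lemma midrad_bound w : normc w < 1 -> 0 < midrad w < 1 /\ normc w <= midrad w ^+ 3.
Proof.
move=> w1; have w0 := normc_ge0 w; rewrite /midrad; move: (normc w) w0 w1 => x x0 x1.
split; first by apply/andP; split; lra.
set u := (1 - x) / 3; have -> : x = 1 - 3 * u by rewrite /u; field.
have u0 : 0 <= u by rewrite /u; lra.
have u1 : 0 <= 3 - u by rewrite /u; lra.
rewrite -subr_ge0 (_ : _ - _ = u ^+ 2 * (3 - u)); last by ring.
by rewrite mulr_ge0 ?sqr_ge0.
Qed.

Lemma midrad2_bound w : normc w < 1 -> 0 <= midrad w ^+ 2 < 1.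
Proof.
move=> /midrad_bound[/andP[r0 r1] _]; rewrite exprn_ge0 ?ltW //= expr2.
by move: (midrad w) r0 r1 => r r0 r1; nra.
Qed.

Lemma CV_dom f w : CV f -> normc w < 1 ->
  exists B, forall n, normc (cf f n * w ^+ n) <= B * (midrad w ^+ 2) ^+ n.
Proof.
move=> cvf w1; have [/andP[r0 r1] rw] := midrad_bound w1.
have [|B HB] := cvf (midrad w); first by rewrite ltW.
exists B => n; rewrite normcM normcX.
apply: (@le_trans _ _ (normc (cf f n) * (midrad w ^+ 3) ^+ n)).
  by rewrite ler_wpM2l ?normc_ge0 // lerXn2r ?nnegrE ?normc_ge0 ?exprn_ge0 // ltW.
rewrite exprS exprMn mulrA ler_wpM2r //.
by rewrite !exprn_ge0 // ltW.
Qed.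

Lemma ev_cvg f w : CV f -> normc w < 1 ->
  ccvg (fun N => \sum_(i < N) cf f i * w ^+ i) (ev f w).
Proof. by move=> cvf w1; have [B HB] := CV_dom cvf w1; apply: csum_cvg (midrad2_bound w1) HB. Qed.

Lemma CV_add f g : CV f -> CV g -> CV (f + g).
Proof.
move=> hf hg r hr; have [B HB] := hf r hr; have [D HD] := hg r hr; exists (B + D) => n.
apply: le_trans (lerD (HB n) (HD n)); rewrite -mulrDl ler_wpM2r ?le_normcD //.
by case/andP: hr => r0 _; exact: exprn_ge0.
Qed.

Lemma CV_opp f : CV f -> CV (- f).
Proof. by move=> hf r /hf[B HB]; exists B => n; rewrite cfN normcN. Qed.

Lemma CV_sub f g : CV f -> CV g -> CV (f - g).
Proof. by move=> hf hg; apply/CV_add/CV_opp. Qed.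

Lemma CV_mul f g : CV f -> CV g -> CV (f * g).
Proof.
move=> hf hg r /andP[r0 r1]; pose s := (1 + r) / 2.
have s0 : 0 < s by rewrite /s; lra.
have hs : 0 <= s < 1 by rewrite ltW //= /s; lra.
have [B HB] := hf s hs; have [D HD] := hg s hs.
have ht : 0 <= r / s < 1 by rewrite divr_ge0 ?(ltW s0) //= ltr_pdivrMr // mul1r /s; lra.
have BD0 : 0 <= B * D.
  by apply: mulr_ge0; [have := HB 0%N | have := HD 0%N];
     rewrite expr0 mulr1; apply: le_trans (normc_ge0 _).
exists (B * D * (2 * (1 - r / s)^-1)) => n.
apply: (@le_trans _ _ (\sum_(i < n.+1) B * D * (r / s) ^+ n)).
  rewrite cfM; apply: (@le_trans _ _ (\sum_(i < n.+1) normc (cf f i * cf g (n - i)) * r ^+ n)).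
    by rewrite -mulr_suml ler_wpM2r ?exprn_ge0 ?normc_sum.
  apply: ler_sum => i _; have ni : (i <= n)%N := ltnSE (ltn_ord i).
  have -> : r ^+ n = (r / s) ^+ n * (s ^+ i * s ^+ (n - i)).
    by rewrite -exprD subnKC // -exprMn divfK // gt_eqF.
  have -> : normc (cf f i * cf g (n - i)) * ((r / s) ^+ n * (s ^+ i * s ^+ (n - i))) =
    (r / s) ^+ n * ((normc (cf f i) * s ^+ i) * (normc (cf g (n - i)) * s ^+ (n - i))).
    by rewrite normcM; ring.
  rewrite [leRHS]mulrC.
  rewrite ler_wpM2l ?exprn_ge0 ?(andP ht).1 //; apply: ler_pM => //.
  - by rewrite mulr_ge0 ?normc_ge0 ?exprn_ge0 ?(ltW s0).
  - by rewrite mulr_ge0 ?normc_ge0 ?exprn_ge0 ?(ltW s0).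
rewrite sumr_const card_ord -mulrnAr ler_wpM2l // -mulr_natl -natr1 mulrDl mul1r.
have h1 := natr_exp_le n ht.
have h2 : (r / s) ^+ n <= (1 - r / s)^-1.
  have /andP[t0 t1] := ht.
  apply: (@le_trans _ _ 1); first exact: exprn_ile1 t0 (ltW t1).
  by rewrite invf_ge1 ?subr_gt0 // lerBlDr lerDl.
by rewrite [leRHS]mulr_natl mulr2n lerD.
Qed.

Lemma CV_finite f N : (forall n, (N <= n)%N -> cf f n = 0) -> CV f.
Proof.
move=> h r /andP[r0 r1]; exists (\sum_(i < N) normc (cf f i)) => n.
have sum0 (P : pred 'I_N) : 0 <= \sum_(i < N | P i) normc (cf f i).
  by apply: sumr_ge0 => i _; exact: normc_ge0.
case: (leqP N n) => nN; first by rewrite h // normc0 mul0r.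
rewrite (bigD1 (Ordinal nN)) //=.
apply: (@le_trans _ _ (normc (cf f n) * 1)); last by rewrite mulr1 lerDl.
by rewrite ler_wpM2l ?normc_ge0 // exprn_ile1 // ltW.
Qed.

Lemma CV_1 : CV 1.
Proof. by apply: (@CV_finite _ 1) => -[|n] // _; rewrite cf1. Qed.
Lemma CV_0 : CV 0.
Proof. by apply: (@CV_finite _ 0) => n _; rewrite cf0. Qed.
Lemma CV_const c : CV (pconst c).
Proof. by apply: (@CV_finite _ 1) => -[|n]. Qed.
Lemma CV_X : CV pX.
Proof. by apply: (@CV_finite _ 2) => -[|[|n]]. Qed.
Lemma CV_exp f k : CV f -> CV (f ^+ k).
Proof.
by move=> hf; elim: k => [|k IH]; [exact: CV_1 | rewrite exprS; exact: CV_mul].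
Qed.
Lemma CV_sum I (r : seq I) (P : pred I) (F : I -> pser C) :
  (forall i, P i -> CV (F i)) -> CV (\sum_(i <- r | P i) F i).
Proof. by move=> h; elim/big_rec: _ => [|i x Pi]; [exact: CV_0 | apply/CV_add/h]. Qed.
Lemma CV_nat n : CV n%:R.
Proof. by elim: n => [|n IH]; [exact: CV_0 | rewrite -natr1; exact/CV_add/CV_1]. Qed.

(* Sub-exponential growth of the coefficients is inherited by solutions of [q g' = a g]. *)
Lemma CV_logder a g : CV a -> cf a 0 = 0 -> pD g = a * g -> CV g.
Proof.
move=> hA a0 Dg r /andP[r0 r1]; pose s := (1 + r) / 2.
have hs : 0 <= s < 1 by rewrite /s; apply/andP; split; lra.
have s0 : 0 < s by rewrite /s; lra.
have [B HB] := hA s hs.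
have ht : 0 <= r / s < 1 by rewrite divr_ge0 ?(ltW s0) //= ltr_pdivrMr // mul1r /s; lra.
have B0 : 0 <= B by have := HB 0%N; apply: le_trans; rewrite expr0 mulr1 normc_ge0.
pose A := B * (1 - r / s)^-1.
have A0 : 0 <= A by rewrite mulr_ge0 // invr_ge0 subr_ge0 ltW // (andP ht).2.
have [m Am] : exists m : nat, A <= m%:R.
  by exists (Num.bound A); apply: ltW; apply: le_lt_trans (archi_boundP A0).
pose M := \sum_(i < m.+1) normc (cf g i) * r ^+ i.
have t0 i : 0 <= normc (cf g i) * r ^+ i by rewrite mulr_ge0 ?normc_ge0 ?exprn_ge0.
have M0 : 0 <= M by exact: sumr_ge0.
exists M => n; elim/ltn_ind: n => n IH; case: (ltnP n m.+1) => nm.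
  by rewrite /M (bigD1 (Ordinal nm)) //= lerDl sumr_ge0.
have n0 : (0 < n)%N := leq_ltn_trans (leq0n m) nm.
have np : 0 < n%:R :> R by rewrite ltr0n.
rewrite -(ler_pM2l np) mulrA -(normc_nat R n) -normcM -cf_pD Dg normc_nat cfM.
rewrite big_ord_recl a0 mul0r add0r.
apply: (@le_trans _ _ (\sum_(i < n) B * (r / s) ^+ i.+1 * M)).
  apply: (@le_trans _ _ (\sum_(i < n) normc (cf a (lift ord0 i) * cf g (n - lift ord0 i)) * r ^+ n)).
    by rewrite -mulr_suml ler_wpM2r ?exprn_ge0 ?normc_sum.
  apply: ler_sum => i _; rewrite lift0; have ni := ltn_ord i.
  have -> : r ^+ n = (r / s) ^+ i.+1 * s ^+ i.+1 * r ^+ (n - i.+1).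
    by rewrite -exprMn divfK ?gt_eqF // -exprD subnKC.
  have -> : normc (cf a i.+1 * cf g (n - i.+1)) * ((r / s) ^+ i.+1 * s ^+ i.+1 * r ^+ (n - i.+1)) =
    (normc (cf a i.+1) * s ^+ i.+1) * (r / s) ^+ i.+1 * (normc (cf g (n - i.+1)) * r ^+ (n - i.+1)).
    by rewrite normcM; ring.
  apply: ler_pM => //.
  - by rewrite !mulr_ge0 ?normc_ge0 ?exprn_ge0 ?(ltW s0) ?(andP ht).1.
  - by rewrite ler_wpM2r ?exprn_ge0 ?(andP ht).1.
  - by apply: IH; rewrite ltn_subrL n0.
rewrite -mulr_suml ler_wpM2r //.
apply: (@le_trans _ _ A); last by apply: le_trans Am _; rewrite ler_nat ltnW.
rewrite -mulr_sumr ler_wpM2l //.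
apply: le_trans (sum_geo_le n ht); apply: ler_sum => i _.
by rewrite ler_wiXn2l ?(andP ht).1 // ltW // (andP ht).2.
Qed.

Lemma evD f g w : CV f -> CV g -> normc w < 1 -> ev (f + g) w = ev f w + ev g w.
Proof.
move=> hf hg w1; apply: ccvg_uniq (ev_cvg (CV_add hf hg) w1) _.
apply: ccvg_ext (ccvgD (ev_cvg hf w1) (ev_cvg hg w1)) => n.
by rewrite -big_split; apply: eq_bigr => i _; rewrite mulrDl.
Qed.

Lemma evM f g w : CV f -> CV g -> normc w < 1 -> ev (f * g) w = ev f w * ev g w.
Proof.
move=> hf hg w1; have hfg := CV_mul hf hg.
apply: ccvg_uniq (ev_cvg hfg w1) _.
have [B HB] := CV_dom hf w1; have [D HD] := CV_dom hg w1.
have [/andP[s0 s1] _] := midrad_bound w1; have ht := midrad2_bound w1.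
have /andP[t0 t1] := ht; set s := midrad w in s0 s1 HB HD ht t0 t1.
have hs : 0 <= s < 1 by rewrite ltW.
have B0 : 0 <= B by have := HB 0%N; rewrite !expr0 !mulr1; apply: le_trans (normc_ge0 _).
have D0 : 0 <= D by have := HD 0%N; rewrite !expr0 !mulr1; apply: le_trans (normc_ge0 _).
apply: ccvg_diff (ccvgM (ev_cvg hf w1) (ev_cvg hg w1)) _.
pose K := B * D * (2 * (1 - s)^-1) * (1 - s)^-1.
apply: rnull_le (rnullMl K (rnull_exp hs)) _ => N.
rewrite ger0_norm ?normc_ge0 // normcB.
pose p (h : pser C) : {poly C} := \poly_(i < N) (cf h i * w ^+ i).
have pE h : \sum_(i < N) cf h i * w ^+ i = (p h).[1].
  rewrite (@horner_coef_wide _ N) ?size_poly //; apply: eq_bigr => i _.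
  by rewrite coef_poly ltn_ord expr1n mulr1.
rewrite (pE f) (pE g) -hornerM (@horner_coef_wide _ (N + N)); last first.
  apply: leq_trans (size_polyMleq _ _) _.
  by apply: leq_trans (leq_pred _) _; apply: leq_add; exact: size_poly.
rewrite big_split_ord /= [X in X + _ - _](_ : _ = \sum_(i < N) cf (f * g) i * w ^+ i); last first.
  apply: eq_bigr => i _; rewrite expr1n mulr1 coefM cfM mulr_suml; apply: eq_bigr => j _.
  have jN : (j < N)%N by have := ltn_ord i; have := ltn_ord j; lia.
  have ijN : (i - j < N)%N by have := ltn_ord i; lia.
  rewrite !coef_poly jN ijN mulrACA -exprD subnKC //; exact: ltnSE (ltn_ord j).
rewrite addrAC subrr add0r; apply: le_trans (normc_sum _ _ _) _.
have K0 : 0 <= (1 - s)^-1 by rewrite invr_ge0 subr_ge0 ltW.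
have le1 n : normc (p f * p g)`_n <= B * D * (2 * (1 - s)^-1) * s ^+ n.
  rewrite coefM; apply: le_trans (normc_sum _ _ _) _.
  apply: (@le_trans _ _ (\sum_(j < n.+1) B * D * (s ^+ 2) ^+ n)).
    apply: ler_sum => j _; rewrite normcM.
    have jn : (j <= n)%N := ltnSE (ltn_ord j).
    have -> : B * D * (s ^+ 2) ^+ n = (B * (s ^+ 2) ^+ j) * (D * (s ^+ 2) ^+ (n - j)).
      by rewrite mulrACA -exprD subnKC.
    have c h E : (forall n, normc (cf h n * w ^+ n) <= E * (s ^+ 2) ^+ n) -> 0 <= E ->
        forall i, normc (p h)`_i <= E * (s ^+ 2) ^+ i.
      move=> hE E0 i; rewrite coef_poly; case: ifP => // _; rewrite normc0.
      by rewrite mulr_ge0 // exprn_ge0.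
    by apply: ler_pM; rewrite ?normc_ge0 // c.
  rewrite sumr_const card_ord -[leLHS]mulr_natl -exprM mulnC exprM expr2.
  rewrite -natr1 mulrDl mul1r.
  have h1 := natr_exp_le n hs.
  have h2 : s ^+ n <= (1 - s)^-1.
    apply: (@le_trans _ _ 1); first exact: exprn_ile1 (ltW s0) (ltW s1).
    by rewrite invf_ge1 ?subr_gt0 // lerBlDr lerDl ltW.
  have sn0 : 0 <= s ^+ n by rewrite exprn_ge0 // ltW.
  have BD0 : 0 <= B * D by exact: mulr_ge0.
  have -> : n%:R * (B * D * (s ^+ n * s ^+ n)) + B * D * (s ^+ n * s ^+ n) =
    B * D * (n%:R * s ^+ n + s ^+ n) * s ^+ n by ring.
  rewrite ler_wpM2r // ler_wpM2l //; lra.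
apply: (@le_trans _ _ (\sum_(i < N) B * D * (2 * (1 - s)^-1) * s ^+ N * s ^+ i)).
  by apply: ler_sum => i _; rewrite expr1n mulr1 -mulrA -exprD.
rewrite -mulr_sumr /K [leRHS]mulrAC.
by rewrite ler_wpM2l ?sum_geo_le // !mulr_ge0 // exprn_ge0 // ltW.
Qed.

Lemma ev_finite f N w : (forall n, (N <= n)%N -> cf f n = 0) -> normc w < 1 ->
  ev f w = \sum_(i < N) cf f i * w ^+ i.
Proof.
move=> h w1; apply: ccvg_uniq (ccvg_cst _).
apply: ccvg_ext (ccvg_shift (ev_cvg (CV_finite h) w1) (fun n => leq_addl N n)) => n /=.
by rewrite big_split_ord /= [X in _ + X]big1 ?addr0 // => i _; rewrite h ?mul0r // leq_addr.
Qed.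

Lemma ev_const c w : normc w < 1 -> ev (pconst c) w = c.
Proof.
move=> w1; rewrite (@ev_finite _ 1) // => [|[|n]] //.
by rewrite big_ord_recl big_ord0 expr0 mulr1 addr0.
Qed.
Lemma ev1 w : normc w < 1 -> ev 1 w = 1. Proof. exact: ev_const. Qed.
Lemma ev0 w : normc w < 1 -> ev 0 w = 0. Proof. exact: ev_const. Qed.
Lemma evX w : normc w < 1 -> ev pX w = w.
Proof.
move=> w1; rewrite (@ev_finite _ 2) // => [|[|[|n]]] //.
by rewrite !big_ord_recl big_ord0 /= mul0r add0r mul1r addr0 expr1.
Qed.
Lemma evN f w : CV f -> normc w < 1 -> ev (- f) w = - ev f w.
Proof.
move=> hf w1; apply/eqP; rewrite -addr_eq0 -evD ?addNr ?ev0 //; exact: CV_opp.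
Qed.
Lemma evB f g w : CV f -> CV g -> normc w < 1 -> ev (f - g) w = ev f w - ev g w.
Proof. by move=> hf hg w1; rewrite evD ?evN //; exact: CV_opp. Qed.
Lemma ev_exp f k w : CV f -> normc w < 1 -> ev (f ^+ k) w = ev f w ^+ k.
Proof.
move=> hf w1; elim: k => [|k IH]; first by rewrite !expr0 ev1.
by rewrite !exprS evM ?IH //; exact: CV_exp.
Qed.
Lemma ev_sum I (r : seq I) (P : pred I) (F : I -> pser C) w :
  (forall i, P i -> CV (F i)) -> normc w < 1 ->
  ev (\sum_(i <- r | P i) F i) w = \sum_(i <- r | P i) ev (F i) w.
Proof.
move=> h w1; elim: r => [|i r IH]; first by rewrite !big_nil ev0.
rewrite !big_cons; case: ifP => // Pi; rewrite evD ?IH //; [exact: h | exact: CV_sum].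
Qed.
Lemma ev_nat n w : normc w < 1 -> ev n%:R w = n%:R.
Proof.
move=> w1; elim: n => [|n IH]; first exact: ev0.
by rewrite -!natr1 evD ?IH ?ev1 //; [exact: CV_nat | exact: CV_1].
Qed.

(* [f(c X^k)] *)
Definition psub (k : nat) (c : C) f : pser C :=
  PSer (fun n => if (k %| n)%N then cf f (n %/ k)%N * c ^+ (n %/ k)%N else 0).

Lemma CV_psub k c f : (0 < k)%N -> normc c = 1 -> CV f -> CV (psub k c f).
Proof.
move=> k0 c1 hf r /andP[r0 r1].
have [|B HB] := hf (r ^+ k).
  by rewrite exprn_ge0 // exprn_ilt1 // -lt0n.
have B0 : 0 <= B by have := HB 0%N; rewrite expr0 mulr1; apply: le_trans (normc_ge0 _).
exists B => n /=; case: ifP => kn; last by rewrite normc0 mul0r.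
by rewrite normcM normcX c1 expr1n mulr1 -{2}(divnK kn) mulnC exprM.
Qed.

Lemma ev_psub k c f w : (0 < k)%N -> normc c = 1 -> CV f -> normc w < 1 ->
  ev (psub k c f) w = ev f (c * w ^+ k).
Proof.
move=> k0 c1 hf w1.
have w1' : normc (c * w ^+ k) < 1.
  by rewrite normcM c1 mul1r normcX exprn_ilt1 ?normc_ge0 // -lt0n.
apply: ccvg_uniq (ev_cvg hf w1').
have kle n : (n <= k * n)%N by rewrite leq_pmull.
apply: ccvg_ext (ccvg_shift (ev_cvg (CV_psub k0 c1 hf) w1) kle) => n /=.
elim: n => [|n IH]; first by rewrite muln0 !big_ord0.
rewrite mulnS addnC big_split_ord /= IH big_ord_recr /=; congr (_ + _).
case: k k0 {c1 hf w1' kle IH} => // k _.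
rewrite big_ord_recl addn0 dvdn_mulr // mulKn // big1 ?addr0 => [|i _].
  by rewrite exprMn -exprM mulrA.
rewrite lift0 dvdn_addr ?dvdn_mulr // gtnNdvd ?mul0r //; have := ltn_ord i; lia.
Qed.

End PowerSeriesEval.

Arguments CV_sub {R f g} _ _ r _.
Arguments CV_add {R f g} _ _ r _.
Arguments CV_mul {R f g} _ _ r _.
Arguments CV_opp {R f} _ r _.
Arguments CV_exp {R f} k _ r _.
Arguments CV_nat R n r _ : clear implicits.
Arguments CV_1 R r _ : clear implicits.
Arguments CV_X R r _ : clear implicits.

Section Exponential.
Variable R : realType.
Local Notation C := R[i].
Implicit Types (f g : pser C) (z w : C).
Local Notation Re := (@complex.Re R).
Local Notation Im := (@complex.Im R).
Local Notation pi := (@pi R).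

Definition eC z : C :=
  Complex (expR (- (2 * pi * Im z)) * cos (2 * pi * Re z))
          (expR (- (2 * pi * Im z)) * sin (2 * pi * Re z)).

Lemma cReD z w : Re (z + w) = Re z + Re w. Proof. by case: z; case: w. Qed.
Lemma cImD z w : Im (z + w) = Im z + Im w. Proof. by case: z; case: w. Qed.
Lemma cReM z w : Re (z * w) = Re z * Re w - Im z * Im w. Proof. by case: z; case: w. Qed.
Lemma cImM z w : Im (z * w) = Re z * Im w + Im z * Re w. Proof. by case: z; case: w. Qed.
Lemma cReN z : Re (- z) = - Re z. Proof. by case: z. Qed.
Lemma cImN z : Im (- z) = - Im z. Proof. by case: z. Qed.
Lemma cRe_nat n : Re (n%:R : C) = n%:R.
Proof. by elim: n => [|n IH] //; rewrite -!natr1 cReD IH. Qed.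
Lemma cIm_nat n : Im (n%:R : C) = 0.
Proof. by elim: n => [|n IH] //; rewrite -!natr1 cImD IH /= addr0. Qed.
Lemma complex_eq z w : Re z = Re w -> Im z = Im w -> z = w.
Proof. by case: z => a b; case: w => c d /= -> ->. Qed.

Lemma eCD z w : eC (z + w) = eC z * eC w.
Proof.
rewrite /eC cReD cImD; apply: complex_eq => /=.
  by rewrite !mulrDr opprD expRD cosD; ring.
by rewrite !mulrDr opprD expRD sinD; ring.
Qed.

Lemma normc_eC z : normc (eC z) = expR (- (2 * pi * Im z)).
Proof.
rewrite /= !exprMn -mulrDr cos2Dsin2 mulr1 sqrtr_sqr ger0_norm //; exact: expR_ge0.
Qed.

Lemma eC_neq0 z : eC z != 0.
Proof. by rewrite -normc_gt0 normc_eC expR_gt0. Qed.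

Lemma eC0 : eC 0 = 1.
Proof. by apply: complex_eq; rewrite /= !mulr0 oppr0 expR0 ?cos0 ?sin0 ?mul1r ?mulr0. Qed.

Lemma eC1 : eC 1 = 1.
Proof.
apply: complex_eq; rewrite /= !mulr0 oppr0 expR0 mul1r mulr1 mulr_natl ?cos2pi ?sin2pi //.
Qed.

Lemma eCN z : eC (- z) = (eC z)^-1.
Proof. by apply: (mulfI (eC_neq0 z)); rewrite -eCD subrr eC0 divff // eC_neq0. Qed.

Lemma eC_natM n z : eC (n%:R * z) = eC z ^+ n.
Proof.
by elim: n => [|n IH]; rewrite ?mul0r ?eC0 ?expr0 // -natr1 mulrDl mul1r eCD IH exprSr.
Qed.

Lemma eC_nat n : eC n%:R = 1.
Proof. by rewrite -[n%:R]mulr1 eC_natM eC1 expr1n. Qed.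

Lemma eC_int (n : int) : eC n%:~R = 1.
Proof. by case: n => n; rewrite ?NegzE ?mulrNz ?eCN -?pmulrn eC_nat ?invr1. Qed.

Lemma eC_lt1 z : 0 < Im z -> normc (eC z) < 1.
Proof. by move=> z0; rewrite normc_eC expR_lt1 oppr_lt0 !mulr_gt0 // pi_gt0. Qed.

Lemma eC_half : eC (2^-1) = -1.
Proof.
have E : (2^-1 : C) = Complex (2^-1) 0.
  apply: (@mulfI _ (2 : C)); first by rewrite pnatr_eq0.
  by rewrite divff ?pnatr_eq0 //; apply: complex_eq;
    rewrite ?cReM ?cImM cRe_nat cIm_nat /= ?mul0r ?subr0 ?divff ?pnatr_eq0 // mulr0 addr0.
rewrite E; apply: complex_eq; rewrite /= !mulr0 oppr0 expR0 mul1r (mulrC 2) mulfK ?pnatr_eq0 //.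
  exact: cospi.
exact: sinpi.
Qed.

Lemma natC_div a b : (a%:R / b%:R : C) = Complex (a%:R / b%:R) 0.
Proof.
case: (posnP b) => [->|b0]; first by rewrite !invr0 !mulr0.
have b0' : (b%:R : C) != 0 by rewrite pnatr_eq0 -lt0n.
apply: (mulIf b0'); rewrite divfK //; apply: complex_eq.
  by rewrite cReM !cRe_nat cIm_nat /= mulr0 subr0 divfK // pnatr_eq0 -lt0n.
by rewrite cImM !cRe_nat !cIm_nat /= mul0r mulr0 addr0.
Qed.

Lemma eC_inj_frac K a b : (a < K)%N -> (b < K)%N ->
  eC (a%:R / K%:R) = eC (b%:R / K%:R) -> a = b.
Proof.
wlog ab : a b / (a <= b)%N.
  move=> h aK bK E; case/orP: (leq_total a b) => ab; first exact: h.
  by apply/esym/h.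
move=> aK bK E; move: ab; rewrite leq_eqVlt => /predU1P[//|ab]; exfalso.
have K0 : (0 < K)%N by exact: leq_ltn_trans aK.
have : eC ((b - a)%:R / K%:R) = 1.
  by rewrite natrB ?(ltnW ab) // mulrBl eCD eCN -E divff // eC_neq0.
rewrite natC_div => /(congr1 Re) /=; rewrite mulr0 oppr0 expR0 mul1r.
set x := _ / _; have xP : 0 < x < 1.
  rewrite divr_gt0 ?ltr0n ?subn_gt0 //= ltr_pdivrMr ?ltr0n // mul1r ltr_nat.
  exact: leq_ltn_trans (leq_subr a b) bK.
have -> : 2 * pi * x = (pi * x) *+ 2 by rewrite mulr2n; ring.
have := pi_gt0 R => p0.
have s0 : 0 < sin (pi * x).
  by apply: sin_gt0_pi; rewrite mulr_gt0 ?(andP xP).1 //= gtr_pMr ?(andP xP).2.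
rewrite cos_mulr2n cos2sin2 => h.
have : sin (pi * x) ^+ 2 > 0 by rewrite exprn_gt0.
by move: (sin (pi * x) ^+ 2) h => y; rewrite mulr2n; lra.
Qed.

Lemma normc_1sub_eC z : normc (1 - eC z) ^+ 2 =
  (1 - normc (eC z)) ^+ 2 + 4 * normc (eC z) * sin (pi * Re z) ^+ 2.
Proof.
rewrite normc_sqr cReB cImB normc_eC [Im 1]/= [Re 1]/= [Re (eC z)]/= [Im (eC z)]/=.
have -> : 2 * pi * Re z = (pi * Re z) *+ 2 by rewrite mulr2n; ring.
rewrite cos_mulr2n sin_mulr2n; have := cos2Dsin2 (pi * Re z).
move: (expR _) (cos _) (sin _) => r c s h.
have -> : (0 - r * ((c * s) *+ 2)) ^+ 2 = 4 * r ^+ 2 * c ^+ 2 * s ^+ 2 by rewrite mulr2n; ring.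
have -> : c ^+ 2 = 1 - s ^+ 2 by rewrite -h; ring.
by rewrite mulr2n; ring.
Qed.

Lemma ccvg_real (u : nat -> R) (l : R) : rnull (fun n => u n - l) ->
  ccvg (fun n => (u n)%:C%C : C) (l%:C)%C.
Proof.
move=> h; apply: (rnull_le (v := fun n => `|u n - l|)).
  by move=> e /h[N HN]; exists N => n /HN; rewrite normr_id.
by move=> n; rewrite -(rmorphB (real_complex R)) normc_real normr_id.
Qed.

Lemma derive_dyadic (f : R -> R) (d a : R) : is_derive (0 : R) 1 f d ->
  rnull (fun k => 2 ^+ k * (f (a / 2 ^+ k) - f 0) - d * a).
Proof.
case=> df dv; case: (eqVneq a 0) => [->|a0].
  by move=> e e0; exists 0%N => n _; rewrite mul0r subrr !mulr0 subrr normr0.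
have : ((fun h => h^-1 *: ((f \o shift (0 : R)) (h *: (1 : R)) - f 0)) @ 0^' --> d)%classic.
  by rewrite -dv; exact: df.
move=> /cvgrPdist_lt h e e0.
have an0 : 0 < `|a| by rewrite normr_gt0.
have [dl dl0 Hdl] := h _ (divr_gt0 e0 an0).
have h2 : 0 <= (2^-1 : R) < 1 by lra.
have [N HN] := rnull_exp h2 (divr_gt0 dl0 an0).
exists N => n /HN; rewrite normrX ger0_norm ?(andP h2).1 // => hn.
have p2 : (2 ^+ n : R) != 0 by rewrite expf_neq0 // pnatr_eq0.
have hh0 : a / 2 ^+ n != 0 by rewrite mulf_neq0 // invr_eq0.
have := Hdl (a / 2 ^+ n); rewrite /ball /= sub0r normrN => /(_ _ hh0).
rewrite /GRing.scale /= mulr1 addr0 => H.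
have {}H : `|d - (a / 2 ^+ n)^-1 * (f (a / 2 ^+ n) - f 0)| < e / `|a|.
  apply: H; rewrite normrM -exprVn [X in _ * X]ger0_norm ?exprn_ge0 ?(andP h2).1 //.
  by rewrite mulrC -ltr_pdivlMr.
rewrite ltr_pdivlMr // -normrM in H.
rewrite distrC; apply: le_lt_trans H; rewrite le_eqVlt; apply/orP; left; apply/eqP; congr `|_|.
by rewrite mulrBl; congr (_ - _); rewrite invf_div [RHS]mulrAC divfK.
Qed.

Lemma ccvg_eC_dyadic z : ccvg (fun k => 2 ^+ k * (eC (z / 2 ^+ k) - 1)) (Complex 0 (2 * pi) * z).
Proof.
pose a := - (2 * pi * Im z); pose b := 2 * pi * Re z.
have pE k : (2 ^+ k : C) = ((2 ^+ k : R)%:C)%C by rewrite rmorphXn rmorph_nat.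
have zk k : z / 2 ^+ k = Complex (Re z / 2 ^+ k) (Im z / 2 ^+ k).
  rewrite pE -fmorphV; apply: complex_eq; rewrite ?cReM ?cImM /= !mulr0 ?subr0 ?add0r //.
have eE k : eC (z / 2 ^+ k) = ((expR (a / 2 ^+ k))%:C)%C *
    Complex (cos (b / 2 ^+ k)) (sin (b / 2 ^+ k)).
  rewrite zk; apply: complex_eq; rewrite /= !mul0r ?subr0 ?addr0 /a /b -?mulNr !mulrA //.
have he := ccvg_real (derive_dyadic a (is_derive_expR 0)).
have hc := ccvg_real (derive_dyadic b (is_derive_cos 0)).
have hs := ccvg_real (derive_dyadic b (is_derive_sin 0)).
rewrite expR0 mul1r in he; rewrite sin0 oppr0 mul0r in hc; rewrite cos0 mul1r in hs.
have h2 : 0 <= (2^-1 : R) < 1 by lra.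
have hh : ccvg (fun k => ((2^-1 ^+ k : R)%:C)%C : C) 0.
  rewrite -[0](rmorph0 (real_complex R)); apply: ccvg_real => e /(rnull_exp h2)[N HN].
  by exists N => n /HN; rewrite subr0.
pose i1 : C := Complex 0 1.
have hcs := ccvgD hc (ccvgMl i1 hs).
have h1 := ccvgD (ccvgM hh hcs) (ccvg_cst 1).
have := ccvgD (ccvgM he h1) hcs.
have -> : (a%:C)%C * (0 * ((0 : R)%:C%C + i1 * b%:C%C) + 1) + ((0 : R)%:C%C + i1 * b%:C%C) =
    Complex 0 (2 * pi) * z.
  rewrite mul0r add0r mulr1; apply: complex_eq; rewrite ?cReD ?cImD ?cReM ?cImM /= /a /b; ring.
apply: ccvg_ext => k; rewrite eE.
have -> : Complex (cos (b / 2 ^+ k)) (sin (b / 2 ^+ k)) =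
    (cos (b / 2 ^+ k))%:C%C + i1 * (sin (b / 2 ^+ k))%:C%C :> C.
  by apply: complex_eq; rewrite ?cReD ?cImD ?cReM ?cImM /=; ring.
have cE (x y : R) : ((2 ^+ k * (x - y))%:C)%C = 2 ^+ k * (x%:C%C - y%:C%C) :> C.
  by rewrite pE -(rmorphB (real_complex R)) -(rmorphM (real_complex R)).
have hE : ((2^-1 ^+ k : R)%:C)%C = (2 ^+ k)^-1 :> C.
  by rewrite pE -(fmorphV (real_complex R)) exprVn.
rewrite !cE hE ?expR0 ?cos0 ?sin0 (rmorph1 (real_complex R)) (rmorph0 (real_complex R)).
have p2 : (2 ^+ k : C) != 0 by rewrite expf_neq0 // pnatr_eq0.
by field.
Qed.

End Exponential.

Section Cauchy.
Variable R : realType.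
Local Notation C := R[i].
Implicit Types (f g : pser C) (z w : C).
Local Notation pi := (@pi R).

Lemma ev_tail_unif f (r : R) : CV f -> 0 <= r < 1 -> exists B t, [/\ 0 <= B, 0 <= t < 1 &
  forall w, normc w <= r -> forall N, normc (ev f w - \sum_(i < N) cf f i * w ^+ i) <= B * t ^+ N].
Proof.
move=> hf /andP[r0 r1].
have nr : normc (r%:C%C : C) = r by rewrite normc_real ger0_norm.
have r1' : normc (r%:C%C : C) < 1 by rewrite nr.
have [B HB] := CV_dom hf r1'; have ht := midrad2_bound r1'.
have B0 : 0 <= B by have := HB 0%N; rewrite !expr0 !mulr1; apply: le_trans (normc_ge0 _).
exists (B / (1 - midrad (r%:C%C : C) ^+ 2)), (midrad (r%:C%C : C) ^+ 2); split => //.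
  by rewrite divr_ge0 // subr_ge0 ltW // (andP ht).2.
move=> w wr N; rewrite mulrAC; apply: csum_tail => // n; apply: le_trans (HB n).
rewrite !normcM !normcX nr ler_wpM2l ?normc_ge0 // lerXn2r ?nnegrE ?normc_ge0 //.
Qed.

Lemma ev_bound f (r : R) : CV f -> 0 <= r < 1 ->
  exists2 B, 0 <= B & forall w, normc w <= r -> normc (ev f w) <= B.
Proof.
move=> hf hr; have [B [t [B0 _ HB]]] := ev_tail_unif hf hr; exists B => // w wr.
by have := HB _ wr 0%N; rewrite big_ord0 subr0 expr0 mulr1.
Qed.

Lemma CV_shift f : CV f -> CV (pshift f).
Proof.
move=> hf r /andP[r0 r1]; pose s := (1 + r) / 2.
have hs : 0 <= s < 1 by rewrite /s; apply/andP; split; lra.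
have s0 : 0 < s by rewrite /s; lra.
have rs1 : r <= s by rewrite /s; lra.
clearbody s; have [B HB] := hf s hs; exists (B / s) => n /=.
rewrite ler_pdivlMr //; apply: le_trans (HB n.+1).
have rs : r ^+ n <= s ^+ n by rewrite lerXn2r ?nnegrE // ltW.
rewrite exprSr mulrA. apply: ler_wpM2r; first exact: ltW.
by apply: ler_wpM2l => //; exact: normc_ge0.
Qed.

Lemma ev_split0 f w : CV f -> normc w < 1 -> ev f w = cf f 0 + w * ev (pshift f) w.
Proof.
move=> hf w1; have hs := CV_shift hf.
have E : f = pconst (cf f 0) + pX * pshift f.
  by apply: pserP => -[|n]; rewrite cfD -[pX]expr1 cf_pXnM /= ?addr0 ?add0r ?subn1.
rewrite [in LHS]E evD ?evM ?ev_const ?evX //; first exact: CV_X.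
- exact: CV_const.
- by apply: CV_mul => //; exact: CV_X.
Qed.

Lemma ccvg_ev0 f (w : nat -> C) : CV f -> ccvg w 0 -> ccvg (fun n => ev f (w n)) (cf f 0).
Proof.
move=> hf hw; have hr : 0 <= (2^-1 : R) < 1 by lra.
have [B B0 HB] := ev_bound (CV_shift hf) hr.
have h := rnullMl B hw; have h2 : 0 < (2^-1 : R) by lra.
have [N HN] := hw _ h2.
move=> e /h[M HM]; exists (maxn N M) => n; rewrite geq_max => /andP[/HN a /HM b].
rewrite subr0 ger0_norm ?normc_ge0 // in a.
rewrite ev_split0 //; last by apply: lt_trans a _; lra.
rewrite addrAC subrr add0r normcM; apply: le_lt_trans b.
rewrite !ger0_norm ?mulr_ge0 ?normc_ge0 // subr0 mulrC ler_wpM2r ?normc_ge0 //.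
by apply/HB/ltW.
Qed.

Lemma root_of_unity_sum K (i n : nat) : (i < K)%N -> (n < K)%N ->
  \sum_(k < K) (eC (i%:R / K%:R) / eC (n%:R / K%:R)) ^+ k = (K%:R *+ (i == n) : C).
Proof.
move=> iK nK; have K0 : (K%:R : C) != 0 by rewrite pnatr_eq0 -lt0n (leq_ltn_trans _ iK).
case: eqP => [->|ni].
  rewrite divff ?eC_neq0 // (eq_bigr (fun _ => 1)) => [|k _]; last by rewrite expr1n.
  by rewrite sumr_const card_ord mulr1n.
set z := eC (_ / _) / _; have z1 : z != 1.
  apply/eqP => E; case: ni; apply: (@eC_inj_frac R K) => //.
  move/(congr1 (fun t => t * eC (n%:R / K%:R))): E; rewrite /z mul1r => <-.
  by rewrite divfK ?eC_neq0.
apply: (mulfI (x := z - 1)); first by rewrite subr_eq0.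
rewrite -subrX1 mulr0 /z expr_div_n -!eC_natM !(mulrC K%:R) !divfK // !eC_nat divr1 subrr //.
Qed.

Lemma cauchy_coef f (y M : R) n : CV f -> 0 < y ->
  (forall x, normc (ev f (eC (Complex x y))) <= M) ->
  normc (cf f n) * expR (- (2 * pi * y)) ^+ n <= M.
Proof.
move=> hf y0 hM; pose w0 := eC (Complex 0 y : C).
have nw0 : normc w0 = expR (- (2 * pi * y)) by rewrite normc_eC.
have w01 : normc w0 < 1 by exact: eC_lt1.
rewrite -nw0 -normcX -normcM.
have hr : 0 <= normc w0 < 1 by rewrite normc_ge0.
have [B [t [B0 ht HB]]] := ev_tail_unif hf hr.
apply/ler_addgt0Pl => e e0.
have [N HN] := rnullMl B (rnull_exp ht) e0.
pose K := (maxn N n).+1; have nK : (n < K)%N by rewrite ltnS leq_maxr.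
have NK : (N <= K)%N by apply: leq_trans (leq_maxl N n) (leqnSn _).
have K0 : (K%:R : C) != 0 by rewrite pnatr_eq0.
pose u k : C := eC (Complex (k%:R / K%:R) y).
have uE k : u k = w0 * eC (1 / K%:R) ^+ k.
  rewrite /w0 -eC_natM -eCD; congr eC; rewrite mul1r natC_div.
  by apply: complex_eq; rewrite ?cReD ?cImD /= ?add0r ?addr0.
have zE k i : (eC (1 / K%:R) ^+ k) ^+ i = eC (i%:R / K%:R) ^+ k :> C.
  by rewrite -exprM mulnC exprM -[eC _ ^+ i]eC_natM mul1r.
have nu k : normc (u k) = normc w0 by rewrite !normc_eC.
pose A := \sum_(k < K) (\sum_(i < K) cf f i * u k ^+ i) / eC (n%:R / K%:R) ^+ k.
have AE : A = K%:R * (cf f n * w0 ^+ n).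
  rewrite /A; under eq_bigr => k _ do rewrite mulr_suml.
  rewrite exchange_big /= (bigD1 (Ordinal nK)) //= [X in _ + X]big1 => [|i ni].
    rewrite addr0; transitivity (\sum_(k < K) cf f n * w0 ^+ n).
      apply: eq_bigr => k _; rewrite uE exprMn zE mulrA.
      by rewrite mulfK // expf_neq0 // eC_neq0.
    by rewrite sumr_const card_ord mulr_natl.
  transitivity (cf f i * w0 ^+ i * \sum_(k < K) (eC (i%:R / K%:R) / eC (n%:R / K%:R)) ^+ k).
    rewrite mulr_sumr; apply: eq_bigr => k _.
    by rewrite uE exprMn zE expr_div_n !mulrA.
  rewrite root_of_unity_sum //; rewrite -val_eqE /= in ni; by rewrite (negbTE ni) mulr0.
have : normc A <= K%:R * (e + M).
  rewrite /A; apply: le_trans (normc_sum _ _ _) _.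
  have -> : K%:R * (e + M) = \sum_(k < K) (e + M) by rewrite sumr_const card_ord mulr_natl.
  apply: ler_sum => k _.
  rewrite normcM normcV normcX [normc (eC _)]normc_eC natC_div mulr0 oppr0 expR0 expr1n invr1 mulr1.
  have h1 := HB (u k) (eq_ind _ (fun x => normc (u k) <= x) (lexx _) _ (nu k)) K.
  have h2 := hM (k%:R / K%:R); have h3 := HN K NK.
  have h4 := normc_sub_le (\sum_(i < K) cf f i * u k ^+ i) (ev f (u k)).
  rewrite normcB in h4; move: h3; rewrite ger0_norm ?mulr_ge0 ?exprn_ge0 ?(andP ht).1 // => h3.
  rewrite -/(u k) in h2; lra.
rewrite AE [normc (K%:R * _)]normcM normc_nat ler_pM2l ?ltr0n //.
Qed.

Lemma ev_eq0 f (y : R) : CV f -> 0 < y ->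
  (forall x, ev f (eC (Complex x y)) = 0) -> f = 0.
Proof.
move=> hf y0 h; apply: pserP => n; rewrite cf0; apply/eqP; rewrite -normc_eq0.
have le : normc (cf f n) * expR (- (2 * pi * y)) ^+ n <= 0.
  by apply: cauchy_coef => // x; rewrite h normc0.
apply/eqP/le_anti; rewrite normc_ge0 andbT.
by move: le; rewrite pmulr_lle0 // exprn_gt0 // expR_gt0.
Qed.

End Cauchy.

(** * Lipschitz's summation formula *)

Section Lipschitz.
Variable R : realType.
Local Notation C := R[i].
Implicit Types (z w : C).
Local Notation Re := (@complex.Re R).
Local Notation Im := (@complex.Im R).
Local Notation pi := (@pi R).

Lemma ccvgV (u : nat -> C) (l : C) : l != 0 -> ccvg u l -> ccvg (fun n => (u n)^-1) l^-1.
Proof.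
move=> l0 hu; have nl0 : 0 < normc l by rewrite normc_gt0.
have h2 : 0 < normc l / 2 by lra.
have [N HN] := hu _ h2.
have hB := rnullMl (2 / normc l ^+ 2) hu.
move=> e /hB[M HM]; exists (maxn N M) => n; rewrite geq_max => /andP[/HN a /HM b].
rewrite ger0_norm ?normc_ge0 // in a.
have un : normc l / 2 <= normc (u n).
  by have := normc_sub_le l (u n); rewrite normcB; lra.
have un0 : 0 < normc (u n) by lra.
have u0 : u n != 0 by rewrite -normc_gt0.
rewrite ger0_norm ?normc_ge0 //; apply: le_lt_trans b.
have -> : (u n)^-1 - l^-1 = (u n * l)^-1 * (l - u n) by field; rewrite u0 l0.
rewrite normcM normcV normcM normcB ger0_norm; last first.
  by rewrite mulr_ge0 ?normc_ge0 // divr_ge0 // exprn_ge0 // ltW.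
rewrite ler_wpM2r ?normc_ge0 // ler_pdivlMr ?exprn_gt0 // mulrC ler_pdivrMr ?mulr_gt0 //.
by rewrite expr2; move: (normc l) (normc (u n)) nl0 un => x y; nra.
Qed.

Lemma ler_cos_pi (x y : R) : 0 <= x -> x <= y -> y <= pi -> cos y <= cos x.
Proof.
move=> x0; rewrite le_eqVlt => /predU1P[-> //|xy] yp; apply: ltW.
have y0 : 0 <= y by exact: ltW (le_lt_trans x0 xy).
have xp : x <= pi by exact: ltW (lt_le_trans xy yp).
by rewrite ltr_cos ?in_itv /= ?x0 ?y0 ?xp ?yp.
Qed.

Lemma ler_sin (t : R) : 0 <= t <= 3 / 4 -> t / 2 <= sin (pi * t).
Proof.
move=> /andP[t0 t1]; have p0 := pi_gt0 R; have p2 := pi_ge2 R.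
have c4 : cos (pi / 4) ^+ 2 = 2^-1.
  have := cos_mulr2n (pi / 4); rewrite (_ : (pi / 4) *+ 2 = pi / 2); last by rewrite mulr2n; field.
  by rewrite cos_pihalf mulr2n; lra.
have c40 : 0 < cos (pi / 4) by apply: cos_gt0_pihalf; apply/andP; split; lra.
have c4h : 2^-1 <= cos (pi / 4).
  by move: (cos (pi / 4)) c4 c40 => c; rewrite expr2; nra.
case: (lerP t (1 / 4)) => t4; last first.
  have s0 : 0 <= sin (pi * t) by apply: sin_ge0_pi; apply/andP; split; nra.
  have : cos (pi * t) ^+ 2 <= 2^-1.
    rewrite -c4; have h1 : cos (pi * t) <= cos (pi / 4).
      by apply: ler_cos_pi; nra.
    have h2 : - cos (pi / 4) <= cos (pi * t).
      have -> : - cos (pi / 4) = cos (pi * (3 / 4)).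
        rewrite (_ : pi * (3 / 4) = - (pi / 4) + pi); last by field.
        by rewrite cosDpi cosN.
      by apply: ler_cos_pi; nra.
    have ha : `|cos (pi * t)| <= cos (pi / 4) by rewrite ler_norml h2 h1.
    by rewrite -[leLHS]real_normK ?num_real // lerXn2r ?nnegrE ?(ltW c40).
  have := cos2Dsin2 (pi * t); move: (sin _) (cos _) s0 => s c s0 E h.
  by rewrite !expr2 in E h; nra.
case: (eqVneq t 0) => [->|tn0]; first by rewrite mulr0 sin0 mul0r.
have tp : 0 < pi * t by rewrite mulr_gt0 // lt_def tn0.
have [|x xP] := @MVT R sin cos 0 (pi * t) tp (fun y _ => is_derive_sin y).
  by apply: continuous_subspaceT => y; exact: continuous_sin.
rewrite sin0 !subr0 => ->; move: xP; rewrite in_itv /= => /andP[x0 x1].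
have : 2^-1 <= cos x.
  by apply: le_trans c4h _; apply: ler_cos_pi; nra.
by move: (cos x) => c hc; nra.
Qed.

Lemma sqr_sin_ge (x : R) : `|x| <= 3 / 4 -> (x / 2) ^+ 2 <= sin (pi * x) ^+ 2.
Proof.
wlog x0 : x / 0 <= x.
  move=> h; case/orP: (le_total 0 x) => x0; first exact: h.
  by rewrite -normrN -(sqrrN (sin _)) -sinN -mulrN -(sqrrN (x / 2)) -mulNr; apply: h; rewrite oppr_ge0.
rewrite ger0_norm // => x1; rewrite lerXn2r ?nnegrE ?divr_ge0 //; last first.
  by apply: ler_sin; rewrite x0.
by apply: le_trans (ler_sin _); rewrite ?x0 ?divr_ge0.
Qed.

Definition koebe w : C := w / (1 - w) ^+ 2.

Lemma normc_koebe z : 0 <= Im z -> `|Re z| <= 3 / 4 -> z != 0 -> normc (koebe (eC z)) <= 4 / normc z ^+ 2.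
Proof.
move=> y0 x1 z0; have nz0 : 0 < normc z by rewrite normc_gt0.
have rho0 : 0 < normc (eC z) by rewrite normc_gt0 eC_neq0.
rewrite /koebe normcM normcV normcX normc_1sub_eC.
set rho := normc (eC z) in rho0 *.
have hs := sqr_sin_ge x1; set s2 := sin _ ^+ 2 in hs *.
have hr : rho * (Im z) ^+ 2 <= (1 - rho) ^+ 2.
  rewrite /rho normc_eC; set u := pi * Im z.
  have u0 : 0 <= u by rewrite mulr_ge0 // pi_ge0.
  have yu : Im z <= u by have := pi_ge2 R; rewrite /u; nra.
  have -> : - (2 * pi * Im z) = - u + - u by rewrite /u; ring.
  rewrite expRD expRN; have h1 := expR_ge1Dx u; move: (expR u) h1 => E h1.
  have E0 : 0 < E by lra.
  have hE : Im z <= E - E^-1.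
    apply: le_trans yu _; rewrite -[E in E - _]mulr1 -(ler_pM2r E0) mulrBl mulVf ?gt_eqF //; nra.
  have -> : (1 - E^-1 * E^-1) = E^-1 * (E - E^-1) by field; rewrite gt_eqF.
  rewrite exprMn -expr2 ler_wpM2l ?exprn_ge0 ?invr_ge0 ?(ltW E0) //.
  by rewrite lerXn2r ?nnegrE //; apply: le_trans hE.
have hz : normc z ^+ 2 = Re z ^+ 2 + Im z ^+ 2 := normc_sqr z.
have hz2 : 0 < normc z ^+ 2 by rewrite exprn_gt0.
have key : rho * normc z ^+ 2 <= 4 * ((1 - rho) ^+ 2 + 4 * rho * s2).
  have h1 : rho * Re z ^+ 2 <= 4 * (rho * s2).
    rewrite [leRHS]mulrCA ler_wpM2l ?(ltW rho0) //; move: hs; rewrite exprMn exprVn -natrX.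
    by rewrite ler_pdivrMr ?ltr0n // mulrC.
  have h2 := sqr_ge0 (1 - rho); have h3 : 0 <= rho * Re z ^+ 2 by rewrite mulr_ge0 ?sqr_ge0 // ltW.
  rewrite hz mulrDr; move: (rho * Re z ^+ 2) (rho * Im z ^+ 2) ((1 - rho) ^+ 2) hr h1 h2 h3 => a b D.
  by rewrite -[4 * rho * s2]mulrA; move: (rho * s2) => v; lra.
have den : 0 < (1 - rho) ^+ 2 + 4 * rho * s2.
  have h4 : 0 < rho * normc z ^+ 2 by rewrite mulr_gt0.
  by move: ((1 - rho) ^+ 2 + 4 * rho * s2) (rho * normc z ^+ 2) key h4 => a b; lra.
by rewrite ler_pdivlMr // mulrAC ler_pdivrMr.
Qed.

Lemma ccvg_koebe z : z != 0 ->
  ccvg (fun m => koebe (eC (z / 2 ^+ m)) / 4 ^+ m) ((Complex 0 (2 * pi) * z) ^- 2).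
Proof.
move=> z0; have p0 := pi_gt0 R.
have t0 : Complex 0 (2 * pi) * z != 0.
  by rewrite mulf_neq0 //; apply/eqP => /(congr1 Im) /= /eqP; rewrite mulf_eq0 pnatr_eq0 (gt_eqF p0).
have hz := ccvg_eC_dyadic z.
have h2 : 0 <= (2^-1 : R) < 1 by lra.
have hh : ccvg (fun k => ((2^-1 ^+ k : R)%:C)%C : C) 0.
  rewrite -[0](rmorph0 (real_complex R)); apply: ccvg_real => e /(rnull_exp h2)[N HN].
  by exists N => n /HN; rewrite subr0.
have he : ccvg (fun k => eC (z / 2 ^+ k)) 1.
  have := ccvgD (ccvgM hh hz) (ccvg_cst 1); rewrite mul0r add0r; apply: ccvg_ext => k.
  rewrite rmorphXn (fmorphV (real_complex R)) rmorph_nat exprVn mulKf ?subrK //.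
  by rewrite expf_neq0 // pnatr_eq0.
have := ccvgM he (ccvgV (expf_neq0 2 t0) (ccvgX 2 hz)); rewrite mul1r; apply: ccvg_ext => k.
rewrite /koebe exprMn invfM -[(eC _ - 1) ^+ 2]sqrrN opprB -exprM mulnC exprM (_ : 2 ^+ 2 = 4 :> C).
  by rewrite mulrCA mulrC.
by rewrite -natrX.
Qed.

(* The duplication formula, the behaviour at 0 and the domination below characterise
   [h(e^{2 i pi z}) = \sum_n (2 i pi (z + n))^{-k}], by dyadic subdivision of z. *)
Definition lip_kernel k (h : C -> C) := [/\
  forall w, w ^+ 2 != 1 -> h w + h (- w) = 2 ^+ k * h (w ^+ 2),
  forall z, z != 0 -> ccvg (fun m => h (eC (z / 2 ^+ m)) / (2 ^+ m) ^+ k) ((Complex 0 (2 * pi) * z) ^- k) &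
  forall Y : R, exists D, forall z, 0 <= Im z <= Y -> `|Re z| <= 3 / 4 -> z != 0 ->
    normc (h (eC z)) <= D / normc z ^+ k].

(* [w / (1 - w)^2 = \sum_n n w^n], and h4, h6 are [\sum_n n^3 w^n / 3!] and
   [\sum_n n^5 w^n / 5!] written as polynomials in it. *)
Definition h4 w : C := koebe w ^+ 2 + koebe w / 6.
Definition h6 w : C := koebe w ^+ 3 + koebe w ^+ 2 / 4 + koebe w / 120.

Let cvg_h4 : ccvg (fun k => ((4 ^+ k)^-1 : C)) 0.
Proof.
have h2 : 0 <= (4^-1 : R) < 1 by lra.
have : ccvg (fun k => ((4^-1 ^+ k : R)%:C)%C : C) 0.
  rewrite -[0](rmorph0 (real_complex R)); apply: ccvg_real => e /(rnull_exp h2)[N HN].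
  by exists N => n /HN; rewrite subr0.
apply: ccvg_ext => k.
by rewrite rmorphXn (fmorphV (real_complex R)) rmorph_nat exprVn.
Qed.

Let pow4 m : (4 ^+ m : C) = (2 ^+ m) ^+ 2.
Proof. by rewrite -!natrX -expnM mulnC expnM. Qed.

Let koebe_dup w : w ^+ 2 != 1 -> [/\ 1 - w != 0, 1 + w != 0 & 1 - w ^+ 2 != 0].
Proof.
move=> h; have h' : 1 - w ^+ 2 != 0 by rewrite subr_eq0 eq_sym.
have : (1 - w) * (1 + w) != 0 by rewrite -subr_sqr expr1n.
by rewrite mulf_eq0 negb_or => /andP[? ?]; split.
Qed.

Let bound_sq z (Y : R) : 0 <= Im z <= Y -> `|Re z| <= 3 / 4 -> normc z ^+ 2 <= 1 + Y ^+ 2.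
Proof.
move=> /andP[y0 yY] x1; rewrite normc_sqr lerD //.
  by rewrite -[leLHS]real_normK ?num_real //; have := normr_ge0 (Re z); nra.
by rewrite lerXn2r ?nnegrE //; apply: le_trans yY.
Qed.

Lemma h4_kernel : lip_kernel 4 h4.
Proof.
split.
- move=> w /koebe_dup[a b c]; rewrite /h4 /koebe opprK; field; by rewrite a b c.
- move=> z z0; have h := ccvg_koebe z0.
  have := ccvgD (ccvgX 2 h) (ccvgM cvg_h4 (ccvgMl (6^-1) h)).
  rewrite mul0r addr0 exprVn -exprM; apply: ccvg_ext => m.
  have -> : (2 ^+ m) ^+ 4 = (4 ^+ m) ^+ 2 :> C.
    by rewrite pow4 -[RHS]exprM.
  have p0 : (4 ^+ m : C) != 0 by rewrite expf_neq0 // pnatr_eq0.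
  by rewrite /h4; field.
- move=> Y; exists (16 + (1 + Y ^+ 2)) => z zY x1 z0.
  have L := normc_koebe (proj1 (andP zY)) x1 z0; have B := bound_sq zY x1.
  have nz2 : 0 < normc z ^+ 2 by rewrite exprn_gt0 // normc_gt0.
  rewrite /h4 (exprM _ 2 2).
  apply: le_trans (le_normcD _ _) _; rewrite normcX [normc (_ / 6)]normcM normcV (normc_nat R 6).
  move: (normc (koebe _)) (normc_ge0 (koebe (eC z))) L => l l0.
  move: (normc z ^+ 2) nz2 B => n n0 B; rewrite ler_pdivlMr // => L.
  rewrite ler_pdivlMr ?exprn_gt0 //; move: (1 + Y ^+ 2) B => y B.
  have e1 : (l * n) ^+ 2 <= 16 by rewrite expr2; have := mulr_ge0 l0 (ltW n0); nra.
  have e2 : l * n / 6 * n <= y by nra.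
  have -> : (l ^+ 2 + l / 6) * n ^+ 2 = (l * n) ^+ 2 + l * n / 6 * n by ring.
  exact: lerD.
Qed.

Lemma h6_kernel : lip_kernel 6 h6.
Proof.
split.
- move=> w /koebe_dup[a b c]; rewrite /h6 /koebe opprK; field; by rewrite a b c.
- move=> z z0; have h := ccvg_koebe z0.
  have := ccvgD (ccvgD (ccvgX 3 h) (ccvgM cvg_h4 (ccvgMl (4^-1) (ccvgX 2 h))))
                (ccvgM (ccvgX 2 cvg_h4) (ccvgMl (120^-1) h)).
  rewrite !mul0r addr0 expr0n /= mul0r addr0 exprVn -exprM; apply: ccvg_ext => m.
  have -> : (2 ^+ m) ^+ 6 = (4 ^+ m) ^+ 3 :> C.
    by rewrite pow4 -[RHS]exprM.
  have p0 : (4 ^+ m : C) != 0 by rewrite expf_neq0 // pnatr_eq0.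
  by rewrite /h6; field.
- move=> Y; exists (64 + 16 * (1 + Y ^+ 2) + (1 + Y ^+ 2) ^+ 2) => z zY x1 z0.
  have L := normc_koebe (proj1 (andP zY)) x1 z0; have B := bound_sq zY x1.
  have nz2 : 0 < normc z ^+ 2 by rewrite exprn_gt0 // normc_gt0.
  rewrite /h6 (exprM _ 2 3).
  apply: le_trans (le_normcD _ _) _; rewrite [normc (_ / 120)]normcM normcV (normc_nat R 120).
  apply: (@le_trans _ _ (normc (koebe (eC z)) ^+ 3 + normc (koebe (eC z)) ^+ 2 / 4 + normc (koebe (eC z)) / 120)).
    rewrite lerD2r; apply: le_trans (le_normcD _ _) _.
    by rewrite [normc (_ / 4)]normcM normcV (normc_nat R 4) !normcX.
  move: (normc (koebe _)) (normc_ge0 (koebe (eC z))) L => l l0.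
  move: (normc z ^+ 2) nz2 B => n n0 B; rewrite ler_pdivlMr // => L.
  rewrite ler_pdivlMr ?exprn_gt0 //; move: (1 + Y ^+ 2) B => y B.
  have ln0 := mulr_ge0 l0 (ltW n0).
  have e0 : (l * n) ^+ 2 <= 16 by rewrite expr2; nra.
  have e1 : (l * n) ^+ 3 <= 64.
    by rewrite exprS; have := sqr_ge0 (l * n); move: ((l * n) ^+ 2) e0 => v; nra.
  have e2 : (l * n) ^+ 2 / 4 * n <= 16 * y.
    by have := sqr_ge0 (l * n); move: ((l * n) ^+ 2) e0 => v; nra.
  have e3 : l * n / 120 * n ^+ 2 <= y ^+ 2.
    have : n ^+ 2 <= y ^+ 2 by rewrite lerXn2r ?nnegrE ?(ltW n0) //; apply: le_trans B; exact: ltW.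
    by have := sqr_ge0 n; move: (n ^+ 2) (y ^+ 2) => a b; nra.
  have -> : (l ^+ 3 + l ^+ 2 / 4 + l / 120) * n ^+ 3 =
     (l * n) ^+ 3 + (l * n) ^+ 2 / 4 * n + l * n / 120 * n ^+ 2 by ring.
  by rewrite !lerD.
Qed.

End Lipschitz.

Section Tannery.
Variable R : realType.
Local Notation C := R[i].
Implicit Types (z w u : C) (h : C -> C).
Local Notation Re := (@complex.Re R).
Local Notation Im := (@complex.Im R).
Local Notation pi := (@pi R).

Lemma kernel_dyadic k h u m : lip_kernel k h -> eC u != 1 ->
  h (eC u) = (\sum_(j < 2 ^ m) h (eC ((u + j%:R) / 2 ^+ m))) / (2 ^+ m) ^+ k.
Proof.
case=> dup _ _ u1; elim: m => [|m IH].
  by rewrite expn0 big_ord_recl big_ord0 addr0 expr0 expr1n !divr1 addr0.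
have p2 j : (2 ^+ j : C) != 0 by rewrite expf_neq0 // pnatr_eq0.
have n2 : (2 : C) != 0 by rewrite pnatr_eq0.
rewrite {}IH expnS mul2n -addnn big_split_ord /= -big_split /=.
transitivity ((2 ^+ k * \sum_(j < 2 ^ m) h (eC ((u + j%:R) / 2 ^+ m))) / (2 ^+ m.+1) ^+ k).
  rewrite [2 ^+ m.+1]exprSr exprMn; field.
  by rewrite !expf_neq0.
congr (_ / _); rewrite mulr_sumr; apply: eq_bigr => j _.
pose v := (u + j%:R) / 2 ^+ m; rewrite -/v.
have v1 : eC v != 1.
  apply: contra_neq u1 => E.
  have : eC v ^+ (2 ^ m) = 1 by rewrite E expr1n.
  by rewrite -eC_natM natrX /v mulrC divfK // eCD eC_nat mulr1.
have E1 : eC ((u + j%:R) / 2 ^+ m.+1) ^+ 2 = eC v.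
  by rewrite -eC_natM /v exprSr; congr eC; field; rewrite p2.
have E2 : eC ((u + (2 ^ m + j)%:R) / 2 ^+ m.+1) = - eC ((u + j%:R) / 2 ^+ m.+1).
  rewrite -[RHS]mulN1r -(eC_half R) -eCD natrD natrX exprSr; congr eC.
  by field; rewrite p2.
by rewrite E2 dup E1.
Qed.

Definition dyad k (h : C -> C) z p (n : int) : C :=
  h (eC ((z + n%:~R) / 2 ^+ p.+1)) / (2 ^+ p.+1) ^+ k.

Lemma kernel_split k h z p : lip_kernel k h -> eC z != 1 ->
  h (eC z) = \sum_(n < 2 ^ p) (dyad k h z p n%:Z + dyad k h z p (- (n.+1%:Z))).
Proof.
move=> hk z1; have Ez : eC (z - (2 ^ p)%:R) = eC z by rewrite eCD eCN eC_nat invr1 mulr1.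
have E1 j : (z - (2 ^ p)%:R + (2 ^ p + j)%:R) / 2 ^+ p.+1 = (z + j%:Z%:~R) / 2 ^+ p.+1.
  by congr (_ / _); rewrite natrD addrA subrK.
have E2 j : (j < 2 ^ p)%N -> (z - (2 ^ p)%:R + (2 ^ p - j.+1)%:R) / 2 ^+ p.+1 =
    (z + (- (j.+1%:Z))%:~R) / 2 ^+ p.+1.
  move=> jp; congr (_ / _); rewrite natrB // -addrA; congr (_ + _).
  by rewrite addrA addNr add0r mulrNz.
rewrite -Ez (kernel_dyadic p.+1 hk) ?Ez // expnS mul2n -addnn big_split_ord /=.
rewrite (reindex_inj rev_ord_inj) /= [RHS]big_split /= [RHS]addrC mulrDl !mulr_suml.
congr (_ + _); apply: eq_bigr => j _; rewrite /dyad.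
  by rewrite E2.
by rewrite E1.
Qed.

Lemma sum_telescope_le (A : R) M d : 0 <= A -> (0 < M)%N ->
  \sum_(i < d) A / ((M + i)%:R * (M + i).+1%:R) <= A / M%:R.
Proof.
move=> A0 M0; suff -> : \sum_(i < d) A / ((M + i)%:R * (M + i).+1%:R) = A / M%:R - A / (M + d)%:R.
  by rewrite lerBlDr lerDl divr_ge0.
elim: d => [|d IH]; first by rewrite big_ord0 addn0 subrr.
rewrite big_ord_recr /= IH addnS.
have h1 : (M + d)%:R != 0 :> R by rewrite pnatr_eq0; lia.
have h2 : (M + d)%:R + 1 != 0 :> R by rewrite natr1 pnatr_eq0.
have h3 : M%:R != 0 :> R by rewrite pnatr_eq0; lia.
rewrite -natr1; move: (M + d)%:R M%:R h1 h2 h3 => a b h1 h2 h3; field.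
by rewrite ?h1 ?h2 ?h3.
Qed.

Lemma inv_pow_le n k : (0 < n)%N -> (2 <= k)%N -> (n%:R ^+ k)^-1 <= 2 / (n%:R * n.+1%:R) :> R.
Proof.
move=> n0 k2; have np : 1 <= n%:R :> R by rewrite ler1n.
apply: (@le_trans _ _ ((n%:R ^+ 2)^-1)).
  rewrite lef_pV2 ?posrE ?exprn_gt0 ?ltr0n //; exact: ler_weXn2l.
rewrite -natr1 -[_^-1]mul1r ler_pdivlMr ?mulr_gt0 //; try lra.
by rewrite mulrAC ler_pdivrMr ?exprn_gt0 //; [rewrite expr2; nra | lra].
Qed.

Lemma lipschitz_sum k h z : (2 <= k)%N -> lip_kernel k h -> 0 <= Im z -> eC z != 1 ->
  ccvg (fun M => \sum_(n < M) ((Complex 0 (2 * pi) * (z + n%:Z%:~R)) ^- k +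
                               (Complex 0 (2 * pi) * (z + (- (n.+1%:Z))%:~R)) ^- k)) (h (eC z)).
Proof.
move=> k2 hk y0 z1; case: (hk) => _ hlim hdom.
have [D0 HD0] := hdom (Im z); pose D := `|D0|.
have Im_z n : Im (z + n%:~R) = Im z.
  by rewrite cImD; case: n => n; rewrite ?NegzE ?mulrNz ?cImN -?pmulrn cIm_nat ?oppr0 addr0.
have zn0 n : z + n%:~R != 0.
  apply: contra_neq z1 => E; have : eC (z + n%:~R) = 1 by rewrite E eC0.
  by rewrite eCD eC_int mulr1.
have Re_pow (v : C) j : Re (v / 2 ^+ j) = Re v / 2 ^+ j /\ Im (v / 2 ^+ j) = Im v / 2 ^+ j.
  have -> : (2 ^+ j : C) = ((2 ^+ j : R)%:C)%C by rewrite rmorphXn rmorph_nat.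
  by rewrite -(fmorphV (real_complex R)) cReM cImM /= !mulr0 subr0 add0r.
pose x := `|Re z|.
have [X HX] : exists X : nat, x <= X%:R.
  by exists (Num.bound x); apply: ltW; apply: le_lt_trans (archi_boundP (normr_ge0 _)).
have dle p (n : int) : (X.*2 <= 2 ^ p)%N -> `|n%:~R : R| <= 2 ^+ p ->
    normc (dyad k h z p n) <= D / normc (z + n%:~R) ^+ k.
  move=> Xp np; rewrite /dyad normcM normcV !normcX (normc_nat R 2).
  have q0 : (2 ^+ p.+1 : C) != 0 by rewrite expf_neq0 // pnatr_eq0.
  have p0 : 0 < 2 ^+ p :> R by rewrite exprn_gt0.
  have p1 : 0 < 2 ^+ p.+1 :> R by rewrite exprn_gt0.
  have v0 : (z + n%:~R) / 2 ^+ p.+1 != 0 by rewrite mulf_neq0 ?zn0 ?invr_eq0.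
  have [RE IE] := Re_pow (z + n%:~R) p.+1.
  have c1 : 0 <= Im z / 2 ^+ p.+1 <= Im z.
    rewrite divr_ge0 ?(ltW p1) //= ler_pdivrMr // ler_peMr //; apply: exprn_ege1; lra.
  have c2 : `|Re (z + n%:~R) / 2 ^+ p.+1| <= 3 / 4.
    rewrite normrM normfV (ger0_norm (ltW p1)) ler_pdivrMr // cReD.
    apply: le_trans (ler_normD _ _) _.
    have -> : Re (n%:~R : C) = n%:~R by case: (n) => j; rewrite ?NegzE ?mulrNz ?cReN -?pmulrn cRe_nat.
    have hx : x *+ 2 <= 2 ^+ p.
      apply: (@le_trans _ _ (X%:R *+ 2)); first by rewrite ler_pMn2r.
      by rewrite -mulrnA muln2 -natrX ler_nat.
    by rewrite exprS -/x; move: hx np; rewrite mulr2n; move: (2 ^+ p) => c; lra.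
  have := HD0 ((z + n%:~R) / 2 ^+ p.+1); rewrite RE IE Im_z => /(_ c1 c2 v0).
  rewrite normcM normcV normcX (normc_nat R 2) => le.
  rewrite ler_pdivrMr ?exprn_gt0 //; apply: le_trans le _.
  have nz : 0 < normc (z + n%:~R) by rewrite normc_gt0 zn0.
  rewrite expr_div_n invf_div [leLHS]mulrCA [leLHS]mulrC.
  apply: ler_wpM2r; first by rewrite exprn_ge0 // ltW.
  by apply: ler_wpM2r; [rewrite invr_ge0 exprn_ge0 // ltW | exact: ler_norm].
have sz (n : nat) : (X.*2 <= n)%N -> (0 < n)%N ->
   n%:R / 2 <= normc (z + n%:Z%:~R) /\ n%:R / 2 <= normc (z + (- (n.+1%:Z))%:~R).
  move=> Xn n0.
  have hx : x *+ 2 <= n%:R.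
    apply: (@le_trans _ _ (X%:R *+ 2)); first by rewrite ler_pMn2r.
    by rewrite -mulrnA muln2 ler_nat.
  rewrite mulr2n in hx; have xr := ler_norm (Re z); have xr' := ler_norm (- Re z).
  rewrite normrN -/x in xr'; rewrite -/x in xr.
  split.
    apply: le_trans (normc_Re _); apply: le_trans (ler_norm _).
    by rewrite -pmulrn cReD cRe_nat; lra.
  apply: le_trans (normc_Re _); rewrite -normrN; apply: le_trans (ler_norm _).
  by rewrite mulrNz -pmulrn cReD cReN cRe_nat -[n.+1%:R]natr1; move: hx xr; lra.
pose A := D * 2 ^+ k * 4.
have D0' : 0 <= D := normr_ge0 _.
have A0 : 0 <= A by rewrite !mulr_ge0 // exprn_ge0.
pose a p n := dyad k h z p n%:Z + dyad k h z p (- (n.+1%:Z)).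
have ale p n : (X.*2 <= n)%N -> (0 < n)%N -> (n < 2 ^ p)%N -> normc (a p n) <= A / (n%:R * n.+1%:R).
  move=> Xn n0 np; have [s1 s2] := sz n Xn n0.
  have Xp : (X.*2 <= 2 ^ p)%N by apply: leq_trans Xn (ltnW np).
  have np1 : `|n%:Z%:~R : R| <= 2 ^+ p by rewrite -pmulrn normr_nat -natrX ler_nat ltnW.
  have np2 : `|(- (n.+1%:Z))%:~R : R| <= 2 ^+ p by rewrite mulrNz normrN -pmulrn normr_nat -natrX ler_nat.
  have nn0 : 0 < n%:R / 2 :> R by rewrite divr_gt0 // ltr0n.
  have one v : n%:R / 2 <= normc v -> D / normc v ^+ k <= D * 2 ^+ k * (2 / (n%:R * n.+1%:R)).
    move=> le; rewrite -mulrA ler_wpM2l //.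
    apply: (@le_trans _ _ ((n%:R / 2) ^+ k)^-1).
      rewrite lef_pV2 ?posrE ?exprn_gt0 //; last exact: lt_le_trans le.
      by rewrite lerXn2r ?nnegrE ?(ltW nn0) ?normc_ge0.
    rewrite expr_div_n invf_div ler_wpM2l ?exprn_ge0 //; exact: inv_pow_le.
  apply: le_trans (le_normcD _ _) _.
  apply: le_trans (lerD (dle _ _ Xp np1) (dle _ _ Xp np2)) _.
  apply: le_trans (lerD (one _ s1) (one _ s2)) _.
  by rewrite /A; move: (D * 2 ^+ k) ((n%:R * n.+1%:R)^-1) => u v; lra.
have key M : (X.*2 <= M)%N -> (0 < M)%N ->
   normc (h (eC z) - \sum_(n < M) ((Complex 0 (2 * pi) * (z + n%:Z%:~R)) ^- k +
                               (Complex 0 (2 * pi) * (z + (- (n.+1%:Z))%:~R)) ^- k)) <= A / M%:R.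
  move=> XM M0.
  have lim1 n : ccvg (fun p => dyad k h z p n) ((Complex 0 (2 * pi) * (z + n%:~R)) ^- k).
    exact: (ccvg_shift (hlim _ (zn0 n)) (fun p => leqnSn p)).
  have lims : ccvg (fun p => \sum_(n < M) a p n) (\sum_(n < M)
     ((Complex 0 (2 * pi) * (z + n%:Z%:~R)) ^- k + (Complex 0 (2 * pi) * (z + (- (n.+1%:Z))%:~R)) ^- k)).
    elim: (M) => [|N IH].
      by rewrite big_ord0; apply: ccvg_ext (ccvg_cst 0) => p; rewrite big_ord0.
    rewrite big_ord_recr /=; apply: ccvg_ext (ccvgD IH (ccvgD (lim1 _) (lim1 _))) => p.
    by rewrite big_ord_recr.
  have := ccvg_shift (ccvgB (ccvg_cst (h (eC z))) lims) (fun p => leq_addl M p).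
  move=> /ccvg_le; apply => p /=.
  have MM : (M <= 2 ^ (M + p))%N.
    by apply: ltnW; apply: leq_trans (ltn_expl M (ltnSn 1)) _; rewrite leq_exp2l // leq_addr.
  rewrite (kernel_split (M + p) hk z1) -(subnKC MM) big_split_ord /= addrAC subrr add0r.
  apply: le_trans (normc_sum _ _ _) _; apply: le_trans (sum_telescope_le (2 ^ (M + p) - M) A0 M0).
  apply: ler_sum => i _; apply: ale.
  - exact: leq_trans XM (leq_addr _ _).
  - by rewrite addn_gt0 M0.
  - by rewrite -ltn_subRL.
have := rnullMl A (@rnull_harmonic R) => hn e /hn[N HN].
exists (maxn N (X.*2)).+1 => -[//|n]; rewrite ltnS geq_max => /andP[Nn Xn].
have hN : A / n.+1%:R < e by apply: le_lt_trans (HN _ Nn); exact: ler_norm.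
apply: le_lt_trans hN.
by rewrite ger0_norm ?normc_ge0 // normcB; apply: key => //; exact: leqW.
Qed.

End Tannery.

Section Lambert.
Variable R : realType.
Local Notation C := R[i].
Implicit Types (z w u : C) (h : C -> C) (f g : pser C).

Lemma CV_le f g : (forall n, normc (cf f n) <= normc (cf g n)) -> CV g -> CV f.
Proof.
move=> le hg r hr; have [B HB] := hg r hr; exists B => n; apply: le_trans (HB n).
by rewrite ler_wpM2r // exprn_ge0 // (andP hr).1.
Qed.

Lemma CV_pD f : CV f -> CV (pD f).
Proof.
move=> hf r /andP[r0 r1]; have [s [s0 s1 rs]] : exists s : R, [/\ 0 < s, s < 1 & r < s].
  by exists ((1 + r) / 2); split; lra.
have hs : 0 <= s < 1 by rewrite ltW.
have [B HB] := hf s hs.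
have B0 : 0 <= B by have := HB 0%N; rewrite expr0 mulr1; apply: le_trans (normc_ge0 _).
have ht : 0 <= r / s < 1 by rewrite divr_ge0 ?(ltW s0) //= ltr_pdivrMr // mul1r.
exists (B * (1 - r / s)^-1) => n; rewrite cf_pD normcM normc_nat.
have -> : r ^+ n = (r / s) ^+ n * s ^+ n by rewrite -exprMn divfK // gt_eqF.
have -> : n%:R * normc (cf f n) * ((r / s) ^+ n * s ^+ n) =
  (normc (cf f n) * s ^+ n) * (n%:R * (r / s) ^+ n) by ring.
apply: ler_pM => //; last exact: natr_exp_le.
- by rewrite mulr_ge0 ?normc_ge0 // exprn_ge0 // ltW.
- by rewrite mulr_ge0 // exprn_ge0 // (andP ht).1.
Qed.

Definition npow j : pser C := PSer (fun n => n%:R ^+ j).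

Lemma CV_npow j : CV (npow j).
Proof.
elim: j => [|j IH].
  move=> r /andP[r0 r1]; exists 1 => n; by rewrite [cf _ n]/= expr0 normc1 mul1r exprn_ile1 // ltW.
suff -> : npow j.+1 = pD (npow j) by exact: CV_pD.
by apply: pserP => n; rewrite cf_pD /= exprS.
Qed.

Lemma sum_conv_closed (F P : C -> C -> C) n :
  (forall d, P 0 d = 0) -> (forall x d, P (x + 1) d - P x d = F x d) ->
  \sum_(i < n) F i%:R n%:R = P n%:R n%:R.
Proof.
move=> P0 PS; suff H m : \sum_(i < m) F i%:R n%:R = P m%:R n%:R by exact: H.
elim: m => [|m IH]; first by rewrite big_ord0 P0.
by rewrite big_ord_recr /= IH -natr1 -PS addrC subrK.
Qed.

Lemma npow11 : 6%:R * (npow 1 * npow 1) = npow 3 - npow 1.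
Proof.
apply: pserP => n; rewrite cf_natM cfM big_ord_recr /= subnn expr1 [0%:R]/= mulr0 addr0.
transitivity (6 * \sum_(i < n) (i%:R * (n%:R - i%:R)) : C).
  congr (_ * _); apply: eq_bigr => i _; rewrite !expr1 natrB // ltnW //; exact: ltn_ord.
rewrite (@sum_conv_closed (fun x d => x * (d - x))
  (fun x d => d * (x * (x - 1) / 2) - (x - 1) * x * (2 * x - 1) / 6)); first last.
- by move=> x d; field.
- by move=> d; rewrite mul0r mul0r !mulr0 !mul0r subrr.
- by rewrite !exprS !expr0; field.
Qed.

Lemma npow13 : 60%:R * (npow 1 * npow 3) = 3%:R * npow 5 - 5%:R * npow 3 + 2%:R * npow 1.
Proof.
apply: pserP => n; rewrite cf_natM cfM cfD cfB !cf_natM big_ord_recr /= subnn [0%:R ^+ 3]expr0n /= mulr0 addr0.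
transitivity (60 * \sum_(i < n) (i%:R * (n%:R - i%:R) ^+ 3) : C).
  by congr (_ * _); apply: eq_bigr => i _; rewrite expr1 natrB // ltnW.
rewrite (@sum_conv_closed (fun x d => x * (d - x) ^+ 3)
  (fun x d => d ^+ 3 * (x * (x - 1) / 2) - 3 * d ^+ 2 * ((x - 1) * x * (2 * x - 1) / 6)
     + 3 * d * (x * (x - 1) / 2) ^+ 2
     - (x - 1) * x * (2 * x - 1) * (3 * (x - 1) ^+ 2 + 3 * (x - 1) - 1) / 30)); first last.
- by move=> x d; field.
- by move=> d; field.
- by field.
Qed.

Lemma ev_npow1 w : normc w < 1 -> ev (npow 1) w = koebe w.
Proof.
move=> w1; have w1' : 1 - w != 0.
  rewrite subr_eq0; apply: contraTneq w1 => <-; by rewrite normc1 ltxx.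
have c0 := CV_npow 0; have c1 := CV_1 R; have cx := CV_X R.
have e1 : (1 - pX) * npow 0 = 1.
  apply: pserP => n; rewrite mulrBl mul1r cfB cf1 -[pX]expr1.
  by rewrite cf_pXnM; case: n => [|n] /=; rewrite ?subr0 ?subrr.
have e2 : npow 0 * npow 0 = npow 1 + npow 0.
  apply: pserP => n; rewrite cfM cfD /= expr1 (eq_bigr (fun _ => 1)) => [|i _]; last by rewrite mulr1.
  by rewrite sumr_const card_ord -natr1.
have E1 : (1 - w) * ev (npow 0) w = 1.
  have H : ev ((1 - pX) * npow 0) w = ev 1 w by rewrite e1.
  by rewrite (evM (CV_sub c1 cx) c0 w1) (evB c1 cx w1) (ev1 w1) (evX w1) in H.
have EG : ev (npow 0) w = (1 - w)^-1 by apply: (mulfI w1'); rewrite E1 divff.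
have E2 : ev (npow 0) w * ev (npow 0) w = ev (npow 1) w + ev (npow 0) w.
  by rewrite -(evM c0 c0 w1) e2 (evD (CV_npow 1) c0 w1).
by rewrite -[LHS](addrK (ev (npow 0) w)) -E2 EG /koebe; field.
Qed.

Lemma h4_ev w : normc w < 1 -> h4 w = ev (npow 3) w / 6.
Proof.
move=> w1; rewrite /h4 -ev_npow1 //; have c1 := CV_npow 1; have c3 := CV_npow 3.
have E : 6 * (ev (npow 1) w * ev (npow 1) w) = ev (npow 3) w - ev (npow 1) w.
  by rewrite -(evM c1 c1 w1) -(ev_nat 6 w1) -(evM (CV_nat R 6) (CV_mul c1 c1) w1) npow11 (evB c3 c1 w1).
have -> : ev (npow 3) w = 6 * (ev (npow 1) w * ev (npow 1) w) + ev (npow 1) w by rewrite E subrK.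
by field.
Qed.

Lemma h6_ev w : normc w < 1 -> h6 w = ev (npow 5) w / 120.
Proof.
move=> w1; rewrite /h6 -ev_npow1 //; have c1 := CV_npow 1; have c3 := CV_npow 3; have c5 := CV_npow 5.
have E1 : 6 * (ev (npow 1) w * ev (npow 1) w) = ev (npow 3) w - ev (npow 1) w.
  by rewrite -(evM c1 c1 w1) -(ev_nat 6 w1) -(evM (CV_nat R 6) (CV_mul c1 c1) w1) npow11 (evB c3 c1 w1).
have cn j k : CV (j%:R * npow k) := CV_mul (CV_nat R j) (CV_npow k).
have E2 : 60 * (ev (npow 1) w * ev (npow 3) w) = 3 * ev (npow 5) w - 5 * ev (npow 3) w + 2 * ev (npow 1) w.
  rewrite -(evM c1 c3 w1) -(ev_nat 60 w1) -(evM (CV_nat R 60) (CV_mul c1 c3) w1) npow13.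
  rewrite (evD (CV_sub (cn 3 5) (cn 5 3)) (cn 2 1) w1) (evB (cn 3 5) (cn 5 3) w1).
  rewrite (evM (CV_nat R 3) c5 w1) (evM (CV_nat R 5) c3 w1) (evM (CV_nat R 2) c1 w1).
  by rewrite !(ev_nat _ w1).
move: (ev (npow 1) w) (ev (npow 3) w) (ev (npow 5) w) E1 E2 => a b c E1 E2.
have Eb : b = 6 * (a * a) + a by rewrite E1 subrK.
have -> : c = (60 * (a * b) + 5 * b - 2 * a) / 3 by rewrite E2; field.
by rewrite Eb; field.
Qed.

Definition cS k : pser C := psmap (ratr : {rmorphism rat -> C}) (pS rat k).

Lemma cf_cS k n : cf (cS k) n = if n == 0%N then 0 else (sigma k n)%:R.
Proof. by rewrite /=; case: eqP => _; rewrite ?rmorph0 // rmorph_nat. Qed.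

Lemma sigma_le k n : (0 < n)%N -> (sigma k n <= n ^ k.+1)%N.
Proof.
move=> n0; rewrite /sigma (perm_big _ (@perm_divisors n n _)) ?n0 ?leqnn //= big_filter.
apply: (@leq_trans (\sum_(d <- iota 1 n) n ^ k)).
  rewrite big_mkcond big_seq [X in (_ <= X)%N]big_seq; apply: leq_sum => d.
  rewrite mem_iota => /andP[d1 d2]; case: ifP => // _; case: k => // k.
  by rewrite leq_exp2r.
by rewrite big_const_seq count_predT size_iota iter_addn_0 mulnC expnS.
Qed.

Lemma CV_cS k : CV (cS k).
Proof.
apply: (@CV_le _ (npow k.+1)); last exact: CV_npow.
move=> n; rewrite cf_cS; case: (posnP n) => [->|n0]; first by rewrite normc0 normc_ge0.
by rewrite /= -natrX !normc_nat ler_nat sigma_le.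
Qed.

Lemma ccvg_lambert k w : normc w < 1 -> 
  ccvg (fun M => \sum_(m < M) ev (npow k.+1) (w ^+ m.+1)) (ev (cS k.+1) w).
Proof.
move=> w1; pose T M : pser C := \sum_(m < M) psub m.+1 1 (npow k.+1).
have cP m : CV (psub m.+1 1 (npow k.+1)) := CV_psub (ltn0Sn m) (normc1 R) (CV_npow k.+1).
have cT M : CV (T M) by apply: CV_sum => m _; exact: cP.
have ET M : ev (T M) w = \sum_(m < M) ev (npow k.+1) (w ^+ m.+1).
  transitivity (\sum_(m < M) ev (psub m.+1 1 (npow k.+1)) w).
    by apply: (ev_sum _ _ w1) => m _; exact: cP.
  apply: eq_bigr => m _.
  by rewrite (ev_psub (ltn0Sn m) (normc1 R) (CV_npow k.+1) w1) mul1r.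
have cfT M n : cf (T M) n = if n == 0%N then 0 else
    (\sum_(m < M | (m.+1 %| n)%N) (n %/ m.+1) ^ k.+1)%:R.
  rewrite /T cf_sum natr_sum [in RHS]big_mkcond /=; case: eqP => [->|_].
    by rewrite big1 // => m _; rewrite div0n exprS mul0r mul0r ?if_same.
  by apply: eq_bigr => m _; case: ifP => // _; rewrite expr1n mulr1 natrX.
have key M n : cf (cS k.+1 - T M) n =
    if n == 0%N then 0 else (\sum_(d <- divisors n | (M < d)%N) (n %/ d) ^ k.+1)%:R.
  rewrite cfB cf_cS cfT; case: posnP => [_|n0]; first by rewrite subrr.
  have -> : (sigma k.+1 n)%:R = (\sum_(d <- divisors n) (n %/ d) ^ k.+1)%:R :> C.
    rewrite /sigma !natr_sum.
    rewrite (@sum_divisors_pairs _ (fun d _ => (d ^ k.+1)%:R) n n) ?n0 ?leqnn //.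
    rewrite (@sum_divisors_pairs _ (fun _ x => (x ^ k.+1)%:R) n n) ?n0 ?leqnn //.
    under eq_bigr => a _ do rewrite big_mkcond.
    rewrite exchange_big /=; apply: eq_bigr => x _; rewrite [RHS]big_mkcond.
    by apply: eq_bigr => a _; rewrite mulnC.
  rewrite (bigID (fun d => (M < d)%N)) /= natrD.
  rewrite [X in _ + X - _](_ : _ = (\sum_(m < M | (m.+1 %| n)%N) (n %/ m.+1) ^ k.+1)%:R) ?addrK //.
  congr _%:R; rewrite -(big_mkord (fun m => m.+1 %| n)%N (fun m => (n %/ m.+1) ^ k.+1)%N).
  rewrite -(big_add1 _ _ 0 M.+1 (fun d => d %| n)%N (fun d => (n %/ d) ^ k.+1)%N).
  rewrite -big_filter -[RHS]big_filter; apply: perm_big; apply: uniq_perm.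
  - exact/filter_uniq/divisors_uniq.
  - exact/filter_uniq/iota_uniq.
  - move=> d; rewrite !mem_filter -dvdn_divisors // mem_index_iota -leqNgt ltnS.
    by case: (boolP (d %| n)%N) => dn; rewrite ?andbF //= (dvdn_gt0 n0 dn) andbT.
have [B HB] := CV_dom (CV_cS k.+1) w1; have ht := midrad2_bound w1.
apply: ccvg_ext (fun M => ET M) _.
apply: (rnull_le (v := fun M => B / (1 - midrad w ^+ 2) * (midrad w ^+ 2) ^+ M)).
  exact/rnullMl/rnull_exp.
move=> M; rewrite ger0_norm ?normc_ge0 // normcB -evB //; last exact: CV_cS.
have zero n : (n < M.+1)%N -> cf (cS k.+1 - T M) n = 0.
  move=> nM; rewrite key; case: posnP => // n0; rewrite big_seq_cond big1 // => d.
  rewrite -dvdn_divisors // => /andP[/(dvdn_leq n0) dn Md].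
  by move: (leq_trans Md (leq_trans dn nM)); rewrite ltnn.
have leS n : normc (cf (cS k.+1 - T M) n) <= normc (cf (cS k.+1) n).
  rewrite (key M n) cf_cS; case: posnP => [_|n0]; first by rewrite lexx.
  have := key 0%N n; rewrite cfB cf_cS cfT (gtn_eqF n0) big_ord0 subr0 => ->.
  rewrite !normc_nat ler_nat big_mkcond [leqRHS]big_mkcond.
  by apply: leq_sum => d _; case: d => [|d] //=; case: ifP.
have dom n : normc (cf (cS k.+1 - T M) n * w ^+ n) <= B * (midrad w ^+ 2) ^+ n.
  by apply: le_trans (HB n); rewrite [normc (cf (_ - _) n * _)]normcM [normc (cf (cS _) n * _)]normcM; apply: ler_wpM2r; [exact: normc_ge0 | exact: leS].
have := csum_tail M.+1 ht dom; rewrite -/(ev _ _) big1 ?subr0 => [|i _].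
  move=> le; apply: le_trans le _; rewrite mulrAC ler_wpM2l //.
    rewrite divr_ge0 ?subr_ge0 ?(ltW (andP ht).2) //.
    by have := HB 0%N; rewrite !expr0 !mulr1; apply: le_trans; exact: normc_ge0.
  by rewrite [leLHS]exprS; apply: ler_piMl; [exact: (exprn_ge0 _ (andP ht).1) | exact: ltW (andP ht).2].
by rewrite zero // mul0r.
Qed.

End Lambert.

Arguments CV_cS R k r _ : clear implicits.
Arguments cS R k : clear implicits.

(** * Modularity of E4, E6 and j *)

Section Lattice.
Variable R : realType.
Local Notation C := R[i].
Implicit Types (z w u : C) (h : C -> C).
Local Notation Re := (@complex.Re R).
Local Notation Im := (@complex.Im R).
Local Notation pi := (@pi R).

Definition twopii : C := Complex 0 (2 * pi).

Lemma twopii_neq0 : twopii != 0.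
Proof.
have p0 := pi_gt0 R.
by apply/eqP => /(congr1 Im) /= /eqP; rewrite mulf_eq0 pnatr_eq0 (gt_eqF p0).
Qed.

Definition zrange M : seq int :=
  0 :: [seq i.+1%:Z | i <- iota 0 M] ++ [seq - (i.+1%:Z) | i <- iota 0 M].

Lemma sum_iota0 (V : zmodType) (F : nat -> V) M : \sum_(i <- iota 0 M) F i = \sum_(i < M) F i.
Proof. by rewrite -(big_mkord xpredT) /index_iota subn0. Qed.

Lemma sum_zrange (V : zmodType) (f : int -> V) M : \sum_(n <- zrange M) f n =
  f 0 + (\sum_(i < M) f i.+1%:Z + \sum_(i < M) f (- (i.+1%:Z))).
Proof. by rewrite big_cons big_cat !big_map !sum_iota0. Qed.

Lemma sum_zrangeN (V : zmodType) (f : int -> V) M : \sum_(n <- zrange M) f (- n) = \sum_(n <- zrange M) f n.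
Proof.
rewrite !sum_zrange oppr0; congr (_ + _); rewrite addrC; congr (_ + _).
Qed.

Lemma sum_zrange_shift (V : zmodType) (f : int -> V) M : \sum_(n <- zrange M) f n =
  \sum_(i < M) (f i%:Z + f (- (i.+1%:Z))) + f M%:Z.
Proof.
rewrite sum_zrange addrA big_split /= [RHS]addrAC; congr (_ + _).
by rewrite -(big_ord_recl M (fun i => f (nat_of_ord i)%:Z)) big_ord_recr.
Qed.

Lemma intC (n : int) : Re (n%:~R : C) = n%:~R /\ Im (n%:~R : C) = 0.
Proof.
by case: n => j; rewrite ?NegzE ?mulrNz ?cReN ?cImN -?pmulrn cRe_nat cIm_nat ?oppr0.
Qed.

Lemma lattice_lower z : 0 < Im z -> exists2 c : R, 0 < c &
  forall m n : int, c * `|n%:~R| <= normc (m%:~R * z + n%:~R).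
Proof.
move=> y0; pose x := `|Re z|; have x0 : 0 <= x := normr_ge0 _.
have d0 : 0 < 2 * (x + 1) by rewrite mulr_gt0 //; lra.
pose c := Num.min (2^-1) (Im z / (2 * (x + 1))).
have c0 : 0 < c by rewrite lt_min invr_gt0 ltr0n /= divr_gt0.
have c1 : c <= 2^-1 by rewrite ge_min lexx.
have c2 : c * (2 * (x + 1)) <= Im z by rewrite -ler_pdivlMr // ge_min lexx orbT.
clearbody c; exists c => // m n.
have RE : Re (m%:~R * z + n%:~R) = m%:~R * Re z + n%:~R.
  by rewrite cReD cReM (intC m).1 (intC m).2 (intC n).1 mul0r subr0.
have IE : Im (m%:~R * z + n%:~R) = m%:~R * Im z.
  by rewrite cImD cImM (intC m).1 (intC m).2 (intC n).2 mul0r !addr0.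
have nR := normc_Re (m%:~R * z + n%:~R); have nI := normc_Im (m%:~R * z + n%:~R).
rewrite RE in nR; rewrite IE normrM [X in _ * X]gtr0_norm // in nI.
set a : R := `|m%:~R| in nI; have a0 : 0 <= a := normr_ge0 _.
set b : R := `|n%:~R|; have b0 : 0 <= b := normr_ge0 _.
case: (lerP (2 * (a * x)) b) => le.
  have h1 : b - a * x <= `|m%:~R * Re z + n%:~R|.
    rewrite /a /x /b -normrM lerBlDr; have := ler_normB (m%:~R * Re z + n%:~R) (m%:~R * Re z).
    by rewrite (_ : m%:~R * Re z + n%:~R - m%:~R * Re z = n%:~R) //; ring.
  apply: le_trans nR; apply: le_trans h1.
  by move: (a * x) le => v le; nra.
apply: le_trans nI; apply: (@le_trans _ _ (a * (c * (2 * (x + 1))))); last by rewrite ler_wpM2l.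
have : c * b <= c * (2 * (a * x)) by rewrite ler_pM2l // ltW.
by have := mulr_ge0 a0 (ltW c0); nra.
Qed.

Section Eisenstein.
Variables (k : nat) (h : C -> C).
Hypotheses (k4 : (4 <= k)%N) (kev : ~~ odd k) (hk : lip_kernel k h).

Definition eterm z (m n : int) : C := (twopii * (m%:~R * z + n%:~R)) ^- k.
(* Truncation to squares: [z |-> -1/z] merely exchanges m and n. *)
Definition esquare z M : C := \sum_(m <- zrange M) \sum_(n <- zrange M) eterm z m n.

Let k0 : (0 < k)%N. Proof. exact: leq_trans k4. Qed.

Let exprN_even (x : C) : (- x) ^+ k = x ^+ k.
Proof. by rewrite exprNn -signr_odd (negbTE kev) mul1r. Qed.

Lemma eterm_opp z m n : eterm z (- m) (- n) = eterm z m n.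
Proof.
by rewrite /eterm !mulrNz mulNr -opprD mulrN exprN_even.
Qed.

Lemma esquare_inv z M : z != 0 -> esquare (- z^-1) M = z ^+ k * esquare z M.
Proof.
move=> z0; have E m n : eterm (- z^-1) m n = z ^+ k * eterm z n (- m).
  rewrite /eterm mulrNz.
  have -> : twopii * (m%:~R * - z^-1 + n%:~R) = twopii * (n%:~R * z - m%:~R) / z by field.
  by rewrite expr_div_n invf_div.
rewrite /esquare; under eq_bigr => m _ do under eq_bigr => n _ do rewrite E.
under eq_bigr => m _ do rewrite -mulr_sumr.
rewrite -mulr_sumr; congr (_ * _).
rewrite (sum_zrangeN (fun m => \sum_(n <- zrange M) eterm z n m)).
by rewrite exchange_big.
Qed.

Lemma eterm_bound z : 0 < Im z -> exists2 A : R, 0 <= A &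
  forall (m n : int) (j : nat), (0 < j)%N -> j%:R <= `|n%:~R : R| -> normc (eterm z m n) <= A / j%:R ^+ k.
Proof.
move=> y0; have [c c0 Hc] := lattice_lower y0.
have t0 : 0 < normc twopii by rewrite normc_gt0 twopii_neq0.
exists ((normc twopii * c) ^- k); first by rewrite invr_ge0 exprn_ge0 // mulr_ge0 // ltW.
move=> m n j j0 jn; rewrite /eterm normcV normcX normcM -invfM -exprMn.
have p0 : 0 < normc twopii * c * j%:R by rewrite !mulr_gt0 // ltr0n.
have le : normc twopii * c * j%:R <= normc twopii * normc (m%:~R * z + n%:~R).
  rewrite -mulrA ler_wpM2l ?(ltW t0) //; apply: le_trans (Hc m n).
  by rewrite ler_wpM2l // ltW.
rewrite lef_pV2 ?posrE ?exprn_gt0 //; last exact: lt_le_trans le.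
by rewrite lerXn2r ?nnegrE ?(ltW p0) //; apply: le_trans le; exact: ltW.
Qed.

Lemma eC_mul_neq1 z (m : nat) : 0 < Im z -> (0 < m)%N -> eC (m%:R * z) != 1.
Proof.
move=> y0 m0; apply/eqP => E; have : normc (eC (m%:R * z)) < 1.
  by apply: eC_lt1; rewrite cImM cRe_nat cIm_nat mul0r addr0 mulr_gt0 // ltr0n.
by rewrite E normc1 ltxx.
Qed.

Lemma erow_bound z : 0 < Im z -> exists2 A : R, 0 <= A & forall M m : nat, (0 < M)%N -> (0 < m)%N ->
  normc (\sum_(n <- zrange M) eterm z m n - h (eC (m%:R * z))) <= A / M%:R ^+ 2.
Proof.
move=> y0; have [A A0 HA] := eterm_bound y0.
exists (5 * A); first by rewrite mulr_ge0.
move=> M m M0 m0; have Mp : 0 < M%:R :> R by rewrite ltr0n.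
have M1 : 1 <= M%:R :> R by rewrite ler1n.
have ny : 0 <= Im (m%:R * z).
  by rewrite cImM cRe_nat cIm_nat mul0r addr0 mulr_ge0 // ltW.
have lim := lipschitz_sum (ltnW (ltnW k4)) hk ny (eC_mul_neq1 y0 m0).
pose b (n : nat) := eterm z m n%:Z + eterm z m (- (n.+1%:Z)).
have lim' : ccvg (fun M => \sum_(n < M) b n) (h (eC (m%:R * z))).
  by apply: ccvg_ext lim => N; apply: eq_bigr => n _; rewrite /b /eterm -pmulrn.
have pw (n : nat) : (M <= n)%N -> A / n%:R ^+ k <= A / M%:R ^+ 2 * (2 / (n%:R * n.+1%:R)).
  move=> Mn; have n0 : (0 < n)%N by exact: leq_trans Mn.
  have np : 0 < n%:R :> R by rewrite ltr0n.
  rewrite -mulrA ler_wpM2l //.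
  have -> : (n%:R ^+ k)^-1 = (n%:R ^+ (k - 2))^-1 * (n%:R ^+ 2)^-1 :> R.
    by rewrite -invfM -exprD subnK // (leq_trans _ k4).
  apply: ler_pM; rewrite ?invr_ge0 ?exprn_ge0 ?(ltW np) //; last exact: inv_pow_le.
  rewrite lef_pV2 ?posrE ?exprn_gt0 //.
  apply: (@le_trans _ _ (n%:R ^+ 2)); first by rewrite lerXn2r ?nnegrE ?ler_nat ?(ltW Mp) ?(ltW np).
  apply: ler_weXn2l; first by rewrite ler1n.
  by rewrite leq_subRL ?(leq_trans _ k4).
have tail : normc (\sum_(n < M) b n - h (eC (m%:R * z))) <= 4 * A / M%:R ^+ 2.
  rewrite normcB; have := ccvg_shift (ccvgB lim' (ccvg_cst (\sum_(n < M) b n))) (fun p => leq_addl M p).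
  move=> /ccvg_le; apply => d /=; rewrite big_split_ord /= addrAC subrr add0r.
  apply: le_trans (normc_sum _ _ _) _.
  have AM0 : 0 <= 4 * A / M%:R ^+ 2 by rewrite divr_ge0 ?exprn_ge0 ?mulr_ge0 // ltW.
  apply: (@le_trans _ _ (4 * A / M%:R ^+ 2 / M%:R)); last first.
    by rewrite ler_pdivrMr // ler_peMr.
  apply: le_trans (sum_telescope_le d AM0 M0); apply: ler_sum => i _.
  have Mi0 : (0 < M + i)%N by rewrite addn_gt0 M0.
  have le1 : normc (eterm z m (M + i)%:Z) <= A / (M + i)%:R ^+ k.
    by apply: HA => //; rewrite -pmulrn normr_nat.
  have le2 : normc (eterm z m (- ((M + i).+1%:Z))) <= A / (M + i)%:R ^+ k.
    by apply: HA => //; rewrite mulrNz normrN -pmulrn normr_nat ler_nat.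
  apply: le_trans (le_normcD _ _) _; apply: le_trans (lerD le1 le2) _.
  apply: le_trans (lerD (pw _ (leq_addr i M)) (pw _ (leq_addr i M))) _.
  by move: (M%:R ^- 2) (((M + i)%:R * (M + i).+1%:R)^-1) => u v; lra.
have last1 : normc (eterm z m M%:Z) <= A / M%:R ^+ 2.
  apply: le_trans (HA _ _ _ M0 _) _; first by rewrite -pmulrn normr_nat.
  rewrite ler_wpM2l // lef_pV2 ?posrE ?exprn_gt0 //; apply: ler_weXn2l => //.
  exact: leq_trans k4.
rewrite sum_zrange_shift addrAC; apply: le_trans (le_normcD _ _) _.
apply: le_trans (lerD tail last1) _.
by move: (M%:R ^- 2) => v; rewrite -!mulrA; lra.
Qed.

Lemma zeta_limit :
  ccvg (fun M => \sum_(n <- zrange M) (twopii * n%:~R) ^- k) (h (-1) / (2 ^+ k - 1)).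
Proof.
have k2 : (2 <= k)%N by exact: leq_trans k4.
have n2 : (2 : C) != 0 by rewrite pnatr_eq0.
have d0 : (2 ^+ k - 1 : C) != 0.
  by rewrite subr_eq0 -natrX pnatr_eq1 -(expn0 2) eqn_exp2l // -lt0n k0.
have I2 : Im (2^-1 : C) = 0.
  have := congr1 Im (natC_div R 1 2); rewrite mul1r => ->; exact: erefl.
have y0 : 0 <= Im (2^-1 : C) by rewrite I2.
have z1 : eC (2^-1 : C) != 1.
  by rewrite eC_half -subr_eq0 -opprD oppr_eq0 -mulr2n pnatr_eq0.
pose O (n : nat) : C := (twopii * n.*2.+1%:R) ^- k.
pose Z (n : nat) : C := (twopii * n.+1%:R) ^- k.
have lim := lipschitz_sum k2 hk y0 z1; rewrite eC_half in lim.
have limO : ccvg (fun M => 2 * 2 ^+ k * \sum_(n < M) O n) (h (-1)).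
  apply: ccvg_ext lim => M; rewrite mulr_sumr; apply: eq_bigr => n _.
  have E1 : (twopii * (2^-1 + n%:Z%:~R)) ^- k = 2 ^+ k * O n.
    have -> : twopii * (2^-1 + n%:Z%:~R) = twopii * n.*2.+1%:R / 2.
      by rewrite -pmulrn -[n.*2.+1%:R]natr1 -muln2 natrM; field.
    by rewrite /O expr_div_n invf_div.
  have E2 : (twopii * (2^-1 + (- (n.+1%:Z))%:~R)) ^- k = 2 ^+ k * O n.
    have -> : 2^-1 + (- (n.+1%:Z))%:~R = - (2^-1 + n%:Z%:~R) :> C.
      by rewrite mulrNz -!pmulrn -[n.+1%:R]natr1; field.
    by rewrite mulrN exprN_even.
  by apply: (etrans (congr2 +%R E1 E2)); ring.
have dbl M : \sum_(n < M.*2) Z n = \sum_(n < M) O n + 2 ^- k * \sum_(n < M) Z n.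
  elim: M => [|M IH]; first by rewrite !big_ord0 mulr0 addr0.
  rewrite doubleS !big_ord_recr /= IH mulrDr.
  have -> : Z M.*2.+1 = 2 ^- k * Z M.
    rewrite /Z -invfM -exprMn; congr (_ ^- k); rewrite -doubleS -muln2 natrM; ring.
  by rewrite /O /Z; ring.
have nt0 : 0 < normc twopii by rewrite normc_gt0 twopii_neq0.
pose A := (normc twopii ^+ k)^-1; have A0 : 0 <= A by rewrite invr_ge0 exprn_ge0 // ltW.
have limd : ccvg (fun M => \sum_(n < M.*2) Z n - \sum_(n < M) Z n) 0.
  have hn := rnullMl A (@rnull_harmonic R).
  move=> e /hn[N HN]; exists N.+1 => -[//|M]; rewrite ltnS => NM.
  have hN : A / M.+1%:R < e by apply: le_lt_trans (HN _ NM); exact: ler_norm.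
  apply: le_lt_trans hN; rewrite subr0 ger0_norm ?normc_ge0 //.
  rewrite -addnn big_split_ord /= addrAC subrr add0r.
  have Mp : 0 < M.+1%:R :> R by rewrite ltr0n.
  apply: le_trans (normc_sum _ _ _) _.
  apply: (@le_trans _ _ (\sum_(i < M.+1) A / M.+1%:R ^+ 2)).
    apply: ler_sum => i _; rewrite /Z normcV normcX normcM normc_nat exprMn invfM ler_wpM2l //.
    apply: (@le_trans _ _ ((M.+1%:R ^+ k)^-1)).
      rewrite lef_pV2 ?posrE ?exprn_gt0 ?ltr0n // lerXn2r ?nnegrE // ler_nat.
      by rewrite addSn ltnS; apply: leq_trans (leq_addr _ _) (leqnSn _).
    rewrite lef_pV2 ?posrE ?exprn_gt0 //; apply: ler_weXn2l => //; by rewrite ler1n.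
  rewrite sumr_const card_ord -mulrnAr ler_wpM2l // -mulr_natr expr2 invfM -mulrA mulVf ?mulr1 //.
  by rewrite gt_eqF.
have := ccvgMl (2 ^+ k - 1)^-1 (ccvgB limO (ccvgMl (2 * 2 ^+ k) limd)).
rewrite mulr0 subr0 [(2 ^+ k - 1)^-1 * h _]mulrC; apply: ccvg_ext => M.
rewrite sum_zrange mulr0 expr0n (gtn_eqF k0) invr0 add0r.
have -> : \sum_(i < M) (twopii * i.+1%:Z%:~R) ^- k = \sum_(n < M) Z n.
  by apply: eq_bigr => i _; rewrite -pmulrn.
have -> : \sum_(i < M) (twopii * (- (i.+1%:Z))%:~R) ^- k = \sum_(n < M) Z n.
  apply: eq_bigr => i _; by rewrite mulrNz mulrN exprN_even -pmulrn.
rewrite dbl; move: (\sum_(n < M) O n) (\sum_(n < M) Z n) => o s.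
have p0 : (2 ^+ k : C) != 0 by exact: expf_neq0.
by move: (2 ^+ k) p0 d0 => p p0 d0; field; rewrite p0 d0.
Qed.

Lemma eis_limit z X : 0 < Im z -> ccvg (fun M => \sum_(m < M) h (eC (m.+1%:R * z))) X ->
  ccvg (esquare z) (h (-1) / (2 ^+ k - 1) + 2 * X).
Proof.
move=> y0 limX; have [A A0 HA] := erow_bound y0.
apply: ccvg_diff (ccvgD zeta_limit (ccvgMl 2 limX)) _.
have hn := rnullMl (2 * A) (@rnull_harmonic R).
move=> e /hn[N HN]; exists N.+1 => -[//|M]; rewrite ltnS => NM.
have hN : 2 * A / M.+1%:R < e by apply: le_lt_trans (HN _ NM); exact: ler_norm.
apply: le_lt_trans hN; rewrite ger0_norm ?normc_ge0 //.
rewrite /esquare sum_zrange.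
have -> : \sum_(n <- zrange M.+1) eterm z 0 n = \sum_(n <- zrange M.+1) (twopii * n%:~R) ^- k.
  by apply: eq_bigr => n _; rewrite /eterm mul0r add0r.
have -> : \sum_(i < M.+1) \sum_(n <- zrange M.+1) eterm z (- (i.+1%:Z)) n =
    \sum_(i < M.+1) \sum_(n <- zrange M.+1) eterm z i.+1%:Z n.
  apply: eq_bigr => i _; rewrite -(sum_zrangeN (eterm z _)).
  by apply: eq_bigr => n _; rewrite eterm_opp.
set r0 := \sum_(n <- _) _; set S := \sum_(i < _) _; set H := \sum_(i < _) _.
have -> : r0 + (S + S) - (r0 + 2 * H) = 2 * (S - H) by ring.
rewrite normcM normc_nat -mulrA ler_wpM2l // /S /H -sumrB.
apply: le_trans (normc_sum _ _ _) _.
apply: (@le_trans _ _ (\sum_(i < M.+1) A / M.+1%:R ^+ 2)).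
  by apply: ler_sum => i _; exact: HA.
have Mp : 0 < M.+1%:R :> R by rewrite ltr0n.
rewrite sumr_const card_ord -mulrnAr ler_wpM2l // -mulr_natr expr2 invfM -mulrA mulVf ?mulr1 //.
by rewrite gt_eqF.
Qed.

End Eisenstein.
End Lattice.

Lemma psmap_pD (K L : comNzRingType) (phi : {rmorphism K -> L}) f :
  psmap phi (pD f) = pD (psmap phi f).
Proof. by apply: pserP => n /=; rewrite rmorphM rmorph_nat. Qed.

Section ModularInvariant.
Variable R : realType.
Local Notation C := R[i].
Implicit Types (z w u : C).
Local Notation Im := (@complex.Im R).

Local Notation toC := (psmap (ratr : {rmorphism rat -> C})).
Definition cE4 : pser C := toC (pE4 rat).
Definition cE6 : pser C := toC (pE6 rat).
Definition cDelta : pser C := toC (pDelta rat).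
Definition cDeltaV : pser C := toC (pDeltaV rat).
Definition cJ : pser C := toC (pJ rat).

Lemma cE4E : cE4 = 1 + 240%:R * cS R 3.
Proof. by rewrite /cE4 /pE4 rmorphD rmorph1 rmorphM rmorph_nat. Qed.
Lemma cE6E : cE6 = 1 - 504%:R * cS R 5.
Proof. by rewrite /cE6 /pE6 rmorphB rmorph1 rmorphM rmorph_nat. Qed.

Lemma CV_cE4 : CV cE4.
Proof. by rewrite cE4E; exact: (CV_add (CV_1 R) (CV_mul (CV_nat R _) (CV_cS R 3))). Qed.
Lemma CV_cE6 : CV cE6.
Proof. by rewrite cE6E; exact: (CV_sub (CV_1 R) (CV_mul (CV_nat R _) (CV_cS R 5))). Qed.

Lemma CV_cDeltaV : CV cDeltaV.
Proof.
apply: (@CV_logder _ (24%:R * cS R 1)).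
- exact: (CV_mul (CV_nat R 24) (CV_cS R 1)).
- by rewrite cf_natM cf_cS mulr0.
- by rewrite -psmap_pD pD_pDeltaV rmorphM rmorphM rmorph_nat.
Qed.

Lemma CV_cDelta : CV cDelta.
Proof.
apply: (@CV_logder _ (- (24%:R * cS R 1))).
- exact: (CV_opp (CV_mul (CV_nat R 24) (CV_cS R 1))).
- by rewrite cfN cf_natM cf_cS mulr0 oppr0.
- by rewrite -psmap_pD pD_pDelta rmorphM rmorphM rmorphN rmorph_nat mulNr.
Qed.

Lemma cJE : cJ = cE4 ^+ 3 * cDeltaV.
Proof. by rewrite /cJ /pJ rmorphM rmorphXn. Qed.

Lemma CV_cJ : CV cJ.
Proof. by rewrite cJE; exact: (CV_mul (CV_exp 3 CV_cE4) CV_cDeltaV). Qed.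

Lemma cf_cJ0 : cf cJ 0 = 1.
Proof. by have := congr1 (ratr : {rmorphism rat -> C}) (cf_pJ0 rat); rewrite rmorph1. Qed.

Definition J z : C := ev cJ (eC z) / eC z.

Lemma J_T z : J (z + 1) = J z.
Proof. by rewrite /J eCD eC1 mulr1. Qed.

Lemma cDelta_eq : cE4 ^+ 3 - cE6 ^+ 2 = 1728%:R * (pX * cDelta).
Proof.
have E : toC (1728%:R * (pX * pDelta rat)) = toC (pE4 rat ^+ 3 - pE6 rat ^+ 2).
  by rewrite pDelta_eq.
transitivity (toC (pE4 rat ^+ 3 - pE6 rat ^+ 2)); first by rewrite rmorphB !rmorphXn.
rewrite -E rmorphM rmorph_nat rmorphM.
by congr (_ * (_ * _)); exact: psmapX.
Qed.

Lemma JE z : 0 < Im z ->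
  J z = 1728%:R * ev cE4 (eC z) ^+ 3 / (ev cE4 (eC z) ^+ 3 - ev cE6 (eC z) ^+ 2).
Proof.
move=> y0; have q1 := eC_lt1 y0; have q0 := eC_neq0 z.
have c4 := CV_cE4; have c6 := CV_cE6; have cd := CV_cDelta; have cv := CV_cDeltaV.
have cx := CV_X R.
have E1 : ev cDelta (eC z) * ev cDeltaV (eC z) = 1.
  by rewrite -(evM cd cv q1) -rmorphM pDeltaK rmorph1 ev1.
have E2 : ev cE4 (eC z) ^+ 3 - ev cE6 (eC z) ^+ 2 = 1728%:R * (eC z * ev cDelta (eC z)).
  have := congr1 (fun f => ev f (eC z)) cDelta_eq.
  rewrite (evM (CV_nat R _) (CV_mul cx cd) q1) (ev_nat _ q1) (evM cx cd q1) (evX q1) => <-.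
  by rewrite (evB (CV_exp 3 c4) (CV_exp 2 c6) q1) (ev_exp 3 c4 q1) (ev_exp 2 c6 q1).
have d0 : ev cDelta (eC z) != 0.
  by apply/eqP => E; move/eqP: E1; rewrite E mul0r eq_sym oner_eq0.
rewrite E2 /J cJE (evM (CV_exp 3 c4) cv q1) (ev_exp 3 c4 q1).
have -> : ev cDeltaV (eC z) = (ev cDelta (eC z))^-1 by apply: (mulfI d0); rewrite E1 divff.
have n0 : (1728%:R : C) != 0 by rewrite pnatr_eq0.
by move: (1728%:R) n0 (eC z) q0 (ev cDelta _) d0 => n n0 q q0 d d0; field; rewrite n0 q0 d0.
Qed.

Lemma Im_invN z : Im (- z^-1) = Im z / normc z ^+ 2.
Proof.
by rewrite normc_sqr; case: z => a b /=; rewrite opprK.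
Qed.

Lemma eis4 z : 0 < Im z -> ccvg (esquare 4 z) (ev cE4 (eC z) / 720%:R).
Proof.
move=> y0; have q1 := eC_lt1 y0.
have lim : ccvg (fun M => \sum_(m < M) h4 (eC (m.+1%:R * z))) (ev (cS R 3) (eC z) / 6).
  rewrite mulrC; apply: ccvg_ext (ccvgMl 6^-1 (ccvg_lambert 2 q1)) => M.
  rewrite mulr_sumr; apply: eq_bigr => m _.
  rewrite eC_natM h4_ev ?normcX ?exprn_ilt1 ?normc_ge0 // mulrC //.
have := eis_limit (leqnn 4) isT (h4_kernel R) y0 lim.
have -> // : h4 (-1) / (2 ^+ 4 - 1) + 2 * (ev (cS R 3) (eC z) / 6) = ev cE4 (eC z) / 720%:R.
rewrite cE4E (evD (CV_1 R) (CV_mul (CV_nat R _) (CV_cS R 3)) q1) (ev1 q1).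
rewrite (evM (CV_nat R _) (CV_cS R 3) q1) (ev_nat _ q1) /h4 /koebe.
by move: (ev _ _) => x; field.
Qed.

Lemma eis6 z c : c = (60 * 504)^-1 -> 0 < Im z -> ccvg (esquare 6 z) (- ev cE6 (eC z) * c).
Proof.
move=> -> y0; have q1 := eC_lt1 y0.
have lim : ccvg (fun M => \sum_(m < M) h6 (eC (m.+1%:R * z))) (ev (cS R 5) (eC z) / 120).
  rewrite mulrC; apply: ccvg_ext (ccvgMl 120^-1 (ccvg_lambert 4 q1)) => M.
  rewrite mulr_sumr; apply: eq_bigr => m _.
  rewrite eC_natM h6_ev ?normcX ?exprn_ilt1 ?normc_ge0 // mulrC //.
have := eis_limit (_ : 4 <= 6)%N isT (h6_kernel R) y0 lim; move=> /(_ isT).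
have -> // : h6 (-1) / (2 ^+ 6 - 1) + 2 * (ev (cS R 5) (eC z) / 120) = - ev cE6 (eC z) / (60 * 504).
rewrite cE6E (evB (CV_1 R) (CV_mul (CV_nat R _) (CV_cS R 5)) q1) (ev1 q1).
rewrite (evM (CV_nat R _) (CV_cS R 5) q1) (ev_nat _ q1) /h6 /koebe.
by move: (ev _ _) => x; field.
Qed.

Lemma half_plane_neq0 z : 0 < Im z -> z != 0.
Proof. by move=> y0; apply: contraTneq y0 => ->; rewrite ltxx. Qed.

Lemma half_plane_inv z : 0 < Im z -> 0 < Im (- z^-1).
Proof.
by move=> y0; rewrite Im_invN divr_gt0 // exprn_gt0 // normc_gt0 half_plane_neq0.
Qed.

Lemma E4_S z : 0 < Im z -> ev cE4 (eC (- z^-1)) = z ^+ 4 * ev cE4 (eC z).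
Proof.
move=> y0; have z0 := half_plane_neq0 y0.
have H := ccvg_uniq (eis4 (half_plane_inv y0)) (ccvg_ext (fun M => esym (@esquare_inv R 4 z M z0)) (ccvgMl (z ^+ 4) (eis4 y0))).
have n0 : (720%:R : C) != 0 by rewrite pnatr_eq0.
by rewrite mulrA in H; exact: (mulIf (invr_neq0 n0)) H.
Qed.

Lemma E6_S z : 0 < Im z -> ev cE6 (eC (- z^-1)) = z ^+ 6 * ev cE6 (eC z).
Proof.
move=> y0; have z0 := half_plane_neq0 y0.
have [c cE c0] : exists2 c : C, c = (60 * 504)^-1 & c != 0.
  have nz n : (n.+1%:R : C) != 0 by rewrite pnatr_eq0.
  exists (60 * 504)^-1; first exact: erefl.
  apply: invr_neq0; apply: mulf_neq0; first exact: (nz 59).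
  exact: (nz 503).
have h1 := eis6 cE y0; have h2 := eis6 cE (half_plane_inv y0).
have h3 : ccvg (esquare 6 (- z^-1)) (z ^+ 6 * (- ev cE6 (eC z) * c)).
  by apply: ccvg_ext (ccvgMl (z ^+ 6) h1) => M; rewrite esquare_inv.
have := ccvg_uniq h2 h3; rewrite mulrA mulrN.
move=> /(mulIf c0).
exact: oppr_inj.
Qed.

Lemma J_S z : 0 < Im z -> J (- z^-1) = J z.
Proof.
move=> y0; have z0 := half_plane_neq0 y0.
have z12 : z ^+ 12 != 0 by rewrite expf_neq0.
have E n a b : n * (z ^+ 4 * a) ^+ 3 / ((z ^+ 4 * a) ^+ 3 - (z ^+ 6 * b) ^+ 2) =
    n * a ^+ 3 / (a ^+ 3 - b ^+ 2).
  have -> : (z ^+ 4 * a) ^+ 3 - (z ^+ 6 * b) ^+ 2 = z ^+ 12 * (a ^+ 3 - b ^+ 2) by ring.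
  have -> : n * (z ^+ 4 * a) ^+ 3 = z ^+ 12 * (n * a ^+ 3) by ring.
  by rewrite -mulf_div divff // mul1r.
rewrite (JE (half_plane_inv y0)) (JE y0) (E4_S y0) (E6_S y0); exact: E.
Qed.

End ModularInvariant.

(** * Modular functions are polynomials in j *)

Section LevelOne.
Variable R : realType.
Local Notation C := R[i].
Implicit Types (z w u : C) (h : C -> C) (f g : pser C).
Local Notation Re := (@complex.Re R).
Local Notation Im := (@complex.Im R).
Local Notation pi := (@pi R).

Definition T_inv h := forall z, 0 < Im z -> h (z + 1) = h z.
Definition S_inv h := forall z, 0 < Im z -> h (- z^-1) = h z.

Lemma Im_add_nat z (n : nat) : Im (z + n%:R) = Im z.
Proof. by rewrite cImD cIm_nat addr0. Qed.

Lemma T_inv_int h z (n : int) : T_inv h -> 0 < Im z -> h (z + n%:~R) = h z.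
Proof.
move=> hT; have hn (m : nat) u : 0 < Im u -> h (u + m%:R) = h u.
  move=> u0; elim: m => [|m IH]; first by rewrite addr0.
  by rewrite -natr1 addrA hT ?Im_add_nat.
case: n => n y0; first by rewrite -pmulrn hn.
rewrite NegzE mulrNz -pmulrn -(hn n.+1 (z - n.+1%:R)) ?subrK //.
by rewrite cImD cImN cIm_nat subr0.
Qed.

Lemma reduce_half h z : T_inv h -> S_inv h -> 0 < Im z ->
  exists z', 2^-1 <= Im z' /\ h z' = h z.
Proof.
move=> hT hS y0.
have [n Hn] : exists n, 2^-1 <= 2 ^+ n * Im z.
  have h2 : 0 <= (2^-1 : R) < 1 by lra.
  have y2 : 0 < 2 * Im z by rewrite mulr_gt0.
  have [N HN] := rnull_exp h2 y2.
  exists N; have h1 : 2^-1 ^+ N < 2 * Im z := le_lt_trans (ler_norm _) (HN N (leqnn _)).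
  rewrite exprVn in h1.
  have p0 : 0 < 2 ^+ N :> R by rewrite exprn_gt0.
  move: h1; rewrite -(ltr_pM2l p0) divff ?gt_eqF // => h1; lra.
elim: n z y0 Hn => [|n IH] z y0 Hn; first by exists z; rewrite expr0 mul1r in Hn.
case: (lerP (2^-1) (Im z)) => yh; first by exists z.
pose m := Num.floor (Re z + 2^-1); pose u := z + (- m)%:~R.
have Iu : Im u = Im z by rewrite /u cImD (intC R _).2 addr0.
have u0 : 0 < Im u by rewrite Iu.
have Ru : `|Re u| <= 2^-1.
  have := floor_itv (Re z + 2^-1); rewrite -/m intrD => /andP[h1 h2].
  rewrite /u cReD (intC R _).1 mulrNz ler_norml; apply/andP; split; lra.
have nu : normc u ^+ 2 <= 2^-1.
  rewrite normc_sqr Iu; have : Re u ^+ 2 <= 2^-1 ^+ 2.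
    by rewrite -[leLHS]real_normK ?num_real // lerXn2r ?nnegrE ?normr_ge0 // invr_ge0.
  have : Im z ^+ 2 <= 2^-1 ^+ 2 by rewrite lerXn2r ?nnegrE ?(ltW y0) ?(ltW yh) // invr_ge0.
  by rewrite !expr2; lra.
have nu0 : 0 < normc u ^+ 2 by rewrite exprn_gt0 // normc_gt0 half_plane_neq0.
have [] := IH (- u^-1) (half_plane_inv u0).
  rewrite Im_invN Iu mulrA ler_pdivlMr //; rewrite exprS in Hn.
  have p0 : 0 <= 2 ^+ n * Im z by rewrite mulr_ge0 ?exprn_ge0 // ltW.
  by move: Hn; rewrite -mulrA; move: (2 ^+ n * Im z) p0 (normc u ^+ 2) nu => a a0 b b1; nra.
move=> z' [yz' E]; exists z'; split => //; rewrite E hS // /u T_inv_int //.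
Qed.

Lemma liouville f : CV f -> cf f 0 = 0 -> S_inv (fun z => ev f (eC z)) -> f = 0.
Proof.
move=> hf f0 hS; pose h z := ev f (eC z).
have hT : T_inv h by move=> z _; rewrite /h eCD eC1 mulr1.
have p2 := pi_ge2 R.
have r4 z : 2^-1 <= Im z -> normc (eC z) <= 4^-1.
  move=> yz; rewrite normc_eC expRN lef_pV2 ?posrE ?expR_gt0 //.
  apply: (@le_trans _ _ (expR (1 + 1))); last by rewrite ler_expR; nra.
  by rewrite expRD; have := expR_ge1Dx (1 : R); nra.
have [B0 B00 HB0] : exists2 B, 0 <= B & forall z, 0 < Im z -> normc (h z) <= B.
  have h4 : 0 <= (4^-1 : R) < 1 by lra.
  have [B B0 HB] := ev_bound hf h4.
  exists B => // z z0; have [z' [yz' <-]] := reduce_half hT hS z0.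
  exact/HB/r4.
have half B : (forall z, 0 < Im z -> normc (h z) <= B) -> forall z, 0 < Im z -> normc (h z) <= B / 2.
  move=> HB z z0; have [z' [yz' <-]] := reduce_half hT hS z0.
  have h34 : 0 < 3 / 4 :> R by lra.
  have [s Es] := expR_total h34.
  have s0 : s < 0 by rewrite -expR_lt1 Es; lra.
  pose y := - s / (2 * pi); have pp : 0 < 2 * pi by lra.
  have y0 : 0 < y by rewrite divr_gt0 // oppr_gt0.
  have ye : - (2 * pi * y) = s by rewrite /y mulrCA divff ?gt_eqF // mulr1 opprK.
  have an n : normc (cf f n) * (3 / 4) ^+ n <= B.
    by rewrite -Es -ye; apply: cauchy_coef => // x; apply: HB.
  have dom n : normc (cf f n * eC z' ^+ n) <= B * 3^-1 ^+ n.
    rewrite normcM normcX; have -> : (3^-1 : R) = (3 / 4)^-1 * 4^-1 by field.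
    rewrite exprMn exprVn mulrA; apply: ler_pM; rewrite ?normc_ge0 ?exprn_ge0 ?normc_ge0 //.
      by rewrite ler_pdivlMr ?exprn_gt0 //; lra.
    apply: lerXn2r; rewrite ?nnegrE ?normc_ge0 ?r4 //; lra.
  have h3 : 0 <= (3^-1 : R) < 1 by lra.
  have := csum_tail 1 h3 dom; rewrite big_ord_recl big_ord0 f0 mul0r addr0 subr0 expr1.
  by have -> : B * 3^-1 / (1 - 3^-1) = B / 2 by field.
have iter k z : 0 < Im z -> normc (h z) <= B0 * 2^-1 ^+ k.
  elim: k z => [|k IH] z z0; first by rewrite expr0 mulr1; exact: HB0.
  by rewrite exprSr mulrA; exact: half.
apply: (@ev_eq0 _ f 1) => // x; apply/eqP; rewrite -normc_eq0; apply/eqP/le_anti.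
rewrite normc_ge0 andbT; apply/ler_addgt0Pl => e e0; rewrite addr0.
have h2 : 0 <= (2^-1 : R) < 1 by lra.
have [N HN] := rnullMl B0 (rnull_exp h2) e0.
apply: le_trans (iter N _ _) _; first exact: ltr01.
by apply: le_trans (ltW (HN N (leqnn _))); exact: ler_norm.
Qed.

Section LevelN.
Variable N : nat.
Hypothesis N0 : (0 < N)%N.

Definition wN z : C := eC (z / N%:R).

Lemma Im_divN z : Im (z / N%:R) = Im z / N%:R.
Proof.
have : Im (z / N%:R * N%:R) = Im z by rewrite divfK // pnatr_eq0 -lt0n.
rewrite cImM cRe_nat cIm_nat mulr0 add0r => <-.
by rewrite mulfK // pnatr_eq0 -lt0n.
Qed.

Lemma wN_lt1 z : 0 < Im z -> normc (wN z) < 1.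
Proof. by move=> y0; apply: eC_lt1; rewrite Im_divN divr_gt0 // ltr0n. Qed.

Lemma wN_neq0 z : wN z != 0. Proof. exact: eC_neq0. Qed.

Lemma wN_pow z : wN z ^+ N = eC z.
Proof. by rewrite /wN -eC_natM mulrC divfK // pnatr_eq0 -lt0n. Qed.

Definition puiseux h := exists m A, CV A /\ forall z, 0 < Im z -> h z = ev A (wN z) / wN z ^+ m.

Lemma puiseux_const c : puiseux (fun _ => c).
Proof.
exists 0%N, (pconst c); split; first exact: CV_const.
by move=> z z0; rewrite expr0 divr1 ev_const // wN_lt1.
Qed.

Lemma puiseux_pad m A j z : CV A -> 0 < Im z ->
  ev A (wN z) / wN z ^+ m = ev (pX ^+ j * A) (wN z) / wN z ^+ (j + m).
Proof.
move=> cA z0; have w1 := wN_lt1 z0.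
rewrite (evM (CV_exp j (CV_X R)) cA w1) (ev_exp _ (CV_X R) w1) (evX w1) exprD.
by rewrite -mulf_div divff ?mul1r // expf_neq0 // wN_neq0.
Qed.

Lemma puiseux_sub h1 h2 : puiseux h1 -> puiseux h2 -> puiseux (fun z => h1 z - h2 z).
Proof.
move=> [m [A [cA EA]]] [n [B [cB EB]]]; exists (n + m)%N, (pX ^+ n * A - pX ^+ m * B).
have c1 := CV_mul (CV_exp n (CV_X R)) cA; have c2 := CV_mul (CV_exp m (CV_X R)) cB.
split; first exact: (CV_sub c1 c2).
move=> z z0; rewrite (evB c1 c2 (wN_lt1 z0)) mulrBl EA // EB //.
by rewrite (puiseux_pad m n cA z0) (puiseux_pad n m cB z0) [(m + n)%N]addnC.
Qed.

Lemma puiseux_mul h1 h2 : puiseux h1 -> puiseux h2 -> puiseux (fun z => h1 z * h2 z).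
Proof.
move=> [m [A [cA EA]]] [n [B [cB EB]]]; exists (m + n)%N, (A * B).
split; first exact: (CV_mul cA cB).
by move=> z z0; rewrite (evM cA cB (wN_lt1 z0)) EA // EB // exprD mulf_div.
Qed.

Lemma puiseux_ext h1 h2 : (forall z, 0 < Im z -> h1 z = h2 z) -> puiseux h1 -> puiseux h2.
Proof. by move=> E [m [A [cA EA]]]; exists m, A; split => // z z0; rewrite -E // EA. Qed.

Lemma bernoulli (r : R) n : 0 <= r <= 1 -> 1 - n%:R * r <= (1 - r) ^+ n.
Proof.
move=> /andP[r0 r1]; elim: n => [|n IH]; first by rewrite mul0r subr0 expr0.
rewrite exprS -natr1; have h0 : 0 <= 1 - r by lra.
apply: (@le_trans _ _ ((1 - r) * (1 - n%:R * r))); last by rewrite ler_wpM2l.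
have : 0 <= n%:R * r * r by rewrite !mulr_ge0.
by move: (n%:R : R) => a; nra.
Qed.

(* Invariance under [z + 1] kills the coefficients of the fractional powers of q. *)
Lemma puiseux_T_inv h : puiseux h -> T_inv h ->
  exists m B, CV B /\ forall z, 0 < Im z -> h z = ev B (eC z) / eC z ^+ m.
Proof.
move=> [m0 [A0 [cA0 EA0]]] hT.
pose A := pX ^+ ((N.-1) * m0) * A0; pose m := (N.-1 * m0 + m0)%N.
have cA : CV A := CV_mul (CV_exp _ (CV_X R)) cA0.
have mE : m = (N * m0)%N by rewrite /m -{2}(prednK N0) mulSn addnC.
have EA z : 0 < Im z -> h z = ev A (wN z) / wN z ^+ m.
  by move=> z0; rewrite EA0 // (puiseux_pad m0 (N.-1 * m0) cA0 z0).
pose zeta : C := eC (1%:R / N%:R).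
have nz : normc zeta = 1 by rewrite normc_eC natC_div mulr0 oppr0 expR0.
have zm : zeta ^+ m = 1.
  by rewrite mE exprM -eC_natM mul1r divff ?eC1 ?expr1n // pnatr_eq0 -lt0n.
have sub0 : psub 1 zeta A - A = 0.
  have cs := CV_psub (ltn0Sn 0) nz cA.
  apply: (@ev_eq0 _ _ 1); first exact: (CV_sub cs cA).
    exact: ltr01.
  move=> x; pose z : C := Complex (x * N%:R) N%:R.
  have z0 : 0 < Im z by rewrite ltr0n.
  have Np : (N%:R : R) != 0 by rewrite pnatr_eq0 -lt0n.
  have Ez : Complex x 1 = z / N%:R.
    have NC : (N%:R : C) != 0 by rewrite pnatr_eq0 -lt0n.
    apply: (mulIf NC); rewrite divfK //; apply: complex_eq.
      by rewrite cReM cRe_nat cIm_nat /= mulr0 subr0.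
    by rewrite cImM cRe_nat cIm_nat /= mulr0 add0r mul1r.
  rewrite Ez -/(wN z); have w1 := wN_lt1 z0.
  rewrite (evB cs cA w1) (ev_psub (ltn0Sn 0) nz cA w1) expr1.
  have Ew : zeta * wN z = wN (z + 1) by rewrite /zeta /wN -eCD -mulrDl addrC.
  have z1 : 0 < Im (z + 1) by rewrite cImD /= addr0.
  have wm : wN z ^+ m != 0 by rewrite expf_neq0 // wN_neq0.
  have := hT z z0; rewrite (EA _ z1) (EA _ z0) -Ew [(zeta * _) ^+ m]exprMn zm mul1r => E.
  by rewrite (mulIf (invr_neq0 wm) E) subrr.
have an n : ~~ (N %| n)%N -> cf A n = 0.
  move=> nN; have := congr1 (fun f => cf f n) sub0; rewrite cf0 cfB [cf (psub _ _ _) n]/= dvd1n divn1.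
  move=> /eqP; rewrite -[X in _ - X]mulr1 -mulrBr mulf_eq0 => /orP[/eqP //|].
  rewrite subr_eq0 => /eqP zn; exfalso; move/negP: nN; apply.
  have : eC ((n %% N)%:R / N%:R) = eC (0%:R / N%:R) :> C.
    have zN : zeta ^+ N = 1.
      by rewrite -[zeta ^+ N]eC_natM mul1r divff ?eC1 // pnatr_eq0 -lt0n.
    have zr : zeta ^+ (n %% N) = 1.
      by rewrite -zn [in RHS](divn_eq n N) exprD mulnC exprM zN expr1n mul1r.
    by rewrite mul0r eC0 -[RHS]zr /zeta -eC_natM mul1r.
  by move=> /eC_inj_frac; rewrite ltn_mod N0 => /(_ isT isT) /eqP.
pose B := PSer (fun n => cf A (N * n)%N).
have AB : A = psub N 1 B.
  apply: pserP => n /=; rewrite expr1n mulr1; case: ifP => [Nn|/negbT/an //].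
  by rewrite [(N * (n %/ N))%N]mulnC divnK.
have cB : CV B.
  move=> r /andP[r0 r1].
  pose s := (1 - r) / N%:R; have Np : 0 < N%:R :> R by rewrite ltr0n.
  have s0 : 0 < s by rewrite divr_gt0 // subr_gt0.
  have N1 : 1 <= N%:R :> R by rewrite ler1n.
  have s1 : s <= 1 by rewrite ler_pdivrMr // mul1r; lra.
  have [|D HD] := cA (1 - s); first by apply/andP; split; lra.
  exists D => n; apply: le_trans (HD (N * n)%N).
  rewrite exprM ler_wpM2l ?normc_ge0 // lerXn2r ?nnegrE ?exprn_ge0 ?subr_ge0 //.
  apply: le_trans (bernoulli N _); last by rewrite ltW.
  by rewrite /s mulrC divfK ?gt_eqF //; lra.
exists m0, B; split; first exact: cB.
move=> z z0; rewrite (EA z z0) AB mE (ev_psub N0 (normc1 R) cB (wN_lt1 z0)).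
by rewrite mul1r (exprM (wN z)) wN_pow.
Qed.

Lemma invariant_polynomial h : puiseux h -> T_inv h -> S_inv h ->
  exists p : {poly C}, forall z, 0 < Im z -> h z = p.[J z].
Proof.
move=> hp hT; have [m [B [cB EB]]] := puiseux_T_inv hp hT.
elim: m h B cB EB {hp hT} => [|m IH] h B cB EB hS.
  exists (cf B 0)%:P => z z0; rewrite hornerC.
  have cc := CV_const (cf B 0).
  have Eh u : 0 < Im u -> ev (B - pconst (cf B 0)) (eC u) = h u - cf B 0.
    move=> u0; have q1 := eC_lt1 u0.
    by rewrite (evB cB cc q1) (ev_const _ q1) (EB u u0) expr0 divr1.
  have E0 : B - pconst (cf B 0) = 0.
    apply: liouville; first exact: (CV_sub cB cc).
      by rewrite cfB subrr.
    by move=> u u0; rewrite (Eh _ (half_plane_inv u0)) (Eh u u0) (hS u u0).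
  by apply/eqP; rewrite -subr_eq0 -(Eh z z0) E0 (ev0 (eC_lt1 z0)).
pose b := cf B 0; pose D := B - pconst b * cJ R ^+ m.+1.
have cc := CV_const b; have cJm := CV_exp m.+1 (@CV_cJ R).
have cD : CV D := CV_sub cB (CV_mul cc cJm).
have D0 : cf D 0 = 0.
  rewrite /D cfB cfMc; suff -> : cf (cJ R ^+ m.+1) 0 = 1 by rewrite mulr1 subrr.
  elim: (m.+1) => [|k Ek]; first by rewrite expr0 cf1.
  by rewrite exprS cfM0 Ek cf_cJ0 mulr1.
have [] := IH (fun z => h z - b * J z ^+ m.+1) (pshift D) (CV_shift cD).
- move=> z z0; have q1 := eC_lt1 z0; have q0 := eC_neq0 z.
  have ED : ev D (eC z) = eC z * ev (pshift D) (eC z).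
    by rewrite (ev_split0 cD q1) D0 add0r.
  have : ev D (eC z) = ev B (eC z) - b * ev (cJ R) (eC z) ^+ m.+1.
    by rewrite (evB cB (CV_mul cc cJm) q1) (evM cc cJm q1) (ev_const _ q1) (ev_exp _ (@CV_cJ R) q1).
  rewrite ED (EB z z0) /J expr_div_n mulrA -mulrBl => <-.
  by rewrite exprS invfM mulrACA divff // mul1r.
- by move=> z z0; rewrite J_S // hS.
move=> p Hp; exists (p + b *: 'X^(m.+1)) => z z0.
by rewrite hornerD hornerZ hornerXn -Hp // subrK.
Qed.

End LevelN.

End LevelOne.

(** * Primitive matrices of determinant N *)

(* The pair (d, b) encodes the primitive matrix (N/d, b; 0, d) of determinant N. *)
Definition Sph (N : nat) : seq (nat * nat) :=
  [seq (d, b) | d <- divisors N, b <- [seq b <- iota 0 d | coprime b (gcdn (N %/ d) d)]].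

Lemma mem_Sph N d b : (0 < N)%N ->
  ((d, b) \in Sph N) = [&& d %| N, b < d & coprime b (gcdn (N %/ d) d)]%N.
Proof.
move=> N0; apply/idP/idP.
  case/allpairsPdep => [d' [b' [hd hb [-> ->]]]]; move: hd hb.
  by rewrite mem_filter mem_iota add0n -dvdn_divisors // => -> /andP[-> /= ->].
case/and3P=> hd hb hc; apply/allpairsPdep; exists d, b; split => //.
  by rewrite -dvdn_divisors.
by rewrite mem_filter mem_iota add0n hb hc.
Qed.

Lemma uniq_Sph N : uniq (Sph N).
Proof.
apply: allpairs_uniq_dep; first exact: divisors_uniq.
  by move=> d _; apply/filter_uniq/iota_uniq.
by move=> [? ?] [? ?] _ _ [-> ->].
Qed.

Lemma SphP N al : (0 < N)%N -> al \in Sph N ->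
  [/\ (0 < al.1)%N, (N %/ al.1 * al.1)%N = N, (al.2 < al.1)%N
    & coprime al.2 (gcdn (N %/ al.1) al.1)].
Proof.
case: al => d b N0; rewrite mem_Sph // => /and3P[dN bd cb] /=; split => //.
  exact: leq_ltn_trans bd.
exact: divnK.
Qed.

Lemma coprime_shift a b d : (0 < a)%N -> (0 < d)%N -> coprime b (gcdn a d) ->
  exists k, coprime a (b + d * k)%N.
Proof.
move=> a0 d0 cb; pose b1 := (b + d)%N; pose k := (a`_\pi(b1)^')%N.
have b10 : (0 < b1)%N by rewrite addn_gt0 d0 orbT.
exists k.+1; rewrite mulnS addnA -/b1 /coprime; apply/negPn/negP => g1.
have pr := pdiv_prime (_ : 1 < gcdn a (b1 + d * k))%N.
have {}pr : prime (pdiv (gcdn a (b1 + d * k))).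
  by apply: pr; rewrite ltn_neqAle eq_sym g1 gcdn_gt0 a0.
set p := pdiv _ in pr; have := pdiv_dvd (gcdn a (b1 + d * k)); rewrite -/p dvdn_gcd.
case/andP=> pa ps; have [pb|pb] := boolP (p %| b1)%N.
  have : (p %| d * k)%N by rewrite -(dvdn_addr _ pb).
  rewrite Euclid_dvdM // => /orP[pd|pk].
    have pb' : (p %| b)%N by rewrite -(dvdn_addl _ pd).
    have : (p %| gcdn b (gcdn a d))%N by rewrite !dvdn_gcd pb' pa pd.
    by rewrite (eqP cb) dvdn1 => /eqP E; rewrite E in pr.
  have : p \in primes k by rewrite mem_primes pr pk part_gt0.
  by rewrite /k primes_part mem_filter inE /= mem_primes pr b10 pb.
have : (p %| d * k)%N.
  apply: dvdn_mull; have <- : (p`_\pi(b1)^')%N = p.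
    by rewrite part_pnat_id // pnatE // !inE /= mem_primes pr b10 (negPf pb).
  by rewrite /k partn_dvd.
by move=> h; move: ps; rewrite dvdn_addl // (negPf pb).
Qed.

Definition primitive (A B C D : int) :=
  forall g : nat, (g %| A)%Z -> (g %| B)%Z -> (g %| C)%Z -> (g %| D)%Z -> g = 1%N.

Section Cosets.
Variable R : realType.
Local Notation C := R[i].
Implicit Types (z w u : C).
Local Notation Re := (@complex.Re R).
Local Notation Im := (@complex.Im R).
Local Notation J := (@J R).

Definition act N (al : nat * nat) z : C := ((N %/ al.1)%:R * z + al.2%:R) / al.1%:R.

Lemma J_T_int z (n : int) : 0 < Im z -> J (z + n%:~R) = J z.
Proof. by apply: T_inv_int => u _; apply: J_T. Qed.

Lemma Im_moebius (A B E D : int) z : 0 < Im z -> 0 < A * D - B * E ->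
  E%:~R * z + D%:~R != 0 /\ 0 < Im ((A%:~R * z + B%:~R) / (E%:~R * z + D%:~R)).
Proof.
move=> z0 det0; have det0' : 0 < A%:~R * D%:~R - B%:~R * E%:~R :> R.
  by rewrite -!intrM -intrB ltr0z.
set x := A%:~R * z + _; set y := _ + D%:~R.
have Rx : Re x = A%:~R * Re z + B%:~R by rewrite /x cReD cReM !(intC R _).1 !(intC R _).2 mul0r subr0.
have Ix : Im x = A%:~R * Im z by rewrite /x cImD cImM !(intC R _).1 !(intC R _).2 mul0r !addr0.
have Ry : Re y = E%:~R * Re z + D%:~R by rewrite /y cReD cReM !(intC R _).1 !(intC R _).2 mul0r subr0.
have Iy : Im y = E%:~R * Im z by rewrite /y cImD cImM !(intC R _).1 !(intC R _).2 mul0r !addr0.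
have y0 : y != 0.
  apply/negP => /eqP E0; have := congr1 Im E0; have := congr1 Re E0.
  rewrite Ry Iy /= => h1 /eqP; rewrite mulf_eq0 (gt_eqF z0) orbF => /eqP h2.
  by move: h1 det0'; rewrite h2 mul0r add0r => ->; rewrite !mulr0 subrr ltxx.
split => //; set u := x / y; have Eu : u * y = x by rewrite divfK.
clearbody u.
have h1 := congr1 Re Eu; have h2 := congr1 Im Eu; rewrite cReM cImM Rx Ix Ry Iy in h1 h2.
have n0 : 0 < Re y ^+ 2 + Im y ^+ 2 by rewrite -normc_sqr exprn_gt0 // normc_gt0.
rewrite -(pmulr_lgt0 _ n0) Ry Iy.
have -> : Im u * ((E%:~R * Re z + D%:~R) ^+ 2 + (E%:~R * Im z) ^+ 2) =
   Im z * (A%:~R * D%:~R - B%:~R * E%:~R).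
  move: h1 h2; move: (Re u) (Im u) (Re z) (Im z) (A%:~R) (B%:~R) (E%:~R) (D%:~R) => a b c d e f g h h1 h2.
  transitivity ((g * c + h) * (e * d) - (g * d) * (e * c + f)); last by ring.
  rewrite -h1 -h2; ring.
by rewrite mulr_gt0.
Qed.

Lemma Im_act N al z : (0 < N)%N -> al \in Sph N -> 0 < Im z -> 0 < Im (act N al z).
Proof.
move=> N0 /(SphP N0) [d0 dN _ _] z0.
have := @Im_moebius (N %/ al.1)%N al.2 0 al.1 z z0.
rewrite mul0r add0r mulr0 subr0 -PoszM dN -!pmulrn => h.
by have [] := h; rewrite ?ltz_nat.
Qed.

Lemma hermite_upper N (A B : int) (d : nat) : (0 < N)%N -> A * d = N ->
  primitive A B 0 d ->
  exists2 al, al \in Sph N &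
    forall z, 0 < Im z -> J ((A%:~R * z + B%:~R) / d%:R) = J (act N al z).
Proof.
move=> N0 dN pr; have d0 : (0 < d)%N.
  by case: d dN {pr} => // h; move: N0; rewrite mulr0 in h; case: h => <-.
have A0 : 0 < A by rewrite -(pmulr_lgt0 _ (_ : 0 < d%:Z)) ?ltz_nat // dN ltz_nat.
case: A A0 dN pr => // a a0 dN pr; have {}dN : (a * d)%N = N by case: dN.
have b1 := modz_ge0 B (_ : d%:Z != 0); have {}b1 : 0 <= (B %% d)%Z by apply: b1; rewrite -lt0n in d0 *; lia.
have b2 : (B %% d)%Z < d by apply: ltz_pmod; rewrite ltz_nat.
have EB := divz_eq B d; move: b1 b2 EB; case: (B %% d)%Z => // b _ b2 EB.
have Ea : (N %/ d)%N = a by rewrite -dN mulnK.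
have al : (d, b) \in Sph N.
  rewrite mem_Sph // -{1}dN dvdn_mull //= -ltz_nat b2 Ea /=; apply/eqP/pr.
  - by rewrite dvdzE /= (dvdn_trans (dvdn_gcdr _ _)) ?dvdn_gcdl.
  - rewrite EB; apply: rpredD; first apply: dvdz_mull; rewrite dvdzE /=.
      by rewrite (dvdn_trans (dvdn_gcdr _ _)) ?dvdn_gcdr.
    by rewrite dvdn_gcdl.
  - exact: dvdz0.
  by rewrite dvdzE /= (dvdn_trans (dvdn_gcdr _ _)) ?dvdn_gcdr.
move: (B %/ d)%Z EB => k EB.
exists (d, b) => // z z0; rewrite -(J_T_int k (Im_act N0 al z0)) /act /= Ea.
have dC : (d%:R : C) != 0 by rewrite pnatr_eq0 -lt0n.
congr J; have -> : (k%:~R : C) = k%:~R * d%:R / d%:R by rewrite mulfK.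
rewrite -mulrDl EB intrD intrM -!pmulrn; congr (_ / _).
by rewrite -addrA [X in _ + X]addrC.
Qed.

Lemma hermite N (A B E D : int) : (0 < N)%N -> A * D - B * E = N -> primitive A B E D ->
  exists2 al, al \in Sph N & forall z, 0 < Im z ->
    J ((A%:~R * z + B%:~R) / (E%:~R * z + D%:~R)) = J (act N al z).
Proof.
move=> N0; have [n] := ubnP `|E|%N; elim: n A B E D => // n IH A B E D; rewrite ltnS => En dN pr.
have [E0|E0] := eqVneq E 0.
  rewrite E0 mulr0 subr0 in dN pr *.
  case: D dN pr => d dN pr.
    have [al al1 al2] := hermite_upper N0 dN pr; exists al => // z z0.
    by rewrite mul0r add0r -pmulrn al2.
  have dN' : (- A) * d.+1 = N by rewrite -dN NegzE mulrN mulNr.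
  have [g|al al1 al2] := @hermite_upper N (- A) (- B) d.+1 N0 dN'.
    rewrite !rpredN => h1 h2 h3 h4; apply: pr => //.
  exists al => // z z0; rewrite -al2 // mul0r add0r NegzE !mulrNz -pmulrn.
  by rewrite invrN mulrN mulNr -opprD mulNr.
pose k := (A %/ E)%Z; pose A' := (A %% E)%Z; pose B' := B - k * D.
have EA : A = k * E + A' := divz_eq A E.
have A'n : (`|A'| < n)%N.
  apply: leq_trans En; have := ltz_mod A E0; have := modz_ge0 A E0; rewrite -/A'; lia.
have dN' : (- E) * B' - (- D) * A' = N by rewrite -dN EA /B'; ring.
have [|al al1 al2] := IH (- E) (- D) A' B' A'n dN'.
  move=> g; rewrite !rpredN => h1 h2 h3 h4; apply: pr => //.
    by rewrite EA rpredD // dvdz_mull.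
  by rewrite -[B](subrK (k * D)) rpredD // dvdz_mull.
exists al => // z z0; rewrite -al2 //.
have det0 : 0 < A * D - B * E by rewrite dN ltz_nat.
have [y0 u0] := Im_moebius z0 det0.
rewrite -(J_T_int (- k) u0).
have -> : (A%:~R * z + B%:~R) / (E%:~R * z + D%:~R) + (- k)%:~R =
          (A'%:~R * z + B'%:~R) / (E%:~R * z + D%:~R).
  apply: (mulIf y0); rewrite mulrDl !divfK // EA /B' !(intrD, intrM, mulrNz); ring.
have det1 : 0 < A' * D - B' * E by move: N0; rewrite -ltz_nat -dN'; congr (0 < _); ring.
have [_ v0] := Im_moebius z0 det1.
by rewrite -(J_S v0) invf_div !mulrNz mulNr -opprD mulNr.
Qed.

Lemma J_SL2 (A B E D : int) z : A * D - B * E = 1 -> 0 < Im z ->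
  J ((A%:~R * z + B%:~R) / (E%:~R * z + D%:~R)) = J z.
Proof.
move=> det z0; have pr : primitive A B E D.
  move=> g gA gB gE gD; have : (g %| A * D - B * E)%Z by rewrite rpredB // dvdz_mulr.
  by rewrite det dvdzE dvdn1 => /eqP.
have [[d b]] := @hermite 1 A B E D (ltn0Sn 0) det pr; rewrite mem_Sph // => /and3P[].
rewrite dvdn1 => /eqP -> ; rewrite ltnS leqn0 => /eqP -> _ -> //.
by rewrite /act /= divn1 mul1r addr0 divr1.
Qed.

Lemma act_S N al : (0 < N)%N -> al \in Sph N -> exists2 be, be \in Sph N &
  forall z, 0 < Im z -> J (act N al (- z^-1)) = J (act N be z).
Proof.
move=> N0 alS; have [d0 dN bd cb] := SphP N0 alS; case: al alS d0 dN bd cb => d b /= alS d0 dN bd cb.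
have det : b%:Z * 0 - (- (N %/ d)%N%:Z) * d = N by rewrite mulr0 add0r mulNr opprK -PoszM dN.
have pr : primitive b (- (N %/ d)%N%:Z) d 0.
  move=> g; rewrite rpredN !dvdzE /= => h1 h2 h3 _.
  have : (g %| gcdn b (gcdn (N %/ d) d))%N by rewrite !dvdn_gcd h1 h2 h3.
  by rewrite (eqP cb) dvdn1 => /eqP.
have [be be1 be2] := hermite N0 det pr; exists be => // z z0; rewrite -be2 //.
have zn := half_plane_neq0 z0; have dC : (d%:R : C) != 0 by rewrite pnatr_eq0 -lt0n.
rewrite /act /= mulr0z addr0 mulrNz -!pmulrn; congr J.
by field; rewrite dC zn.
Qed.

Lemma act_T N al : (0 < N)%N -> al \in Sph N -> exists2 be, be \in Sph N &
  forall z, 0 < Im z -> J (act N al (z + 1)) = J (act N be z).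
Proof.
move=> N0 alS; have [d0 dN bd cb] := SphP N0 alS; case: al alS d0 dN bd cb => d b /= alS d0 dN bd cb.
have dN' : (N %/ d)%N%:Z * d = N by rewrite -PoszM dN.
have pr : primitive (N %/ d)%N ((N %/ d)%N + b)%N 0 d.
  move=> g; rewrite !dvdzE /= => h1 h2 _ h3; rewrite dvdn_addr // in h2.
  have : (g %| gcdn b (gcdn (N %/ d) d))%N by rewrite !dvdn_gcd h1 h2 h3.
  by rewrite (eqP cb) dvdn1 => /eqP.
have [be be1 be2] := hermite_upper N0 dN' pr; exists be => // z z0; rewrite -be2 //.
by rewrite /act /= -!pmulrn natrD mulrDr mulr1 addrA.
Qed.

(* Every coset representative is reached from diag(N, 1) by the action of SL_2(Z) on the right. *)
Lemma act_transitive N al z : (0 < N)%N -> al \in Sph N -> 0 < Im z ->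
  exists z', [/\ 0 < Im z', J z' = J z & J (N%:R * z') = J (act N al z)].
Proof.
move=> N0 alS z0; have [d0 dN bd cb] := SphP N0 alS.
have a0 : (0 < N %/ al.1)%N by rewrite lt0n; apply/eqP => E; rewrite E mul0n in dN; rewrite -dN in N0.
have [k ck] := coprime_shift a0 d0 cb.
have Im0 := Im_act N0 alS z0; move: Im0; rewrite /act.
case: al alS d0 dN bd cb a0 ck => d b /= _ d0 dN _ _ a0.
set a := (N %/ d)%N in dN a0 *; set s := (b + d * k)%N => ck Im0.
have /coprimezP [[p q] /= Epq] : coprimez s a by rewrite /coprimez /gcdz /= gcdnC; apply/eqP; congr Posz; apply/eqP.
have det : p * s - (- q) * a = 1 by rewrite mulNr opprK.
have det0 : 0 < p * s - (- q) * a by rewrite det.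
have [y0 v0] := Im_moebius z0 det0.
exists ((p%:~R * z + (- q)%:~R) / (a%:~R * z + s%:~R)); split => //.
  exact: J_SL2.
have dC : (d%:R : C) != 0 by rewrite pnatr_eq0 -lt0n.
have x0 : 0 < Im ((a%:R * z + b%:R) / d%:R + (k%:Z)%:~R) by rewrite cImD (intC R _).2 addr0.
rewrite -(J_T_int k Im0) -(J_S x0) -(J_T_int (d%:Z * p) (half_plane_inv x0)); congr J.
have Ex : (a%:R * z + b%:R) / d%:R + k%:Z%:~R = (a%:~R * z + s%:~R) / d%:R.
  by apply: (mulIf dC); rewrite mulrDl !divfK // /s -!pmulrn natrD natrM; ring.
rewrite Ex invf_div mulrA; apply: (mulIf y0); rewrite divfK // [RHS]mulrDl mulNr divfK //.
have -> : N%:R = a%:~R * d%:R :> C by rewrite -dN natrM -pmulrn.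
have := congr1 (fun n : int => n%:~R : C) Epq; rewrite intrD !intrM mulrNz -[(1 : int)%:~R]/(1 : C) => E1.
rewrite -[(Posz d)%:~R]/(d%:R).
move: E1; move: (p%:~R) (q%:~R) (a%:~R) (s%:~R) (d%:R) => p' q' a' s' d' E1.
apply/eqP; rewrite -subr_eq0; apply/eqP; transitivity (d' * (1 - (p' * s' + q' * a'))).
  by ring.
by rewrite E1 subrr mulr0.
Qed.

End Cosets.

(** * Growth at the cusp *)

Section Cusp.
Variable R : realType.
Local Notation C := R[i].
Implicit Types (z w u : C) (h : C -> C) (p q : {poly C}) (al be : nat * nat).
Local Notation Im := (@complex.Im R).
Local Notation J := (@J R).

Lemma ccvg_sum (I : Type) (r : seq I) (F : I -> nat -> C) (L : I -> C) :
  (forall i, ccvg (F i) (L i)) -> ccvg (fun n => \sum_(i <- r) F i n) (\sum_(i <- r) L i).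
Proof.
move=> hF; elim: r => [|i r IH].
  by rewrite big_nil; apply: (ccvg_ext _ (ccvg_cst 0)) => n; rewrite big_nil.
by rewrite big_cons; apply: (ccvg_ext _ (ccvgD (hF i) IH)) => n; rewrite big_cons.
Qed.

Lemma ccvg_neq0 (u : nat -> C) l : ccvg u l -> l != 0 ->
  exists K, forall k, (K <= k)%N -> u k != 0.
Proof.
move=> hu l0; have n0 : 0 < normc l by rewrite normc_gt0.
have [K HK] := hu _ n0; exists K => k /HK; rewrite ger0_norm ?normc_ge0 //.
by apply: contraTneq => ->; rewrite sub0r normcN ltxx.
Qed.

Lemma eventually_all (T : eqType) (s : seq T) (Q : T -> nat -> Prop) :
  (forall x, x \in s -> exists K, forall k, (K <= k)%N -> Q x k) ->
  exists K, forall k, (K <= k)%N -> forall x, x \in s -> Q x k.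
Proof.
elim: s => [|x s IH] h; first by exists 0%N.
have [|K1 H1] := IH; first by move=> y ys; apply: h; rewrite inE ys orbT.
have [K2 H2] := h x (mem_head _ _); exists (maxn K1 K2) => k; rewrite geq_max => /andP[k1 k2] y.
by rewrite inE => /orP[/eqP -> |]; [exact: H2 | exact: H1].
Qed.

Variable N : nat.
Hypothesis N0 : (0 < N)%N.

Let NC : (N%:R : C) != 0. Proof. by rewrite pnatr_eq0 -lt0n. Qed.

Definition cusp k : C := k.+1%:R * N%:R * Complex 0 1.
Definition wcusp k : C := wN N (cusp k).

Lemma Im_cusp k : 0 < Im (cusp k).
Proof.
by rewrite /cusp -natrM cImM cRe_nat cIm_nat /= mulr1 mul0r addr0 ltr0n muln_gt0.
Qed.

Lemma wcuspE k : wcusp k = eC (Complex 0 1) ^+ k.+1.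
Proof. by rewrite -eC_natM /wcusp /wN /cusp; congr eC; rewrite [LHS]mulrAC mulfK. Qed.

Lemma wcusp_neq0 k : wcusp k != 0. Proof. exact: eC_neq0. Qed.

Lemma ccvg_wcusp : ccvg wcusp 0.
Proof.
have t1 : normc (eC (Complex 0 1) : C) < 1 by apply: eC_lt1; rewrite /= ltr01.
have ht : 0 <= normc (eC (Complex 0 1) : C) < 1 by rewrite normc_ge0.
have := rnull_subseq (rnull_exp ht) (fun n => leqnSn n).
move=> h; apply: rnull_le h _ => n; rewrite ger0_norm ?normc_ge0 // subr0 wcuspE normcX.
exact: lexx.
Qed.

Lemma ccvg_wcuspX m : ccvg (fun k => wcusp k ^+ m) (0 ^+ m).
Proof. exact: (ccvgX m ccvg_wcusp). Qed.

(* [growth h m L] : h ~ L w^{-m} as z goes to the cusp, with w = e^{2 i pi z/N} *)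
Definition growth h m L := ccvg (fun k => wcusp k ^+ m * h (cusp k)) L.

Lemma growth_ext h1 h2 m L : (forall z, 0 < Im z -> h1 z = h2 z) -> growth h1 m L -> growth h2 m L.
Proof. by move=> E; apply: ccvg_ext => k; rewrite E // Im_cusp. Qed.

Lemma growth_const c : growth (fun _ => c) 0 c.
Proof. by apply: (ccvg_ext _ (ccvg_cst c)) => k; rewrite mul1r. Qed.

Lemma growth_pad h m n L : growth h m L -> (m < n)%N -> growth h n 0.
Proof.
move=> hh mn; have := ccvgM (ccvg_wcuspX (n - m)) hh.
rewrite expr0n subn_eq0 leqNgt mn mul0r; apply: ccvg_ext => k.
by rewrite mulrA -exprD subnK // ltnW.
Qed.

Lemma growthB h1 h2 m L1 L2 : growth h1 m L1 -> growth h2 m L2 ->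
  growth (fun z => h1 z - h2 z) m (L1 - L2).
Proof. by move=> g1 g2; apply: (ccvg_ext _ (ccvgB g1 g2)) => k; rewrite mulrBr. Qed.

Lemma growthM h1 h2 m1 m2 L1 L2 : growth h1 m1 L1 -> growth h2 m2 L2 ->
  growth (fun z => h1 z * h2 z) (m1 + m2) (L1 * L2).
Proof. by move=> g1 g2; apply: (ccvg_ext _ (ccvgM g1 g2)) => k; rewrite exprD mulrACA. Qed.

Lemma growthB_max h1 h2 m1 m2 L1 L2 : growth h1 m1 L1 -> growth h2 m2 L2 ->
  L1 != 0 -> L2 != 0 -> (m1 = m2 -> L1 != L2) ->
  exists2 L, L != 0 & growth (fun z => h1 z - h2 z) (maxn m1 m2) L.
Proof.
move=> g1 g2 n1 n2; case: (ltngtP m1 m2) => [lt|lt|E] hL.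
- by exists (0 - L2); [rewrite sub0r oppr_eq0 | apply: growthB (growth_pad g1 lt) g2].
- by exists (L1 - 0); [rewrite subr0 | apply: growthB g1 (growth_pad g2 lt)].
by exists (L1 - L2); [rewrite subr_eq0 hL | apply: growthB => //; rewrite E].
Qed.

Lemma growth_prod (T : eqType) (s : seq T) (F : T -> C -> C) (m : T -> nat) :
  (forall x, x \in s -> exists2 L, L != 0 & growth (F x) (m x) L) ->
  exists2 L, L != 0 & growth (fun z => \prod_(x <- s) F x z) (\sum_(x <- s) m x) L.
Proof.
elim: s => [|x s IH] h.
  exists 1; first exact: oner_neq0.
  by rewrite big_nil; apply: growth_ext (growth_const 1) => z _; rewrite big_nil.
have [|L1 n1 g1] := IH; first by move=> y ys; apply: h; rewrite inE ys orbT.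
have [L2 n2 g2] := h x (mem_head _ _); exists (L2 * L1); first by rewrite mulf_neq0.
by rewrite big_cons; apply: growth_ext (growthM g2 g1) => z _; rewrite big_cons.
Qed.

Lemma growth_neq0 h m L : growth h m L -> L != 0 ->
  exists K, forall k, (K <= k)%N -> h (cusp k) != 0.
Proof.
move=> g L0; have [K HK] := ccvg_neq0 g L0; exists K => k /HK.
by apply: contraNneq => ->; rewrite mulr0.
Qed.

Lemma growth_inj h m1 m2 L1 L2 : growth h m1 L1 -> growth h m2 L2 -> L1 != 0 -> L2 != 0 -> m1 = m2.
Proof.
move=> g1 g2 n1 n2; case: (ltngtP m1 m2) => // lt.
  by rewrite (ccvg_uniq g2 (growth_pad g1 lt)) eqxx in n2.
by rewrite (ccvg_uniq g1 (growth_pad g2 lt)) eqxx in n1.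
Qed.

Lemma growth_ev (f : pser C) (c : C) m : CV f -> c != 0 ->
  growth (fun z => ev f (wN N z) / (c * wN N z ^+ m)) m (cf f 0 / c).
Proof.
move=> hf c0; rewrite [cf f 0 / c]mulrC.
have := ccvgMl c^-1 (ccvg_ev0 hf ccvg_wcusp); apply: ccvg_ext => k.
rewrite -/(wcusp k); have : wcusp k ^+ m != 0 by rewrite expf_neq0 // wcusp_neq0.
by move: (_ ^+ m) (ev f _) => b a b0; field; rewrite c0 b0.
Qed.

Lemma Sph_gt0 al : al \in Sph N -> (0 < N %/ al.1)%N.
Proof.
move=> /(SphP N0)[_ dN _ _]; rewrite lt0n; apply/eqP => E; move: N0.
by rewrite -[X in (0 < X)%N]dN E.
Qed.

Lemma cf_psub0 k c (f : pser C) : cf (psub k c f) 0 = cf f 0.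
Proof. by rewrite /= dvdn0 div0n expr0 mulr1. Qed.

Definition zeta al : C := eC (al.2%:R / al.1%:R).
(* [J (act al z)] is equivalent to [(zeta al)^{-1} w^{- mexp al}]: with a d = N, a/d = a^2/N. *)
Definition mexp al : nat := ((N %/ al.1) ^ 2)%N.

Lemma zeta_neq0 al : zeta al != 0. Proof. exact: eC_neq0. Qed.

Lemma normc_zeta al : normc (zeta al) = 1.
Proof. by rewrite normc_eC natC_div mulr0 oppr0 expR0. Qed.

Lemma mexp_gt0 al : al \in Sph N -> (0 < mexp al)%N.
Proof. by move=> aS; rewrite expn_gt0 Sph_gt0. Qed.

Lemma eC_act al z : al \in Sph N -> eC (act N al z) = zeta al * wN N z ^+ mexp al.
Proof.
move=> aS; have [d0 dN _ _] := SphP N0 aS; rewrite -eC_natM /zeta -eCD; congr eC.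
have dC : (al.1%:R : C) != 0 by rewrite pnatr_eq0 -lt0n.
rewrite /act mulrDl addrC /mexp expnS expn1 natrM -{4}dN natrM; congr (_ + _).
have aC : ((N %/ al.1)%:R : C) != 0 by rewrite pnatr_eq0 -lt0n Sph_gt0.
by move: aC dC; move: ((N %/ al.1)%:R) (al.1%:R) => a d aC dC; field; rewrite aC dC.
Qed.

Lemma J_act al z : al \in Sph N -> 0 < Im z ->
  J (act N al z) = ev (psub (mexp al) (zeta al) (cJ R)) (wN N z) / (zeta al * wN N z ^+ mexp al).
Proof.
move=> aS z0; have cj := @CV_cJ R.
by rewrite (ev_psub (mexp_gt0 aS) (normc_zeta al) cj (wN_lt1 N0 z0)) /J eC_act.
Qed.

Lemma growth_Jact al : al \in Sph N -> growth (fun z => J (act N al z)) (mexp al) (zeta al)^-1.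
Proof.
move=> aS; have cs := CV_psub (mexp_gt0 aS) (normc_zeta al) (@CV_cJ R).
have := growth_ev (mexp al) cs (zeta_neq0 al).
rewrite cf_psub0 cf_cJ0 mul1r.
by apply: growth_ext => z z0; rewrite J_act.
Qed.

Lemma growth_J : growth J N 1.
Proof.
have cs := CV_psub N0 (normc1 R) (@CV_cJ R).
have := growth_ev N cs (oner_neq0 C).
rewrite cf_psub0 cf_cJ0 divr1.
apply: growth_ext => z z0.
by rewrite (ev_psub N0 (normc1 R) (@CV_cJ R) (wN_lt1 N0 z0)) !mul1r (wN_pow N0).
Qed.

Lemma growth_poly p d : (size p <= d.+1)%N -> growth (fun z => p.[J z]) (N * d) p`_d.
Proof.
move=> sp; have [L HL] : exists L : 'I_d.+1 -> C, forall i, L i = p`_i * 1 ^+ i * (0 ^+ N) ^+ (d - i).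
  by exists (fun i : 'I_d.+1 => p`_i * 1 ^+ i * (0 ^+ N) ^+ (d - i)).
have -> : p`_d = \sum_(i < d.+1) L i.
  rewrite big_ord_recr /= big1 => [|i _]; first by rewrite add0r HL /= subnn expr0 expr1n !mulr1.
  by rewrite HL /= -exprM expr0n muln_eq0 (gtn_eqF N0) subn_eq0 leqNgt ltn_ord mulr0.
apply: ccvg_ext (ccvg_sum (index_enum 'I_d.+1) (_ : forall i : 'I_d.+1,
  ccvg (fun k => p`_i * (wcusp k ^+ N * J (cusp k)) ^+ i * (wcusp k ^+ N) ^+ (d - i)) (L i))) => [k|i]; last first.
  rewrite HL.
  exact: (ccvgM (ccvgMl p`_i (ccvgX i growth_J)) (ccvgX (d - i) (ccvg_wcuspX N))).
rewrite (horner_coef_wide _ sp) mulr_sumr; apply: eq_bigr => i _.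
have id : (i <= d)%N by rewrite -ltnS.
rewrite exprMn; have -> : (N * d = N * i + N * (d - i))%N by rewrite -mulnDr subnKC.
rewrite exprD !exprM.
move: (_ ^+ i) (_ ^+ (d - i)) (J _ ^+ i) p`_i => a b c e; ring.
Qed.

Lemma Sph_eq al be : al \in Sph N -> be \in Sph N -> mexp al = mexp be -> al.1 = be.1.
Proof.
move=> /(SphP N0)[_ d1 _ _] bS; have [_ d2 _ _] := SphP N0 bS; move=> /eqP; rewrite eqn_exp2r // => /eqP E; rewrite E in d1.
by apply/eqP; rewrite -(eqn_pmul2l (Sph_gt0 bS)) d1 d2.
Qed.

Lemma growth_diff al be : al \in Sph N -> be \in Sph N -> al != be ->
  exists m, exists2 L, L != 0 & growth (fun z => J (act N al z) - J (act N be z)) m L.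
Proof.
move=> aS bS ab; exists (maxn (mexp al) (mexp be)).
apply: growthB_max (growth_Jact aS) (growth_Jact bS) _ _ _; rewrite ?invr_eq0 ?zeta_neq0 // => E.
have d12 := Sph_eq aS bS E; apply: contra_neq ab => /invr_inj.
have [_ _ b1 _] := SphP N0 aS; have [_ _ b2 _] := SphP N0 bS.
rewrite /zeta d12 => /eC_inj_frac; rewrite -{1}d12 b1 b2 => /(_ isT isT) b12.
by case: al be d12 b12 {aS bS E b1 b2} => a b [c d] /= -> ->.
Qed.

Lemma J_act_inj al be : al \in Sph N -> be \in Sph N ->
  (forall z, 0 < Im z -> J (act N al z) = J (act N be z)) -> al = be.
Proof.
move=> aS bS E; apply/eqP/negPn/negP => /(growth_diff aS bS)[m [L L0 g]].
have [K HK] := growth_neq0 g L0; have := HK K (leqnn _).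
by rewrite E ?Im_cusp // subrr eqxx.
Qed.

Lemma uniq_J_act : exists K, forall k, (K <= k)%N -> uniq [seq J (act N al (cusp k)) | al <- Sph N].
Proof.
have [al aS|K HK] := @eventually_all _ (Sph N)
   (fun al k => forall be, be \in Sph N -> al != be -> J (act N al (cusp k)) != J (act N be (cusp k))) _.
  apply: eventually_all => be bS; have [<-|ab] := eqVneq al be; first by exists 0%N.
  have [m [L L0 g]] := growth_diff aS bS ab; have [K HK] := growth_neq0 g L0.
  by exists K => k /HK h _; rewrite -subr_eq0.
exists K => k /HK h; rewrite map_inj_in_uniq ?uniq_Sph // => al be aS bS E.
by apply/eqP/negPn/negP => ab; have := h al aS be bS ab; rewrite E eqxx.
Qed.

Definition charpoly z : {poly C} := \prod_(al <- Sph N) ('X - (J (act N al z))%:P).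

Lemma charpoly_inv (f : C -> C) :
  (forall z, 0 < Im z -> 0 < Im (f z)) -> (forall z, 0 < Im z -> exists2 u, 0 < Im u & f u = z) ->
  (forall al, al \in Sph N -> exists2 be, be \in Sph N &
     forall z, 0 < Im z -> J (act N al (f z)) = J (act N be z)) ->
  forall z, 0 < Im z -> charpoly (f z) = charpoly z.
Proof.
move=> fH fS hf.
have [s Hs] : {s : nat * nat -> nat * nat & forall al, al \in Sph N -> s al \in Sph N /\
     forall z, 0 < Im z -> J (act N al (f z)) = J (act N (s al) z)}.
  apply: (@choice _ _ (fun al be => al \in Sph N -> be \in Sph N /\
     forall z, 0 < Im z -> J (act N al (f z)) = J (act N be z))) => al.
  have [aS|nS] := boolP (al \in Sph N); last by exists al.
  by have [be b1 b2] := hf al aS; exists be.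
have sI : {in Sph N &, injective s}.
  move=> al be aS bS E; apply: (J_act_inj aS bS) => z z0.
  by have [u u0 <-] := fS z z0; rewrite (Hs _ aS).2 // (Hs _ bS).2 // E.
have pe : perm_eq [seq s al | al <- Sph N] (Sph N).
  have us : uniq [seq s al | al <- Sph N] by rewrite map_inj_in_uniq ?uniq_Sph.
  have sub : {subset [seq s al | al <- Sph N] <= Sph N}.
    by move=> _ /mapP[al aS ->]; apply: (Hs al aS).1.
  apply: (uniq_perm us (uniq_Sph N)).
  by have [] := uniq_min_size us sub _; rewrite ?size_map.
move=> z z0; rewrite /charpoly -[RHS](perm_big _ pe) big_map /=.
by apply: eq_big_seq => al aS; rewrite (Hs al aS).2.
Qed.

Lemma charpoly_T z : 0 < Im z -> charpoly (z + 1) = charpoly z.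
Proof.
apply: (@charpoly_inv (fun z => z + 1)).
- by move=> u u0; rewrite cImD /= addr0.
- by move=> u u0; exists (u - 1); [rewrite cImB /= subr0 | rewrite subrK].
by move=> al aS; apply: act_T.
Qed.

Lemma charpoly_S z : 0 < Im z -> charpoly (- z^-1) = charpoly z.
Proof.
apply: (@charpoly_inv (fun z => - z^-1)).
- by move=> u u0; apply: half_plane_inv.
- by move=> u u0; exists (- u^-1); [exact: half_plane_inv | rewrite invrN opprK invrK].
by move=> al aS; apply: act_S.
Qed.

Lemma puiseux_Jact al : al \in Sph N -> puiseux N (fun z => J (act N al z)).
Proof.
move=> aS; have cs := CV_psub (mexp_gt0 aS) (normc_zeta al) (@CV_cJ R).
have cc := CV_const (zeta al)^-1.
exists (mexp al), (pconst (zeta al)^-1 * psub (mexp al) (zeta al) (cJ R)).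
split; first exact: (CV_mul cc cs).
move=> z z0; have w1 := wN_lt1 N0 z0.
by rewrite J_act // (evM cc cs w1) (ev_const _ w1) invfM mulrA [ev _ _ / _]mulrC.
Qed.

Lemma puiseux_charpoly b : puiseux N (fun z => (charpoly z)`_b).
Proof.
rewrite /charpoly; have : {subset Sph N <= Sph N} by [].
elim: {1 3}(Sph N) b => [|al s IH] b sub.
  apply: (puiseux_ext _ (puiseux_const N0 ((1 : {poly C})`_b))) => z _.
  by rewrite big_nil.
have sub' : {subset s <= Sph N} by move=> x xs; apply: sub; rewrite inE xs orbT.
have aS := sub al (mem_head _ _).
have h1 : puiseux N (fun z => if b == 0%N then 0 else (\prod_(al <- s) ('X - (J (act N al z))%:P))`_b.-1).
  by case: (b == 0%N); [exact: puiseux_const | exact: IH].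
apply: (puiseux_ext _ (puiseux_sub N0 h1 (puiseux_mul N0 (puiseux_Jact aS) (IH b sub')))) => z z0.
by rewrite big_cons mulrBl coefB coefXM coefCM.
Qed.

Lemma exists_modular_poly : exists P : {poly {poly C}},
  [/\ P \is monic, size P = (size (Sph N)).+1
    & forall z, 0 < Im z -> map_poly (horner_eval (J z)) P = charpoly z].
Proof.
have hp b : exists p, forall z, 0 < Im z -> (charpoly z)`_b = p.[J z].
  apply: (invariant_polynomial N0 (puiseux_charpoly b)).
    by move=> z z0; rewrite charpoly_T.
  by move=> z z0; rewrite charpoly_S.
have [p Hp] := choice hp; set n := size (Sph N).
have sP : (size (\poly_(b < n) p b) < size ('X^n : {poly {poly C}}))%N.
  by rewrite size_polyXn ltnS size_poly.
exists ('X^n + \poly_(b < n) p b); split.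
- by rewrite monicE lead_coefDl // lead_coefXn.
- by rewrite size_polyDl // size_polyXn.
move=> z z0; apply/polyP => i; rewrite coef_map coefD coefXn coef_poly /= horner_evalE.
have szc : size (charpoly z) = n.+1 by rewrite size_prod_XsubC.
have mc : charpoly z \is monic by apply: monic_prod_XsubC.
case: (ltngtP i n) => lt; rewrite ?add0r ?addr0.
- by rewrite Hp.
- by rewrite horner0 nth_default // szc.
by rewrite hornerC lt -[n]/(n.+1.-1) -szc -lead_coefE (monicP mc).
Qed.

Definition beval (P : {poly {poly C}}) x y : C := (map_poly (horner_eval x) P).[y].

Lemma beval_charpoly P : (forall z, 0 < Im z -> map_poly (horner_eval (J z)) P = charpoly z) ->
  forall z, 0 < Im z -> beval P (J z) (J (N%:R * z)) = 0.
Proof.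
move=> hP z z0; rewrite /beval hP //; apply/rootP; rewrite /charpoly.
have S1 : (1%N, 0%N) \in Sph N by rewrite mem_Sph // dvd1n /= gcdn1.
rewrite (big_rem _ S1) /= rootM root_XsubC /act /= divn1 addr0 divr1.
by rewrite eqxx.
Qed.

Lemma size_vanishing (Q : {poly {poly C}}) : Q != 0 ->
  (forall z, 0 < Im z -> beval Q (J z) (J (N%:R * z)) = 0) -> (size (Sph N) < size Q)%N.
Proof.
move=> Q0 hQ; pose q := lead_coef Q; have q0 : q != 0 by rewrite lead_coef_eq0.
have sq : (size q <= (size q).-1.+1)%N by exact: leqSpred.
have lq : q`_(size q).-1 != 0 by rewrite -lead_coefE lead_coef_eq0.
have [K1 H1] := growth_neq0 (growth_poly sq) lq.
have [K2 H2] := uniq_J_act; pose k := maxn K1 K2.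
have qk := H1 k (leq_maxl _ _); have uk := H2 k (leq_maxr _ _).
have z0 := Im_cusp k; set z := cusp k in qk uk z0.
have nz : map_poly (horner_eval (J z)) Q != 0.
  apply: contraNneq qk => E; have := congr1 (fun r : {poly C} => r`_(size Q).-1) E.
  by rewrite coef_map coef0 /= horner_evalE -lead_coefE => ->.
have := max_poly_roots nz _ uk; rewrite size_map => h.
apply: leq_trans (h _) (size_poly _ _); apply/allP => _ /mapP[al aS ->].
have [u [u0 u1 u2]] := act_transitive N0 aS z0.
by apply/rootP; rewrite -u1 -u2; exact: hQ.
Qed.

End Cusp.

(** * Degrees *)

Section DegreeCount.
Local Open Scope nat_scope.

Lemma count_coprime e m :
  count (fun b => coprime b e) (iota 0 (m * e)) = (m * totient e)%N.
Proof.
elim: m => [|m IH]; first by rewrite !mul0n.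
rewrite mulSn addnC iotaD count_cat IH add0n -[in RHS]addn1 mulnDl mul1n; congr addn.
rewrite -[X in iota X]addn0 iotaDl count_map totient_count_coprime -sum1_count.
rewrite big_mkcond /index_iota subn0; apply: eq_bigr => b _ /=.
by rewrite /coprime gcdnC gcdnMDl; case: (_ == _).
Qed.

Definition psi N d := (d %/ gcdn d (N %/ d) * totient (gcdn d (N %/ d)))%N.

Lemma sum_Sph N (F : nat -> nat) :
  (\sum_(al <- Sph N) F al.1 = \sum_(d <- divisors N) psi N d * F d)%N.
Proof.
rewrite /Sph big_allpairs_dep /=; apply: eq_bigr => d _.
rewrite big_const_seq count_predT size_filter iter_addn_0 mulnC; congr muln.
by have := count_coprime (gcdn d (N %/ d)) (d %/ gcdn d (N %/ d)); rewrite divnK ?dvdn_gcdl // [gcdn (N %/ d) d]gcdnC.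
Qed.

Lemma deg_identity N : (0 < N)%N ->
  (\sum_(al <- Sph N) maxn N ((N %/ al.1) ^ 2) = N * deg_formula N)%N.
Proof.
move=> N0; rewrite (sum_Sph N (fun d => maxn N ((N %/ d) ^ 2))).
have dP d : d \in divisors N -> (N %/ d * d = N)%N.
  by rewrite -dvdn_divisors // => dN; rewrite divnK.
have Ediv d : d \in divisors N -> (0 < d)%N by move/dP; case: d => // E; rewrite muln0 in E; rewrite -E in N0.
have a0 d : d \in divisors N -> (0 < N %/ d)%N.
  by move/dP; case: (N %/ d)%N => // E; rewrite mul0n in E; rewrite -E in N0.
have big1' d : d \in divisors N -> (N < d * d)%N = (N %/ d < d)%N.
  by move=> dd; rewrite -{1}(dP d dd) ltn_pmul2r // Ediv.
have sm d : d \in divisors N -> (d * d < N)%N = (d < N %/ d)%N.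
  by move=> dd; rewrite -{1}(dP d dd) ltn_pmul2r // Ediv.
have Nd d : d \in divisors N -> (N %/ d)%N \in divisors N.
  by move=> dd; rewrite -dvdn_divisors // -{2}(dP d dd) dvdn_mulr.
have da d : d \in divisors N -> (N %/ (N %/ d) = d)%N.
  by move=> dd; rewrite -{1}(dP d dd) mulKn // a0.
have pe : perm_eq (divisors N) [seq (N %/ d)%N | d <- divisors N].
  have inj : {in divisors N &, injective (fun d => N %/ d)%N}.
    by move=> x y xd yd E; rewrite -(da x xd) E da.
  apply: uniq_perm; rewrite ?map_inj_in_uniq ?divisors_uniq // => d.
  apply/idP/mapP => [dd|[x xd ->]]; last exact: Nd.
  by exists (N %/ d)%N; rewrite ?da ?Nd.
rewrite (bigID (fun d => N < d * d)%N) /= /deg_formula mulnDr mulnA [(N * 2)%N]mulnC -mulnA.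
rewrite mul2n -addnn -addnA; congr addn.
  rewrite big_distrr /= big_seq_cond [RHS]big_seq_cond; apply: eq_bigr => d /andP[dd].
  rewrite big1' // => lt; rewrite mulnC; congr muln; apply/maxn_idPl.
  by rewrite -[leqRHS](dP d dd) -mulnn leq_pmul2l ?a0 // ltnW.
rewrite (bigID (fun d => d * d < N)%N) /=; congr addn.
  rewrite (perm_big _ pe) /= big_map big_distrr /=.
  rewrite big_seq_cond [RHS]big_seq_cond; apply: congr_big => // [d|d /andP[dd]].
    case: (boolP (d \in _)) => //= dd.
    by rewrite (sm _ (Nd d dd)) !big1' ?Nd // da //; case: ltngtP.
  rewrite (sm _ (Nd d dd)) da // => /andP[_ lt].
  have -> : maxn N (d ^ 2) = (d ^ 2)%N.
    by apply/maxn_idPr; rewrite -{1}(dP d dd) -mulnn leq_pmul2r ?Ediv // ltnW.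
  rewrite /psi (da d dd) [gcdn (N %/ d) d]gcdnC; set e := gcdn d (N %/ d).
  rewrite mulnAC [RHS]mulnA; congr muln.
  have key x y : (y * (x * e * (x * e)) = (y * e) * (x * e) * x)%N by lia.
  have := key (d %/ e)%N (N %/ d %/ e)%N.
  rewrite (divnK (dvdn_gcdl d (N %/ d) : (e %| d)%N)) (divnK (dvdn_gcdr d (N %/ d) : (e %| N %/ d)%N)).
  by rewrite (dP d dd) mulnn.
rewrite /phi_sqrt; set s := Nat.sqrt N.
have eqd d : d \in divisors N -> (~~ (N < d * d) && ~~ (d * d < N))%N = (d == s) && (s * s == N)%N.
  move=> dd; rewrite -!leqNgt andbC -eqn_leq eq_sym; apply/eqP/andP => [E|[/eqP -> /eqP //]].
  have ds : s = d by rewrite /s -E; apply: PeanoNat.Nat.sqrt_square.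
  by rewrite ds E !eqxx.
rewrite big_seq_cond (eq_bigl (fun d => (d \in divisors N) && ((d == s) && (s * s == N)%N))); last first.
  move=> d; case: (boolP (d \in _)) => //= dd; rewrite -eqd //.
case: eqP => E; last by rewrite muln0 big1 // => d; rewrite !andbF.
have sN : s \in divisors N by rewrite -dvdn_divisors // -E dvdn_mulr.
rewrite -big_filter (_ : [seq _ <- _ | _] = [:: s]); last first.
  rewrite -(filter_pred1_uniq (divisors_uniq N) sN); apply: eq_in_filter => d dd.
  by rewrite dd /= andbT.
rewrite big_seq1.
have s0 := Ediv s sN; have Ns : (N %/ s = s)%N by rewrite -E mulKn.
by rewrite /psi Ns gcdnn divnn s0 mul1n mulnC -mulnn E maxnn.
Qed.

End DegreeCount.

Section Degrees.
Variable R : realType.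
Local Notation C := R[i].
Implicit Types (z w u : C) (h : C -> C) (p q : {poly C}) (al be : nat * nat).
Local Notation Im := (@complex.Im R).
Local Notation J := (@J R).
Variable N : nat.
Hypothesis N2 : (1 < N)%N.
Let N0 : (0 < N)%N := ltnW N2.

Lemma zeta_neq1 al : al \in Sph N -> N = mexp N al -> zeta R al != 1.
Proof.
move=> aS E; have [d0 dN bd cb] := SphP N0 aS; apply: contraTneq N2 => z1.
have ad : (N %/ al.1 = al.1)%N.
  apply/eqP; rewrite eq_sym -(eqn_pmul2l (Sph_gt0 N0 aS)); apply/eqP.
  by rewrite dN mulnn; exact: E.
have b0 : al.2 = 0%N.
  by apply: (@eC_inj_frac R al.1) => //; rewrite -/(zeta R al) z1 mul0r eC0.
by move: cb; rewrite ad gcdnn b0 /coprime gcd0n => /eqP d1; rewrite -dN ad d1.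
Qed.

Lemma growth_diag : exists2 L, L != 0 &
  growth N (fun z => \prod_(al <- Sph N) (J z - J (act N al z))) (\sum_(al <- Sph N) maxn N (mexp N al)) L.
Proof.
apply: (growth_prod N0) => al aS.
apply: (growthB_max N0 (@growth_J R N N0) (@growth_Jact R N N0 al aS)); rewrite ?oner_neq0 ?invr_eq0 ?zeta_neq0 // => E.
by rewrite eq_sym -[1]invr1 (inj_eq invr_inj) (zeta_neq1 aS E).
Qed.

Variable P : {poly {poly C}}.
Hypothesis hP : forall z, 0 < Im z -> map_poly (horner_eval (J z)) P = charpoly N z.

Lemma horner_diag x : P.['X].[x] = (map_poly (horner_eval x) P).[x].
Proof. by rewrite -{3}(hornerX x) -[LHS]horner_evalE -horner_map /= horner_evalE. Qed.

Lemma size_diag : (size P.['X]).-1 = deg_formula N.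
Proof.
have [L L0 g] := growth_diag; set d := P.['X].
have gd : growth N (fun z => d.[J z]) (\sum_(al <- Sph N) maxn N (mexp N al)) L.
  apply: (growth_ext N0 _ g) => z z0; rewrite /d horner_diag hP // /charpoly horner_prod.
  by apply: eq_bigr => al _; rewrite hornerXsubC.
have d0 : d != 0.
  apply/eqP => d0; have [K HK] := growth_neq0 gd L0.
  by have := HK K (leqnn _); rewrite d0 horner0 eqxx.
have l0 : d`_(size d).-1 != 0 by rewrite -lead_coefE lead_coef_eq0.
have gp := growth_poly N0 (leqSpred (size d)).
have := growth_inj N0 gp gd l0 L0; rewrite (deg_identity N0) => /eqP.
by rewrite eqn_pmul2l // => /eqP.
Qed.

(* Substituting [Y = w^{-N} Y'] makes each [w^{max(N, a^2)} (Y - J_al)] bounded in Y'. *)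
Lemma charpoly_coef_bound (s : seq (nat * nat)) b : {subset s <= Sph N} ->
  exists c L, ccvg c L /\ forall k,
    wcusp R N k ^+ (\sum_(al <- s) maxn N (mexp N al)) *
      (\prod_(al <- s) ('X - (J (act N al (cusp R N k)))%:P))`_b = wcusp R N k ^+ (N * b) * c k.
Proof.
elim: s b => [|al s IH] b sub.
  exists (fun _ => (b == 0%N)%:R), (b == 0%N)%:R; split; first exact: ccvg_cst.
  by move=> k; rewrite !big_nil expr0 mul1r coef1; case: b => [|b]; rewrite ?muln0 ?mul1r ?mulr0.
have sub' : {subset s <= Sph N} by move=> x xs; apply: sub; rewrite inE xs orbT.
have aS := sub al (mem_head _ _).
have [c [L [hc Ec]]] := IH b sub'.
have [c' [L' [hc' Ec']]] : exists c' L', ccvg c' L' /\ forall k,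
    wcusp R N k ^+ (\sum_(al <- s) maxn N (mexp N al)) * (wcusp R N k ^+ N *
      (if b == 0%N then 0 else (\prod_(al <- s) ('X - (J (act N al (cusp R N k)))%:P))`_b.-1))
    = wcusp R N k ^+ (N * b) * c' k.
  case: b {c L hc Ec} => [|b].
    by exists (fun=> 0), 0; split; [exact: ccvg_cst | move=> k; rewrite !mulr0].
  have [c [L [hc Ec]]] := IH b sub'; exists c, L; split => // k.
  by rewrite /= mulrCA Ec mulnS exprD mulrA.
pose m := mexp N al; pose M := maxn N m.
have gm := ccvgM (@ccvg_wcuspX R N N0 (M - m)) (@growth_Jact R N N0 al aS).
exists (fun k => wcusp R N k ^+ (M - N) * c' k -
   wcusp R N k ^+ (M - m) * (wcusp R N k ^+ m * J (act N al (cusp R N k))) * c k).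
exists (0 ^+ (M - N) * L' - 0 ^+ (M - m) * (zeta R al)^-1 * L); split.
  exact: (ccvgB (ccvgM (@ccvg_wcuspX R N N0 (M - N)) hc') (ccvgM gm hc)).
move=> k; rewrite !big_cons mulrBl coefB coefXM coefCM -/m -/M.
have EN : wcusp R N k ^+ M = wcusp R N k ^+ (M - N) * wcusp R N k ^+ N.
  by rewrite -exprD subnK // leq_maxl.
have Em : wcusp R N k ^+ M = wcusp R N k ^+ (M - m) * wcusp R N k ^+ m.
  by rewrite -exprD subnK // leq_maxr.
rewrite mulrBr [RHS]mulrBr; congr (_ - _).
  by rewrite exprD EN mulrCA -Ec'; move: (_ ^+ N) (_ ^+ (M - N)) (_ ^+ (\sum_(j <- s) _)) (if _ then _ else _) => a e f g; ring.
rewrite exprD Em [RHS]mulrCA -Ec.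
by move: (_ ^+ m) (_ ^+ (M - m)) (_ ^+ (\sum_(j <- s) _)) (_`_b) (J _) => a e f g h; ring.
Qed.

Lemma size_coef_bound b : P`_b != 0 -> (b + (size (P`_b)%R).-1 <= deg_formula N)%N.
Proof.
move=> pb0; rewrite leqNgt; apply/negP => lt; set p := P`_b in pb0 lt; set d := (size p).-1 in lt.
have l0 : p`_d != 0 by rewrite -lead_coefE lead_coef_eq0.
have gp := growth_poly N0 (leqSpred (size p)) : growth N _ (N * d) p`_d.
have [c [L [hc Ec]]] := @charpoly_coef_bound (Sph N) b (fun x xs => xs).
rewrite (deg_identity N0) in Ec; pose e := (N * (b + d) - N * deg_formula N)%N.
have e0 : (0 < e)%N by rewrite subn_gt0 ltn_pmul2l.
have h := ccvgM (@ccvg_wcuspX R N N0 e) hc.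
have {h} : ccvg (fun k => wcusp R N k ^+ (N * d) * p.[J (cusp R N k)]) (0 ^+ e * L).
  apply: ccvg_ext h => k.
  have wn : wcusp R N k ^+ (N * deg_formula N) != 0 by rewrite expf_neq0 // wcusp_neq0.
  apply: (mulfI wn); rewrite mulrA -exprD /e subnKC ?leq_pmul2l // 1?ltnW //.
  have -> : p.[J (cusp R N k)] = (charpoly N (cusp R N k))`_b.
    by rewrite -hP ?Im_cusp // coef_map /= horner_evalE.
  by rewrite [RHS]mulrCA Ec mulrA -exprD -mulnDr addnC.
rewrite expr0n gtn_eqF // mul0r => h0.
by rewrite (ccvg_uniq gp h0) eqxx in l0.
Qed.

End Degrees.

(** * Descent of the coefficients *)

Section Functional.
Variable F : numFieldType.

Definition qcomb (m : nat -> rat) (e : seq F) := \sum_(i < size e) ratr (m i) * e`_i.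

Lemma qfree_basis (x : F) (s : seq F) : x != 0 -> exists e : seq F,
  [/\ e`_0 = x, (0 < size e)%N,
      forall m, qcomb m e = 0 -> forall i, (i < size e)%N -> m i = 0
    & forall u, u \in s -> exists m, u = qcomb m e].
Proof.
move=> x0; elim: s => [|u s [e [e0 se fr sp]]].
  exists [:: x]; split => // m; rewrite /qcomb big_ord_recl big_ord0 addr0 /= => /eqP.
  by rewrite mulf_eq0 (negPf x0) orbF fmorph_eq0 => /eqP m0 [].
have [[m mu]|nu] := pselect (exists m, u = qcomb m e).
  by exists e; split => // v; rewrite inE => /orP[/eqP -> |]; [exists m | exact: sp].
have crcons m : qcomb m (rcons e u) = qcomb m e + ratr (m (size e)) * u.
  rewrite /qcomb size_rcons big_ord_recr /= nth_rcons ltnn eqxx; congr (_ + _).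
  by apply: eq_bigr => i _; rewrite nth_rcons ltn_ord.
exists (rcons e u); split.
- by rewrite nth_rcons se.
- by rewrite size_rcons.
- move=> m; rewrite crcons; have [m0|m0] := eqVneq (m (size e)) 0.
    rewrite m0 rmorph0 mul0r addr0 => /fr h i; rewrite size_rcons ltnS leq_eqVlt.
    by case/orP => [/eqP ->|/h].
  move=> E; exfalso; apply: nu; exists (fun i => - (m i / m (size e))).
  have m0' : (ratr (m (size e)) : F) != 0 by rewrite fmorph_eq0.
  apply: (mulfI m0'); move/eqP: E; rewrite addr_eq0 => /eqP E.
  rewrite -[LHS]opprK -E /qcomb mulr_sumr -sumrN; apply: eq_bigr => i _.
  by rewrite rmorphN rmorphM fmorphV mulNr mulrN mulrA mulrCA divff // mulr1.
move=> v; rewrite inE => /orP[/eqP -> |vs].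
  exists (fun i => (i == size e)%:R); rewrite crcons eqxx rmorph1 mul1r /qcomb big1 ?add0r // => i _.
  by rewrite ltn_eqF // rmorph0 mul0r.
have [m ->] := sp v vs; exists (fun i => if (i < size e)%N then m i else 0).
rewrite crcons ltnn rmorph0 mul0r addr0; apply: eq_bigr => i _.
by rewrite ltn_ord.
Qed.

(* A Q-linear form on the Q-span of [s], normalised at [x]. *)
Lemma rat_functional (x : F) (s : seq F) : x != 0 -> x \in s -> exists l : F -> rat,
  [/\ l x = 1, l 0 = 0
    & forall (I : finType) (u : I -> F) (c : I -> rat), (forall i, u i \in s) ->
        \sum_i u i * ratr (c i) = 0 -> \sum_i l (u i) * c i = 0].
Proof.
move=> x0 xs; have [e [e0 se fr sp]] := qfree_basis s x0.
have [m Hm] : {m : F -> nat -> rat & forall u, u \in s -> u = qcomb (m u) e}.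
  apply: (@choice _ _ (fun u m => u \in s -> u = qcomb m e)) => u.
  by have [/sp [m ->]|us] := boolP (u \in s); [exists m | exists (fun=> 0)].
have lin (I : finType) (u : I -> F) (c : I -> rat) : (forall i, u i \in s) ->
    \sum_i u i * ratr (c i) = 0 -> \sum_i m (u i) 0%N * c i = 0.
  move=> us E; apply: (fr (fun j => \sum_i m (u i) j * c i)) se.
  rewrite -[RHS]E /qcomb; under eq_bigr do rewrite rmorph_sum mulr_suml.
  rewrite exchange_big; apply: eq_bigr => i _ /=; rewrite [in RHS](Hm _ (us i)) mulr_suml.
  by apply: eq_bigr => j _; rewrite rmorphM mulrAC.
exists (fun u => if u == 0 then 0 else m u 0%N); split.
- rewrite (negPf x0); have := fr (fun i => m x i - (i == 0%N)%:R) _ 0%N se.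
  move=> h; apply/eqP; rewrite -subr_eq0; apply/eqP; rewrite -[1]/((0%N == 0%N)%:R); apply: h.
  rewrite /qcomb; under eq_bigr do rewrite rmorphB mulrBl.
  rewrite sumrB -/(qcomb _ _) -(Hm x xs) -(prednK se) big_ord_recl big1 => [|i _].
    by rewrite rmorph1 mul1r addr0 e0 subrr.
  by rewrite rmorph0 mul0r.
- by rewrite eqxx.
move=> I u c us E; rewrite -[RHS](lin _ u c us E); apply: eq_bigr => i _.
case: eqP => // ui; rewrite mul0r; suff -> : m (u i) 0%N = 0 by rewrite mul0r.
by apply: (fr (m (u i))) se; rewrite -(Hm _ (us i)).
Qed.

End Functional.

Section Series.
Variable K : comNzRingType.
Implicit Types (g f : pser K) (P : {poly {poly K}}).

Definition pexpand N f : pser K := PSer (fun n => if (N %| n)%N then cf f (n %/ N) else 0).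

Definition jmono g N A B a b : pser K :=
  pX ^+ (A - a) * g ^+ a * (pX ^+ (N * (B - b)) * pexpand N g ^+ b).

Definition jseries g N A B P := \sum_(b < B) \sum_(a < A) pconst P`_b`_a * jmono g N A B a b.

Lemma cf_jseries g N A B P n : cf (jseries g N A B P) n =
  \sum_(b < B) \sum_(a < A) P`_b`_a * cf (jmono g N A B a b) n.
Proof. by rewrite cf_sum; apply: eq_bigr => b _; rewrite cf_sum; apply: eq_bigr => a _; rewrite cfMc. Qed.

Definition fits A B P := (size P <= B)%N /\ forall b, (size (P`_b)%R <= A)%N.

Lemma sum_ord_widen (V : nmodType) (F : nat -> V) n m : (n <= m)%N ->
  (forall i, (n <= i)%N -> F i = 0) -> \sum_(i < m) F i = \sum_(i < n) F i.
Proof.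
move=> nm h; rewrite -!(big_mkord xpredT F) (big_cat_nat _ nm) //= [X in _ + X]big_nat_cond.
by rewrite [X in _ + X]big1 ?addr0 // => i /andP[/andP[ni _] _]; apply: h.
Qed.

Lemma jseries_widen g N A B A' B' P : fits A B P -> (A <= A')%N -> (B <= B')%N ->
  jseries g N A' B' P = pX ^+ ((A' - A) + N * (B' - B)) * jseries g N A B P.
Proof.
move=> [sB sA] AA BB; rewrite /jseries mulr_sumr.
have c0 : pconst 0 = 0 :> pser K by apply: pserP => -[|n].
rewrite (sum_ord_widen (F := fun b => \sum_(a < A') pconst P`_b`_a * jmono g N A' B' a b) BB); last first.
  move=> b bB; rewrite big1 // => a _; rewrite [P`_b]nth_default ?coef0 ?c0 ?mul0r //.
  exact: leq_trans bB.
apply: eq_bigr => b _; rewrite mulr_sumr.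
rewrite (sum_ord_widen (F := fun a => pconst P`_b`_a * jmono g N A' B' a b) AA); last first.
  by move=> a aA; rewrite nth_default ?c0 ?mul0r // (leq_trans (sA b)).
apply: eq_bigr => a _; rewrite [RHS]mulrCA; congr (_ * _); rewrite /jmono.
have -> : (A' - a = (A' - A) + (A - a))%N by have := ltn_ord a; lia.
have -> : (B' - b = (B' - B) + (B - b))%N by have := ltn_ord b; lia.
rewrite mulnDr !exprD; move: (pX ^+ _) (pX ^+ _) (pX ^+ _) (pX ^+ _) (g ^+ _) (_ ^+ b) => x y z t u v; ring.
Qed.

Lemma pXM_eq0 m f : pX ^+ m * f = 0 -> f = 0.
Proof.
by move=> h; apply: pserP => n; have := congr1 (fun f => cf f (n + m)) h;
  rewrite cf_pXnM leq_addl addnK !cf0.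
Qed.

Lemma jseries_fits g N A B A' B' P : fits A B P -> fits A' B' P ->
  jseries g N A B P = 0 -> jseries g N A' B' P = 0.
Proof.
move=> h h' E; apply: (@pXM_eq0 ((maxn A A' - A') + N * (maxn B B' - B'))).
rewrite -(jseries_widen g N h') ?leq_maxr //.
by rewrite (jseries_widen g N h) ?leq_maxl // E mulr0.
Qed.

Lemma jseriesB g N A B P Q : jseries g N A B (P - Q) = jseries g N A B P - jseries g N A B Q.
Proof.
apply: pserP => n; rewrite cfB !cf_jseries -sumrB; apply: eq_bigr => b _.
by rewrite -sumrB; apply: eq_bigr => a _; rewrite !coefB mulrBl.
Qed.

End Series.

Lemma psmap_jmono (K L : comNzRingType) (phi : {rmorphism K -> L}) g N A B a b :
  psmap phi (jmono g N A B a b) = jmono (psmap phi g) N A B a b.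
Proof.
have E : psmap phi (pexpand N g) = pexpand N (psmap phi g).
  by apply: pserP => n /=; case: ifP => // _; rewrite rmorph0.
by rewrite /jmono !rmorphM !rmorphXn /= E psmapX.
Qed.

Definition qmono N A B a b n : rat := cf (jmono (pJ rat) N A B a b) n.

Definition qvan N A B (c : nat -> nat -> rat) := forall n,
  \sum_(x : 'I_B * 'I_A) c x.1 x.2 * qmono N A B x.2 x.1 n = 0.

Definition jF (F : numFieldType) : pser F := psmap (ratr : {rmorphism rat -> F}) (pJ rat).

Lemma cf_jseries_jF (F : numFieldType) N A B (P : {poly {poly F}}) n :
  cf (jseries (jF F) N A B P) n =
  \sum_(x : 'I_B * 'I_A) P`_(x.1)`_(x.2) * ratr (qmono N A B x.2 x.1 n).
Proof.
rewrite cf_jseries pair_bigA; apply: eq_bigr => x _; congr (_ * _).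
by rewrite /qmono /jF -psmap_jmono.
Qed.

(* The coefficients of the monomials in j(z) and j(Nz) are rational, so a Q-linear form
   applied to the coefficients of a relation gives a rational relation. *)
Lemma descend (F : numFieldType) N A B (P : {poly {poly F}}) (b0 a0 : nat) :
  P`_b0`_a0 != 0 -> fits A B P -> jseries (jF F) N A B P = 0 ->
  exists Q : {poly {poly rat}},
    [/\ qvan N A B (fun b a => Q`_b`_a), (forall b, P`_b = 0 -> Q`_b = 0),
        fits A B Q, Q`_b0`_a0 = 1
      & forall b a, P`_b`_a = 0 -> Q`_b`_a = 0].
Proof.
move=> p0 [sB sA] E; pose s := P`_b0`_a0 :: [seq P`_(nat_of_ord x.1)`_(nat_of_ord x.2) | x : 'I_B * 'I_A <- enum {: 'I_B * 'I_A}].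
have [l [l1 l0 lin]] := rat_functional p0 (mem_head _ _ : _ \in s).
pose Q : {poly {poly rat}} := \poly_(b < B) \poly_(a < A) l P`_b`_a.
have EQ b a : Q`_b`_a = l P`_b`_a.
  rewrite coef_poly; case: ltnP => [_|bB]; last first.
    by rewrite coef0 [P`_b]nth_default ?coef0 ?l0 // (leq_trans sB).
  rewrite coef_poly; case: ltnP => // aA.
  by rewrite nth_default ?l0 // (leq_trans (sA b)).
exists Q; split.
- move=> n; under eq_bigr do rewrite EQ; apply: lin => [x|].
    by rewrite inE; apply/orP; right; apply/mapP; exists x; rewrite ?mem_enum.
  by rewrite -cf_jseries_jF E cf0.
- by move=> b Pb; apply/polyP => a; rewrite EQ Pb !coef0 l0.
- split=> [|b]; first exact: size_poly.
  by rewrite coef_poly; case: ifP => _; rewrite ?size_poly0 ?size_poly.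
- by rewrite EQ l1.
by move=> b a Pba; rewrite EQ Pba l0.
Qed.

Definition liftQ (F : numFieldType) (Q : {poly {poly rat}}) : {poly {poly F}} :=
  map_poly (map_poly (ratr : {rmorphism rat -> F})) Q.

Section LiftQ.
Variables (F : numFieldType) (Q : {poly {poly rat}}).

Lemma coef_liftQ b : (liftQ F Q)`_b = map_poly ratr Q`_b.
Proof. by rewrite coef_map. Qed.

Lemma size_liftQ : size (liftQ F Q) = size Q.
Proof. by apply: size_map_inj_poly; [exact: map_poly_inj | rewrite rmorph0]. Qed.

Lemma fits_liftQ A B : fits A B (liftQ F Q) <-> fits A B Q.
Proof.
by split=> -[h1 h2]; split; rewrite ?size_liftQ // -?size_liftQ // => b; have := h2 b;
  rewrite coef_liftQ size_map_poly.
Qed.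

Lemma qvan_liftQ N A B : qvan N A B (fun b a => Q`_b`_a) -> jseries (jF F) N A B (liftQ F Q) = 0.
Proof.
move=> h; apply: pserP => n; rewrite cf_jseries_jF cf0 -[RHS](rmorph0 (ratr : {rmorphism rat -> F})) -(h n).
by rewrite rmorph_sum; apply: eq_bigr => x _; rewrite coef_liftQ coef_map rmorphM.
Qed.

Lemma diag_liftQ : (liftQ F Q).['X] = map_poly ratr Q.['X].
Proof. by rewrite -(map_polyX (ratr : {rmorphism rat -> F})) -horner_map. Qed.

End LiftQ.

Lemma frac_mul_pow (F : fieldType) (p u s v t x y : F) : x != 0 -> y != 0 ->
  p * (u * s * (v * t)) = u * x * (v * y) * (p * (s / x) * (t / y)).
Proof. by move=> x0 y0; field; rewrite x0 y0. Qed.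

Section Complex.
Variable R : realType.
Local Notation C := R[i].
Local Notation Im := (@complex.Im R).
Local Notation J := (@J R).
Variable N : nat.
Hypothesis N0 : (0 < N)%N.

Lemma ev_jseries A B (P : {poly {poly C}}) z : fits A B P -> 0 < Im z ->
  ev (jseries (jF C) N A B P) (eC z) =
  eC z ^+ A * eC (N%:R * z) ^+ B * beval P (J z) (J (N%:R * z)).
Proof.
move=> [sB sA] z0; have q1 := eC_lt1 z0; have cX := CV_X R; have cj := @CV_cJ R.
have Eexp : pexpand N (cJ R) = psub N 1 (cJ R).
  by apply: pserP => n; rewrite /= expr1n mulr1.
have cs := CV_psub N0 (normc1 R) cj.
have cm a b : CV (jmono (jF C) N A B a b).
  rewrite /jmono -[jF C]/(cJ R) Eexp.
  exact: (CV_mul (CV_mul (CV_exp _ cX) (CV_exp _ cj)) (CV_mul (CV_exp _ cX) (CV_exp _ cs))).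
have ct (b : 'I_B) (a : 'I_A) : CV (pconst P`_b`_a * jmono (jF C) N A B a b).
  exact: (CV_mul (CV_const _) (cm a b)).
have cr (b : 'I_B) : CV (\sum_(a < A) pconst P`_b`_a * jmono (jF C) N A B a b).
  by apply: CV_sum => a _; exact: ct.
rewrite /jseries (ev_sum _ (fun b _ => cr b) q1).
rewrite /beval (horner_coef_wide _ (leq_trans (size_poly _ _) sB)) mulr_sumr.
apply: eq_bigr => b _; rewrite (ev_sum _ (fun a _ => ct b a) q1).
rewrite coef_map /= horner_evalE (horner_coef_wide _ (sA b)) mulr_suml mulr_sumr.
apply: eq_bigr => a _; rewrite (evM (CV_const _) (cm a b) q1) (ev_const _ q1).
rewrite /jmono -[jF C]/(cJ R) Eexp.
rewrite (evM (CV_mul (CV_exp _ cX) (CV_exp _ cj)) (CV_mul (CV_exp _ cX) (CV_exp _ cs)) q1).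
rewrite (evM (CV_exp _ cX) (CV_exp _ cj) q1) (evM (CV_exp _ cX) (CV_exp _ cs) q1).
rewrite !(ev_exp _ cX q1) (ev_exp _ cj q1) (ev_exp _ cs q1) (evX q1).
rewrite (ev_psub N0 (normc1 R) cj q1) mul1r eC_natM exprM /J eC_natM.
have qa : (eC z : C) ^+ a != 0 by rewrite expf_neq0 // eC_neq0.
have qb : (eC z ^+ N : C) ^+ b != 0 by rewrite !expf_neq0 // eC_neq0.
have EA : eC z ^+ A = eC z ^+ (A - a) * eC z ^+ a :> C.
  by rewrite -exprD subnK // ltnW.
have EB : (eC z ^+ N) ^+ B = (eC z ^+ N) ^+ (B - b) * (eC z ^+ N) ^+ b :> C.
  by rewrite -[RHS]exprD subnK // ltnW.
rewrite EA EB !expr_div_n {EA EB}.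
exact: (frac_mul_pow _ _ _ _ _ qa qb).
Qed.

Lemma jseries_eq0 A B (P : {poly {poly C}}) : fits A B P ->
  jseries (jF C) N A B P = 0 <-> forall z, 0 < Im z -> beval P (J z) (J (N%:R * z)) = 0.
Proof.
move=> fP; split=> h.
  move=> z z0; have := ev_jseries fP z0; rewrite h (ev0 (eC_lt1 z0)) => /esym /eqP.
  by rewrite !mulf_eq0 !expf_eq0 !(negPf (eC_neq0 _)) !andbF /= => /eqP.
apply: (@ev_eq0 _ _ 1) => //; last first.
  have z0 x : 0 < Im (Complex x 1) by rewrite /= ltr01.
  by move=> x; rewrite (ev_jseries fP (z0 x)) h ?z0 // mulr0.
have cX := CV_X R; have cj := @CV_cJ R.
have cs := CV_psub N0 (normc1 R) cj.
have Eexp : pexpand N (cJ R) = psub N 1 (cJ R).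
  by apply: pserP => n; rewrite /= expr1n mulr1.
apply: CV_sum => b _; apply: CV_sum => a _.
rewrite /jmono -[jF C]/(cJ R) Eexp.
exact: (CV_mul (CV_const _) (CV_mul (CV_mul (CV_exp _ cX) (CV_exp _ cj)) (CV_mul (CV_exp _ cX) (CV_exp _ cs)))).
Qed.

Lemma bevalB P Q x y : beval (P - Q) x y = beval P x y - beval Q x y :> C.
Proof. by rewrite /beval rmorphB hornerD hornerN. Qed.

Lemma fits_exists (F : nzRingType) (P : {poly {poly F}}) :
  exists A, (forall b, size (P`_b)%R <= A)%N.
Proof.
exists (\max_(b < size P) size (P`_b)%R)%N => b.
case: (ltnP b (size P)) => bP; last by rewrite nth_default ?size_poly0.
exact: (leq_bigmax (Ordinal bP)).
Qed.

Lemma exists_rat_modular_poly : exists A B (Q : {poly {poly rat}}),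
  [/\ fits A B Q, Q \is monic, size Q = (size (Sph N)).+1,
      qvan N A B (fun b a => Q`_b`_a)
    & forall z, 0 < Im z -> map_poly (horner_eval (J z)) (liftQ C Q) = charpoly N z].
Proof.
have [P [mP sP hP]] := exists_modular_poly R N0; set n := size (Sph N) in sP.
have [A sA] := fits_exists P; have fP : fits A n.+1 P by split; rewrite ?sP.
have Pn : P`_n = 1 by move/monicP: mP; rewrite lead_coefE sP.
have pn0 : P`_n`_0 != 0 by rewrite Pn coef1 oner_neq0.
have vP : jseries (jF C) N A n.+1 P = 0.
  by apply/(jseries_eq0 fP) => z z0; exact: (beval_charpoly N0 hP z0).
have [Q [vQ Q0 fQ Q1 Qz]] := descend pn0 fP vP.
have Qn : Q`_n = 1.
  apply/polyP => -[|a]; rewrite ?Q1 ?coef1 //.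
  by apply: Qz; rewrite Pn coef1.
have sQ : size Q = n.+1.
  apply/eqP; rewrite eqn_leq fQ.1 /= ltnNge; apply/negP => sQ.
  by have := oner_neq0 {poly rat}; rewrite -Qn nth_default ?eqxx.
have mQ : Q \is monic by rewrite monicE lead_coefE sQ Qn.
exists A, n.+1, Q; split => //.
have fQC : fits A n.+1 (liftQ C Q) by apply/fits_liftQ.
have vQC := (jseries_eq0 fQC).1 (qvan_liftQ C vQ).
suff <- : P = liftQ C Q by [].
apply/eqP; rewrite -subr_eq0; apply/negPn/negP => D0.
have := size_vanishing N0 D0 (_ : forall z, 0 < Im z -> _).
have sD : (size (P - liftQ C Q)%R <= n)%N.
  have : (size (P - liftQ C Q)%R <= n.+1)%N.
    by apply: leq_trans (size_polyD _ _) _; rewrite size_polyN size_liftQ sQ sP maxnn.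
  rewrite leq_eqVlt => /orP[/eqP E|//]; exfalso; move/negP: D0; apply.
  have E1 : (liftQ C Q)`_n = 1.
    by rewrite coef_liftQ Qn; exact: (rmorph1 (map_poly (ratr : {rmorphism rat -> C}))).
  by rewrite -lead_coef_eq0 lead_coefE E [_.-1]/= coefB E1 Pn subrr.
rewrite ltnNge sD => h; apply/notF/h => z z0.
by rewrite bevalB vQC // (beval_charpoly N0 hP z0) subrr.
Qed.

Lemma size_rat_vanishing A B (Q : {poly {poly rat}}) : fits A B Q -> Q != 0 ->
  qvan N A B (fun b a => Q`_b`_a) -> (size (Sph N) < size Q)%N.
Proof.
move=> fQ Q0 vQ; have fQC : fits A B (liftQ C Q) by apply/fits_liftQ.
rewrite -(size_liftQ C); apply: (@size_vanishing R N N0).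
  by rewrite -size_poly_eq0 size_liftQ size_poly_eq0.
exact: (jseries_eq0 fQC).1 (qvan_liftQ C vQ).
Qed.

End Complex.

Import Rstruct.

Local Notation RR := (Rdefinitions.R : realType).

Section Algebraic.
Variable N : nat.
Hypothesis N0 : (0 < N)%N.
Implicit Types P Q : {poly {poly algC}}.

Lemma fits_xbound P : fits (xbound P) (size P) P.
Proof.
split=> // b; case: (ltnP b (size P)) => bP; last by rewrite nth_default ?size_poly0.
exact: (leq_bigmax (Ordinal bP)).
Qed.

Lemma jsubstE P : jsubst N P = cf (jseries (jF algC) N (xbound P) (size P) P).
Proof.
have E : PSer (qjN N) = pexpand N (PSer qj) by [].
apply/funext => n; rewrite cf_jseries /jsubst; apply: eq_bigr => b _; apply: eq_bigr => a _.
congr (_ * _); rewrite fps_mulE !fps_shiftE !fps_powE !PSerK E qjE.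
by [].
Qed.

Lemma vanishes_jNP P : vanishes_jN N P <-> jseries (jF algC) N (xbound P) (size P) P = 0.
Proof.
split=> [h|h n]; last by rewrite jsubstE h cf0.
by apply: pserP => n; rewrite -jsubstE cf0.
Qed.

Lemma size_vanishes_jN Q : Q != 0 -> vanishes_jN N Q -> (size (Sph N) < size Q)%N.
Proof.
move=> Q0 /vanishes_jNP vQ; have fQ := fits_xbound Q.
have c0 : Q`_(size Q).-1`_(size (lead_coef Q)).-1 != 0.
  by rewrite -lead_coefE -lead_coefE !lead_coef_eq0.
have [Q' [vQ' _ fQ' Q1 _]] := descend c0 fQ vQ.
apply: leq_trans (size_rat_vanishing RR N0 fQ' _ vQ') fQ'.1.
by apply: contra_eq_neq Q1 => ->; rewrite !coef0 eq_sym oner_neq0.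
Qed.

Lemma modular_poly_uniq P Q : is_modular_poly N P -> is_modular_poly N Q -> P = Q.
Proof.
move=> [mP vP minP] [mQ vQ minQ]; apply/eqP; rewrite -subr_eq0; apply/negPn/negP => D0.
have sPQ : size P = size Q.
  by apply/eqP; rewrite eqn_leq minP ?minQ ?monic_neq0.
have sD : (size (P - Q)%R < size P)%N.
  have sP0 : (0 < size P)%N by rewrite size_poly_gt0 monic_neq0.
  have : (size (P - Q)%R <= size P)%N.
    by apply: leq_trans (size_polyD _ _) _; rewrite size_polyN sPQ maxnn.
  rewrite leq_eqVlt => /orP[/eqP E|//]; exfalso; move/negP: D0; apply.
  rewrite -lead_coef_eq0 lead_coefE E /= coefB {2}sPQ -!lead_coefE.
  by rewrite (monicP mP) (monicP mQ) subrr.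
have : vanishes_jN N (P - Q).
  apply/vanishes_jNP; pose A := maxn (xbound P) (xbound Q).
  have [_ fP] := fits_xbound P; have [_ fQ] := fits_xbound Q.
  have hP : fits A (size P) P by split=> // b; rewrite (leq_trans (fP b)) ?leq_maxl.
  have hQ : fits A (size P) Q by split=> [|b]; rewrite ?sPQ // (leq_trans (fQ b)) ?leq_maxr.
  have hD : fits A (size P) (P - Q).
    split=> [|b]; first exact: ltnW.
    rewrite coefB (leq_trans (size_polyD _ _)) // size_polyN geq_max.
    by rewrite (leq_trans (fP b)) ?leq_maxl // (leq_trans (fQ b)) ?leq_maxr.
  apply: (jseries_fits hD (fits_xbound _)); rewrite jseriesB.
  rewrite (jseries_fits (fits_xbound P) hP ((vanishes_jNP P).1 vP)).
  by rewrite (jseries_fits (fits_xbound Q) hQ ((vanishes_jNP Q).1 vQ)) subrr.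
by move=> /(minP _ D0); rewrite leqNgt sD.
Qed.

Lemma size_diag_le_totdeg P : ((size (diag P)).-1 <= totdeg P)%N.
Proof.
rewrite /diag horner_coef; set S := \sum_(i < _) _.
suff : (size S <= (totdeg P).+1)%N by case: (size S).
apply: leq_trans (size_sum _ _ _) _; apply/bigmax_leqP => b _.
have [->|b0] := eqVneq (P`_b) 0; first by rewrite mul0r size_poly0.
apply: leq_trans (size_polyMleq _ _) _; rewrite size_polyXn addnS /=.
have : (b + (size (ycoef P b)).-1 <= totdeg P)%N.
  exact: (@leq_bigmax_cond _ (fun b : 'I_(size P) => ycoef P b != 0)
    (fun b : 'I_(size P) => b + (size (ycoef P b)).-1)%N b).
rewrite /ycoef; have : (0 < size (P`_b)%R)%N by rewrite size_poly_gt0.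
by case: (size (P`_b)%R) => // s _ /=; rewrite addSn ltnS addnC.
Qed.

End Algebraic.

Theorem theorem1 (N : nat) (hN : (2 <= N)%N) :
  (exists P, is_modular_poly N P) /\
  (forall P, is_modular_poly N P ->
     totdeg P = (size (diag P)).-1 /\ (size (diag P)).-1 = deg_formula N).
Proof.
have N0 : (0 < N)%N := ltnW hN.
have [A [B [Q [fQ mQ sQ vQ hQ]]]] := exists_rat_modular_poly RR N0.
have mod : is_modular_poly N (liftQ algC Q).
  split.
  - by rewrite monicE lead_coefE size_liftQ coef_liftQ -lead_coefE (monicP mQ) rmorph1.
  - apply/vanishes_jNP; have fA : fits A B (liftQ algC Q) by apply/fits_liftQ.
    exact: (jseries_fits fA (fits_xbound _) (qvan_liftQ algC vQ)).
  by move=> P P0 vP; rewrite size_liftQ sQ; exact: size_vanishes_jN.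
split; first by exists (liftQ algC Q).
move=> P mP; rewrite (modular_poly_uniq mP mod).
have dQ : (size (diag (liftQ algC Q))).-1 = deg_formula N.
  by rewrite -(size_diag hN hQ) /diag !diag_liftQ !size_map_poly.
split => //; apply/eqP; rewrite eqn_leq size_diag_le_totdeg andbT dQ.
apply/bigmax_leqP => b; rewrite /ycoef coef_liftQ => b0.
have := size_coef_bound hN hQ (_ : (liftQ RR[i] Q)`_b != 0).
rewrite coef_liftQ !size_map_poly; apply.
by move: b0; rewrite -!size_poly_eq0 !size_map_poly.
Qed.
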